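(* Let $0<d<n$ ($d$ real, $n$ an integer) and let $\mu$ be a $d$-dimensional Ahlfors regular measure supported on the closed set $E\subset\mathbb R^n$ (i.e. with support $E$). Suppose that for some $\alpha>0$ the function $D_{\mu,\alpha}$ is such that, on $\Omega=\mathbb R^n\setminus E$, $|\nabla D_{\mu,\alpha}|$ is locally constant and positive. Then $d$ is an integer, $E$ is a $d$-plane (an affine $d$-dimensional subspace), and the density of $\mu$ with respect to $\mathcal H^d|_E$ is constant. If $d<n-1$, there is a constant $c>0$ such that $D_{\mu,\alpha}(x)=c\,\mathrm{dist}(x,E)$ for $x\in\Omega$.
   Context: A measure $\mu$ with support the closed set $E\subset\mathbb R^n$ is $d$-Ahlfors regular if there is $C\ge1$ with $C^{-1}r^d\le\mu(B(Q,r))\le Cr^d$ for all $Q\in E$ and $0<r<\mathrm{diam}(E)$. Standing assumption: $E$ is unbounded. For $\alpha>0$ and $x\in\Omega$, $R_{\mu,\alpha}(x)=\int_E|x-y|^{-d-\alpha}\,d\mu(y)$ and $D_{\mu,\alpha}(x)=R_{\mu,\alpha}(x)^{-1/\alpha}$. $\mathcal H^d|_E$ is the restriction to $E$ of $d$-dimensional Hausdorff measure. *)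

(* Defs.v *)
From HB Require Import structures.
From mathcomp Require Import all_boot all_order all_algebra.
From mathcomp Require Import all_classical all_reals all_analysis.

Set Implicit Arguments.
Unset Strict Implicit.
Unset Printing Implicit Defensive.

Import Order.TTheory GRing.Theory Num.Theory.
Import numFieldNormedType.Exports.

Local Open Scope classical_set_scope.
Local Open Scope ring_scope.

(* MathComp-Analysis norms 'rV[R]_n with the sup norm. It is used below only
   through the topology it induces (open, closed, near, derivatives) and the
   bounded sets, which are the Euclidean ones; every metric quantity is written
   with [enorm]. *)
Definition enorm (R : realType) (n : nat) (x : 'rV[R]_n) : R :=
  Num.sqrt (\sum_(i < n) x 0 i ^+ 2).

Definition eball (R : realType) (n : nat) (x : 'rV[R]_n) (r : R)
    : set 'rV[R]_n := [set y | enorm (x - y) < r].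

Definition dist_to (R : realType) (n : nat) (E : set 'rV[R]_n) (x : 'rV[R]_n)
    : R := inf [set enorm (x - y) | y in E].

(* The element 0 makes the diameter of the empty set 0 instead of -oo. *)
Definition ediam (R : realType) (n : nat) (A : set 'rV[R]_n) : \bar R :=
  ereal_sup (0%E |` [set (enorm (x - y))%:E | x in A & y in A]).

Notation borelRn R n := (g_sigma_algebraType (@open 'rV[R]_n)).

Definition measure_support (R : realType) (n : nat)
    (mu : {measure set borelRn R n -> \bar R}) : set 'rV[R]_n :=
  [set x | forall U : set 'rV[R]_n, open_nbhs x U -> (0 < mu U)%E].

Definition ahlfors_regular (R : realType) (n : nat) (d : R)
    (mu : {measure set borelRn R n -> \bar R}) (E : set 'rV[R]_n) : Prop :=
  [/\ closed E,
      measure_support mu = E &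
      exists2 C : R, 1 <= C &
        forall (Q : 'rV[R]_n) (r : R), E Q -> 0 < r -> (r%:E < ediam E)%E ->
          ((C^-1 * r `^ d)%:E <= mu (eball Q r) <= (C * r `^ d)%:E)%E].

Definition Rmu (R : realType) (n : nat) (d alpha : R)
    (mu : {measure set borelRn R n -> \bar R}) (E : set 'rV[R]_n)
    (x : 'rV[R]_n) : \bar R :=
  (\int[mu]_(y in E) (enorm (x - (y : 'rV[R]_n)) `^ (- d - alpha))%:E)%E.

(* Meant for x outside E, where [Rmu] is finite and positive as soon as mu is
   Ahlfors regular with unbounded support E; the value on E is irrelevant. *)
Definition Dmu (R : realType) (n : nat) (d alpha : R)
    (mu : {measure set borelRn R n -> \bar R}) (E : set 'rV[R]_n)
    (x : 'rV[R]_n) : R :=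
  fine (Rmu d alpha mu E x) `^ (- alpha^-1).

Definition gradient (R : realType) (n : nat) (f : 'rV[R]_n -> R)
    (x : 'rV[R]_n) : 'rV[R]_n :=
  \row_(i < n) 'D_(delta_mx 0 i) f x.

Definition locally_constant_on (R : realType) (n : nat) (Omega : set 'rV[R]_n)
    (f : 'rV[R]_n -> R) : Prop :=
  forall x, Omega x -> \forall y \near x, Omega y -> f y = f x.

(* Hausdorff measure of dimension d > 0, as an outer measure on all subsets,
   without normalizing constant. Covers are sequences, finite covers being
   padded with empty sets, which contribute 0 `^ d = 0. *)
Definition hausdorff_content (R : realType) (n : nat) (d delta : R)
    (A : set 'rV[R]_n) : \bar R :=
  ereal_inf [set (\sum_(0 <= i <oo) (ediam (U i) `^ d))%E
    | U in [set U : nat -> set 'rV[R]_n |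
        A `<=` \bigcup_i U i /\ forall i, (ediam (U i) <= delta%:E)%E]].

Definition hausdorff (R : realType) (n : nat) (d : R) (A : set 'rV[R]_n)
    : \bar R :=
  ereal_sup [set hausdorff_content d delta A | delta in [set e : R | 0 < e]].

Definition affine_plane (R : realType) (n k : nat) (E : set 'rV[R]_n) : Prop :=
  exists (p : 'rV[R]_n) (V : {vspace 'rV[R]_n}),
    \dim V = k /\ E = [set x | x - p \in V].

(* Main.v *)
(* D is differentiable off E and its gradient has locally constant norm
   c. Maximizing - D(y) - c' |y - x| and D(y) - c' |y - x| over balls for c' < c shows that
   D(x) = c dist(x, E), and that if q in E is nearest to x, then q is nearest to every
   point of the ray from q through x. So E misses an open half-space containing x
   whose boundary contains q, for every x off E, and E is convex. As d < n, packing
   disjoint balls at the points of a grid shows that E lies in a hyperplane; let f be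
   normal to the affine span L of E. If x in L were off E, with nearest point q, then
   D(q + f + s(x - q)) <= c |f + s(x - q)| = c |f| + O(s^2), so the derivative of D at
   q + f along x - q vanishes; this derivative is the integral of a function which has
   the sign of (y - q).(x - q) <= 0, so E is orthogonal to x - q, which is absurd. Hence
   E = L, and its dimension is d by covering with a grid.

   D(x + f) depends only on |f| for x in E and f normal to E, so D = c dist(., E) with one
   constant c. This says that the integral of K_t(x, .) against mu does not depend
   on x in E nor on t > 0, for K_t(x, y) = t^alpha (|x - y|^2 + t^2)^(- (d + alpha) / 2).
   The same holds for nu, the Hausdorff measure on E, by translation and dilation.
   Integrating K_t over U x U against mu x nu, in both orders, and letting t tend to 0,
   where K_t concentrates near the diagonal, gives kappa mu(U) = c' nu(U) for U open. *)
Require Import Defs.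
From HB Require Import structures.
From mathcomp Require Import all_boot all_order all_algebra.
From mathcomp Require Import all_classical all_reals all_analysis.
From mathcomp Require Import measurable_realfun zify ring lra.

Import Order.TTheory GRing.Theory Num.Theory.
Import numFieldNormedType.Exports.

Local Open Scope classical_set_scope.
Local Open Scope ring_scope.

Set Implicit Arguments.
Unset Strict Implicit.
Unset Printing Implicit Defensive.

(** * Euclidean geometry of row vectors *)

Section euclid.
Context {R : realType} {n : nat}.
Implicit Types (x y z v : 'rV[R]_n) (a r s : R).

(** Off [E] the function [D] is handled only through first-order expansions with a quadratic
    remainder, so integral curves of its gradient are out of reach; extremal points on balls take
    their place. Two facts make this work up to [E]. The potential is finite, because an infinite
    value would spread to a neighbourhood, where the gradient would vanish. And Ahlfors regularity
    forces [D] to tend to 0 at [E] at most linearly, which fixes the boundary value. The complement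
    of [E] may have two components, so a single slope cannot come from connectedness; it comes from
    the symmetry of the potential about the plane. In the last step nothing is known of [mu] beyond
    its potentials, in particular no invariance. Each of the two inequalities between kappa [mu] and
    c [nu] needs a lower limit for one measure, through Fatou's lemma, and an upper bound of the
    total integral for the other. The finiteness of kappa is not known beforehand; it results from
    comparing both sides on one ball. *)

Definition dot x y : R := \sum_(i < n) x 0 i * y 0 i.

Lemma dotC x y : dot x y = dot y x.
Proof. by apply: eq_bigr => i _; rewrite mulrC. Qed.

Lemma dotDl x y z : dot (x + y) z = dot x z + dot y z.
Proof. by rewrite -big_split; apply: eq_bigr => i _; rewrite mxE mulrDl. Qed.

Lemma dotZl a x z : dot (a *: x) z = a * dot x z.
Proof. by rewrite /dot big_distrr; apply: eq_bigr => i _; rewrite mxE /= mulrA. Qed.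

Lemma dotNl x z : dot (- x) z = - dot x z.
Proof. by rewrite -scaleN1r dotZl mulN1r. Qed.

Lemma dotBl x y z : dot (x - y) z = dot x z - dot y z.
Proof. by rewrite dotDl dotNl. Qed.

Lemma dotDr x y z : dot x (y + z) = dot x y + dot x z.
Proof. by rewrite !(dotC x) dotDl. Qed.

Lemma dotZr a x z : dot x (a *: z) = a * dot x z.
Proof. by rewrite !(dotC x) dotZl. Qed.

Lemma dotNr x z : dot x (- z) = - dot x z.
Proof. by rewrite !(dotC x) dotNl. Qed.

Lemma dotBr x y z : dot x (y - z) = dot x y - dot x z.
Proof. by rewrite !(dotC x) dotBl. Qed.

Lemma dot0r x : dot x 0 = 0.
Proof. by rewrite -(scale0r 0) dotZr mul0r. Qed.

Lemma dot0l x : dot 0 x = 0.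
Proof. by rewrite dotC dot0r. Qed.

Lemma dot_suml (I : finType) (F : I -> 'rV[R]_n) z :
  dot (\sum_i F i) z = \sum_i dot (F i) z.
Proof.
by elim/big_ind2: _ => [|x1 y1 x2 y2 <- <-|//]; rewrite ?dot0l ?dotDl.
Qed.

Lemma dot_ge0 x : 0 <= dot x x.
Proof. by apply: sumr_ge0 => i _; rewrite -expr2 sqr_ge0. Qed.

Lemma enorm_sqr x : enorm x ^+ 2 = dot x x.
Proof.
have -> : enorm x = Num.sqrt (dot x x).
  by congr Num.sqrt; apply: eq_bigr => i _; rewrite expr2.
by rewrite sqr_sqrtr ?dot_ge0.
Qed.

Lemma enorm_ge0 x : 0 <= enorm x.
Proof. exact: sqrtr_ge0. Qed.
Hint Resolve enorm_ge0 : core.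

Lemma ler_enorm_sqr x r : 0 <= r -> (enorm x <= r) = (dot x x <= r ^+ 2).
Proof. by move=> r0; rewrite -enorm_sqr ler_sqr ?nnegrE. Qed.

Lemma enorm_eq_sqr x r : 0 <= r -> dot x x = r ^+ 2 -> enorm x = r.
Proof.
by move=> r0 h; apply/eqP; rewrite -(eqrXn2 (n:=2))// enorm_sqr h.
Qed.

Lemma enorm0 : enorm (0 : 'rV[R]_n) = 0.
Proof. by apply: enorm_eq_sqr => //; rewrite dot0l expr0n. Qed.

Lemma dot_eq0 x : (dot x x == 0) = (x == 0).
Proof.
apply/idP/eqP => [|->]; last by rewrite dot0l.
rewrite psumr_eq0; last by move=> i _; rewrite -expr2 sqr_ge0.
move=> /allP h; apply/rowP => i; rewrite mxE.
by have /= := h i (mem_index_enum _); rewrite mulf_eq0 orbb => /eqP.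
Qed.

Lemma enorm_eq0 x : (enorm x == 0) = (x == 0).
Proof. by rewrite -dot_eq0 -enorm_sqr sqrf_eq0. Qed.

Lemma enorm_gt0 x : (0 < enorm x) = (x != 0).
Proof. by rewrite lt_def enorm_eq0 enorm_ge0 andbT. Qed.

Lemma enormZ a x : enorm (a *: x) = `|a| * enorm x.
Proof.
apply: enorm_eq_sqr; first by rewrite mulr_ge0.
by rewrite dotZl dotZr exprMn real_normK ?num_real // enorm_sqr expr2 mulrA.
Qed.

Lemma enormN x : enorm (- x) = enorm x.
Proof. by rewrite -scaleN1r enormZ normrN1 mul1r. Qed.

Lemma enormBC x y : enorm (x - y) = enorm (y - x).
Proof. by rewrite -enormN opprB. Qed.

Lemma enorm_sqrD x y :
  enorm (x + y) ^+ 2 = enorm x ^+ 2 + 2 * dot x y + enorm y ^+ 2.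
Proof. by rewrite !enorm_sqr dotDl !dotDr (dotC y x); ring. Qed.

Lemma enorm_sqrB x y :
  enorm (x - y) ^+ 2 = enorm x ^+ 2 - 2 * dot x y + enorm y ^+ 2.
Proof. by rewrite enorm_sqrD dotNr enormN; ring. Qed.

Lemma cauchy_schwarz x y : `|dot x y| <= enorm x * enorm y.
Proof.
have h : 0 <= dot (dot y y *: x - dot x y *: y) (dot y y *: x - dot x y *: y).
  exact: dot_ge0.
have [y0|y0] := eqVneq y 0; first by rewrite y0 dot0r normr0 enorm0 mulr0.
have yy : 0 < dot y y by rewrite lt_def dot_eq0 y0 dot_ge0.
rewrite -ler_sqr ?nnegrE ?mulr_ge0 // real_normK ?num_real // exprMn !enorm_sqr.
move: h; rewrite !(dotBl, dotBr, dotZl, dotZr) (dotC y x) => h.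
rewrite -subr_ge0 -(pmulr_rge0 _ yy); apply: le_trans h _.
by rewrite le_eqVlt; apply/orP; left; apply/eqP; ring.
Qed.

Lemma dot_le x y : dot x y <= enorm x * enorm y.
Proof. exact: le_trans (ler_norm _) (cauchy_schwarz _ _). Qed.

Lemma enormD x y : enorm (x + y) <= enorm x + enorm y.
Proof.
rewrite -ler_sqr ?nnegrE ?addr_ge0 // enorm_sqrD sqrrD.
by have := dot_le x y; lra.
Qed.

Lemma enorm_dist y x z : enorm (x - z) <= enorm (x - y) + enorm (y - z).
Proof. by have := enormD (x - y) (y - z); rewrite addrA subrK. Qed.

Lemma enorm_sub x y : enorm x - enorm y <= enorm (x - y).
Proof. by rewrite lerBlDr -{1}(subrK y x) enormD. Qed.

(** Equality forces the scalar product to be the product of the norms, and then the difference of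
    the two sides has square norm zero. This places an extremal point on a ray. *)
Lemma enorm_colinear x y :
  enorm (x + y) = enorm x + enorm y -> enorm y *: x = enorm x *: y.
Proof.
move=> h; have : dot x y = enorm x * enorm y.
  have := enorm_sqrD x y; rewrite h sqrrD => e; lra.
move=> e; apply/eqP; rewrite -subr_eq0 -dot_eq0.
rewrite !(dotBl, dotBr, dotZl, dotZr) (dotC y x) -!enorm_sqr e.
by apply/eqP; ring.
Qed.

Lemma norm_le_enorm x : `|x| <= enorm x.
Proof.
rewrite [leLHS]/Num.norm /= mx_normrE; apply/bigmax_leP; split=> //= -[i j] _ /=.
rewrite ord1 -ler_sqr ?nnegrE // real_normK ?num_real // enorm_sqr.
rewrite /dot (bigD1 j) //= -expr2 lerDl.
by apply: sumr_ge0 => k _; rewrite -expr2 sqr_ge0.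
Qed.

Lemma enorm_le_norm x : enorm x <= n%:R * `|x|.
Proof.
have [n0|n0] := posnP n.
  have -> : enorm x = 0.
    by apply: enorm_eq_sqr => //; rewrite /dot; move: x; rewrite n0 => x; rewrite big_ord0 expr0n.
  by rewrite mulr_ge0.
rewrite ler_enorm_sqr ?mulr_ge0 // exprMn.
apply: (@le_trans _ _ (\sum_(i < n) `|x| ^+ 2)).
  apply: ler_sum => i _; rewrite -expr2 -[leLHS]real_normK ?num_real //.
  rewrite ler_sqr ?nnegrE // [leRHS]/Num.norm /= mx_normrE.
  by apply/bigmax_geP; right => /=; exists (0, i).
rewrite sumr_const card_ord -[leLHS]mulr_natl ler_wpM2r ?sqr_ge0 //.
by rewrite -natrX ler_nat leq_pmulr.
Qed.

Lemma eball_center x r : 0 < r -> eball x r x.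
Proof. by rewrite /eball /= subrr enorm0. Qed.

Lemma eball_open x r : open (eball x r).
Proof.
rewrite openE => y; rewrite /eball /= => xy.
apply/nbhs_ballP; exists ((r - enorm (x - y)) / n.+1%:R) => /=.
  by rewrite divr_gt0 // subr_gt0.
move=> z; rewrite -ball_normE /= => yz.
have := enorm_dist y x z; have := enorm_le_norm (y - z).
have : n%:R * `|y - z| <= n.+1%:R * `|y - z| by rewrite ler_wpM2r // ler_nat.
move: yz; rewrite ltr_pdivlMr // mulrC; lra.
Qed.

(** Bridge between the topology, which comes from the sup norm, and the Euclidean balls in which the
    estimates are stated. *)
Lemma nbhs_eballP x (A : set 'rV[R]_n) :
  nbhs x A <-> exists2 r, 0 < r & eball x r `<=` A.
Proof.
split=> [/nbhs_ballP[r /= r0 h]|[r r0 h]].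
  exists r => // y xy; apply: h; rewrite -ball_normE /=.
  exact: le_lt_trans (norm_le_enorm _) xy.
apply: filterS h _; apply: open_nbhs_nbhs; split; first exact: eball_open.
exact: eball_center.
Qed.

Lemma enorm_continuous_at (f : 'rV[R]_n -> R) x r k : 0 < r ->
  (forall y, enorm (x - y) < r -> `|f x - f y| <= k * enorm (x - y)) ->
  {for x, continuous f}.
Proof.
move=> r0 fk; apply/(@cvgrPdist_lt _ _ _ (nbhs x) (nbhs_filter x)) => e e0.
have k0 : 0 < `|k| + 1 by rewrite ltr_wpDl.
apply/nbhs_eballP; exists (Num.min r (e / (`|k| + 1))).
  by rewrite lt_min r0 divr_gt0.
move=> y; rewrite /eball /= lt_min => /andP[yr ye].
apply: le_lt_trans (fk _ yr) _; move: ye; rewrite ltr_pdivlMr // mulrC.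
apply: le_lt_trans; rewrite ler_wpM2r //.
by rewrite (le_trans (ler_norm k)) // lerDl.
Qed.

Lemma enorm_dist_continuous y : continuous (fun x => enorm (x - y)).
Proof.
move=> x; apply: (@enorm_continuous_at _ x 1 1) => // z _; rewrite mul1r.
rewrite ler_norml; have := enorm_dist z x y; have := enorm_dist x z y.
rewrite (enormBC z x); lra.
Qed.

Lemma enorm_dist_continuous_l y : continuous (fun x => enorm (y - x)).
Proof.
rewrite (_ : (fun x => enorm (y - x)) = (fun x => enorm (x - y))).
  exact: enorm_dist_continuous.
by apply/funext => x; rewrite enormBC.
Qed.

Lemma eball_compact x r : compact [set y | enorm (x - y) <= r].
Proof.
apply: bounded_closed_compact.
  exists (enorm x + r); split; first exact: num_real.
  move=> t tr y /= yr; apply/ltW; apply: le_lt_trans tr.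
  apply: (le_trans (norm_le_enorm _)).
  by have := enorm_dist x y 0; rewrite !subr0 (enormBC y x); lra.
rewrite (_ : [set _ | _] = (fun y => enorm (x - y)) @^-1` [set t | t <= r]) //.
by apply: (preimage_closed _ (@closed_le R r)) => y _; exact: enorm_dist_continuous_l.
Qed.

Lemma sphere_compact x r : compact [set y | enorm (x - y) = r].
Proof.
apply: (subclosed_compact _ (@eball_compact x r)); last by move=> y /= <-.
rewrite (_ : [set _ | _] = (fun y => enorm (x - y)) @^-1` [set r]) //.
by apply: (preimage_closed _ (@closed_eq R r)) => y _; exact: enorm_dist_continuous_l.
Qed.

End euclid.
#[export] Hint Resolve enorm_ge0 : core.

Section distance.
Context {R : realType} {n : nat}.
Variable E : set 'rV[R]_n.
Implicit Types (x y q : 'rV[R]_n).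

Lemma dist_to_le x y : E y -> dist_to E x <= enorm (x - y).
Proof. by move=> Ey; apply: ge_inf; [exists 0 => _ [z _ <-]; exact: enorm_ge0|exists y]. Qed.

Hypothesis E0 : E !=set0.

Lemma dist_to_ge x r : (forall y, E y -> r <= enorm (x - y)) -> r <= dist_to E x.
Proof.
move=> h; apply: lb_le_inf; last by move=> _ [y Ey <-]; exact: h.
by have [y Ey] := E0; exists (enorm (x - y)); exists y.
Qed.

Lemma dist_to_lip x y : dist_to E x <= dist_to E y + enorm (x - y).
Proof.
rewrite -lerBlDr; apply: dist_to_ge => z Ez.
by have := dist_to_le x Ez; have := enorm_dist y x z; lra.
Qed.

Lemma dist_to_continuous : continuous (dist_to E).
Proof.
move=> x; apply: (@enorm_continuous_at _ _ _ x 1 1) => // z _; rewrite mul1r.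
rewrite ler_norml; have := dist_to_lip x z; have := dist_to_lip z x.
by rewrite (enormBC z x); lra.
Qed.

Hypothesis Ecl : closed E.

(** Only the points of [E] within the distance from [x] to one chosen point [y] compete, and they
    form a compact set. *)
Lemma dist_to_attained x : exists2 q, E q & enorm (x - q) = dist_to E x.
Proof.
have [y Ey] := E0.
have [|||q] := @EVT_min_rV R n (fun q => enorm (x - q))
    (E `&` [set q | enorm (x - q) <= enorm (x - y)]).
- by exists y; split => /=.
- by rewrite setIC; apply: compact_closedI => //; exact: eball_compact.
- by apply: continuous_subspaceT => z; exact: enorm_dist_continuous_l.
rewrite inE => -[Eq _] h; exists q => //; apply/eqP.
rewrite eq_le dist_to_le // andbT; apply: dist_to_ge => z Ez.
have [zy|/ltW yz] := leP (enorm (x - z)) (enorm (x - y)).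
  by apply: h; rewrite inE; split.
by apply: le_trans yz; apply: h; rewrite inE; split => /=.
Qed.

Lemma dist_to_gt0 x : ~ E x -> 0 < dist_to E x.
Proof.
have [q Eq <-] := dist_to_attained x => nEx.
by rewrite enorm_gt0 subr_eq0; apply/eqP => xq; apply: nEx; rewrite xq.
Qed.

End distance.

(** * Functions whose gradient has constant norm *)

Section directional_derivative.
Context {R : realType} {n : nat}.
Implicit Types (f : 'rV[R]_n -> R) (x y v : 'rV[R]_n) (a b : R).

(** [a] is the derivative of [f] at [y] along [v], in a form without division or punctured
    neighbourhood. *)
Definition dirder f y v a := forall e, 0 < e -> exists2 eta, 0 < eta &
  forall t, `|t| < eta -> `|f (y + t *: v) - f y - a * t| <= e * `|t|.

Lemma dirderN f y v a : dirder f y v a -> dirder (fun x => - f x) y v (- a).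
Proof.
move=> h e /h[eta eta0 {}h]; exists eta => // t /h.
by rewrite -normrN; congr (`|_| <= _); ring.
Qed.

(** Only positive [t] are compared: the bound is one-sided, as at an extremal point. *)
Lemma dirder_le f y v a b eta : 0 < eta -> dirder f y v a ->
  (forall t, 0 < t < eta -> f (y + t *: v) - f y <= b * t) -> a <= b.
Proof.
move=> eta0 fa fb; rewrite leNgt; apply/negP => ba.
have [|h h0 hf] := fa ((a - b) / 2); first by lra.
pose t := Num.min h eta / 2.
have m0 : 0 < Num.min h eta by rewrite lt_min h0.
have t0 : 0 < t by rewrite divr_gt0.
have : t < h /\ t < eta.
  by apply/andP; rewrite -lt_min /t ltr_pdivrMr // ltr_pMr ?ltr1n.
move=> [th te]; have := fb t; rewrite t0 te => /(_ isT) h1.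
have := hf t; rewrite gtr0_norm // => /(_ th); rewrite ler_norml => /andP[h2 _].
have : 0 < (a - b) * t by rewrite mulr_gt0 // subr_gt0.
lra.
Qed.

Lemma dirder_is_derive f y v a : dirder f y v a -> is_derive y v f a.
Proof.
move=> fa; have h : (fun h => h^-1 *: ((f \o shift y) (h *: v) - f y)) @ 0^' --> a.
  apply/cvgrPdist_le => e /fa[eta eta0 {}fa]; near=> t.
  have t0 : t != 0 by near: t; exact: nbhs_dnbhs_neq.
  have /fa : `|t| < eta by near: t; apply: dnbhs0_lt.
  rewrite -ler_pdivrMr ?normr_gt0 // -normfV -normrM -normrN.
  congr (`|_| <= _); rewrite /= (addrC (t *: v)) [t^-1 *: _]mulrC mulrBl mulfK //.
  by rewrite opprB.
by split; [apply/cvg_ex; exists a | apply/cvg_lim].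
Unshelve. all: by end_near. Qed.

Lemma dirder_along f x v t a : dirder f (x + t *: v) v a ->
  is_derive t (1 : R) (fun s => f (x + s *: v)) a.
Proof.
move=> fa; have h : (fun h => h^-1 *: (((fun s => f (x + s *: v)) \o shift t) (h *: (1 : R))
    - f (x + t *: v))) @ 0^' --> a.
  have [da <-] := dirder_is_derive fa.
  apply: cvg_trans da; apply: near_eq_cvg; near=> h.
  rewrite /= /shift /=; do 3 f_equal.
  by rewrite scalerDl addrCA /GRing.scale /= mulr1.
by split; [apply/cvg_ex; exists a | apply/cvg_lim].
Unshelve. all: by end_near. Qed.

End directional_derivative.

Section eikonal.
Context {R : realType} {n : nat}.
Variables (F : 'rV[R]_n -> R) (G : 'rV[R]_n -> 'rV[R]_n).
Variables (x : 'rV[R]_n) (r c : R).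
Hypothesis c0 : 0 < c.
Hypothesis Fc : forall y, enorm (x - y) < r -> {for y, continuous F}.
Hypothesis FG : forall y v, enorm (x - y) < r -> dirder F y v (dot (G y) v).
Hypothesis Gc : forall y, enorm (x - y) < r -> enorm (G y) = c.

(** Mean value theorem on the segment from [x] to [y], where the slope is at most [c] by
    Cauchy-Schwarz. *)
Lemma eikonal_lip y : enorm (x - y) < r -> F y - F x <= c * enorm (x - y).
Proof.
move=> xyr.
pose p t := x + t *: (y - x).
have pr t : 0 <= t <= 1 -> enorm (x - p t) < r.
  move=> /andP[t0 t1]; rewrite /p opprD addNKr enormN enormZ ger0_norm //.
  by apply: le_lt_trans xyr; rewrite (enormBC x) ler_piMl ?enorm_ge0.
have [t /= t01||t t01] := @MVT_segment R (fun t => F (p t))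
   (fun t => dot (G (p t)) (y - x)) 0 1 ler01.
- apply: dirder_along; apply: FG; apply: pr.
  by move: t01; rewrite in_itv /= => /andP[? ?]; rewrite !ltW.
- apply: continuous_in_subspaceT => t; rewrite inE /= in_itv /= => /pr tr.
  apply: differentiable_continuous; apply/derivable1_diffP.
  by have [] := dirder_along (FG (y - x) tr).
rewrite /p scale1r scale0r addr0 subrKC subr0 mulr1 => ->.
apply: le_trans (dot_le _ _) _; rewrite Gc ?(enormBC y) //; apply: pr.
by move: t01; rewrite in_itv.
Qed.

(* Maximize [F y - c' |y - x|] on the ball: an interior maximum would force
   the slope of [F] in the direction of its gradient to be at most [c' < c]. *)
Let ascent_approx s c' : 0 < s < r -> 0 <= c' < c ->
  exists2 z, enorm (x - z) = s & F x + c' * s <= F z.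
Proof.
move=> /andP[s0 sr] /andP[c'0 c'c].
have [|||z] := @EVT_max_rV R n (fun y => F y - c' * enorm (x - y))
    [set y | enorm (x - y) <= s].
- by exists x; rewrite /= subrr enorm0 ltW.
- exact: eball_compact.
- apply: continuous_in_subspaceT => y; rewrite inE /= => xys.
  apply: (@continuousB _ _ _ F (fun y => c' * enorm (x - y))).
    by apply: Fc; exact: le_lt_trans xys sr.
  by apply: continuousM; [exact: cst_continuous | exact: enorm_dist_continuous_l].
rewrite inE /= => zs zmax.
have sE : enorm (x - z) = s.
  apply/eqP; rewrite eq_le zs leNgt; apply/negP => zs'.
  have zr := lt_trans zs' sr.
  (* The left side is the derivative of [F] at [z] along [G z]; maximality bounds the growth of [F]
     by c' times the displacement t |G z|. *)
  suff : c * c <= c' * c by rewrite ler_pM2r // leNgt c'c.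
  rewrite -{1 2 3}(Gc zr) -expr2 enorm_sqr.
  have G0 : 0 < enorm (G z) by rewrite Gc.
  apply: (dirder_le (eta := (s - enorm (x - z)) / enorm (G z)) _ (FG (G z) zr)).
    by rewrite divr_gt0 ?subr_gt0.
  move=> t /andP[t0 tz]; set y := z + t *: G z.
  have zy : enorm (z - y) = t * enorm (G z).
    by rewrite /y opprD addNKr enormN enormZ gtr0_norm.
  have xy := enorm_dist z x y; rewrite zy in xy.
  have xys : enorm (x - y) <= s.
    by move: tz; rewrite ltr_pdivlMr // => /ltW; lra.
  have := zmax y; rewrite inE /= => /(_ xys) h.
  have : c' * enorm (x - y) <= c' * (enorm (x - z) + t * enorm (G z)).
    by rewrite ler_wpM2l.
  lra.
exists z => //.
have := zmax x; rewrite inE /= subrr enorm0 ltW // => /(_ isT).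
by rewrite sE; lra.
Qed.

Lemma eikonal_ascent s : 0 < s < r ->
  exists2 z, enorm (x - z) = s & F x + c * s <= F z.
Proof.
(* Slope 0 yields a point of the sphere, which the extreme value theorem needs; the same point
   settles the case where [e] is at least [c * s]. *)
move=> sr; have [z0 z0s z0F] : exists2 z, enorm (x - z) = s & F x + 0 * s <= F z.
  by apply: ascent_approx; rewrite ?lexx.
have [|||z] := @EVT_max_rV R n F [set y | enorm (x - y) = s].
- by exists z0.
- exact: sphere_compact.
- apply: continuous_in_subspaceT => y; rewrite inE /= => xys.
  by apply: Fc; rewrite xys; case/andP: sr.
rewrite inE /= => zs zmax; exists z => //.
have s0 : 0 < s by case/andP: sr.
apply/ler_addgt0Pr => e e0; rewrite -lerBlDr.
have [es|es] := ltP e (c * s); last first.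
  by apply: le_trans (zmax z0 _); [lra | rewrite inE].
(* The slope [c - e / s] loses exactly [e] over the length [s], and the maximizer [z] on the sphere
   does not depend on [e]. *)
have [|y ys hy] := @ascent_approx s (c - e / s) sr.
  by rewrite subr_ge0 ler_pdivrMr // ltW //= ltrBlDr ltrDl divr_gt0.
apply: le_trans (zmax y _); last by rewrite inE.
by apply: le_trans hy; rewrite mulrBl divfK ?gt_eqF // addrA.
Qed.

End eikonal.

(** * Differentiability of Riesz potentials *)

Section taylor.
Context {R : realType}.
Implicit Types (b u a : R).

(** The lower bound comes from ln (1 + u) <= u, the upper one from ln (1 + u) >= u / (1 + u), each
    followed by exp v >= 1 + v. *)
Lemma powR_taylor b u : 0 < b -> 2 * (1 + b) * `|u| <= 1 ->
  `|(1 + u) `^ (- b) - 1 + b * u| <= 2 * b * (1 + b) * u ^+ 2.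
Proof.
move=> b0 hu.
have [bu1 bu2] : - (1 / 2) <= (1 + b) * u /\ (1 + b) * u <= 1 / 2.
  have : (1 + b) * `|u| <= 1 / 2 by lra.
  rewrite -[1 + b]gtr0_norm ?addr_gt0 // -normrM ler_norml.
  by rewrite gtr0_norm ?addr_gt0 // => /andP.
have u1 : -(1/2) <= u by nra.
have u1' : 0 < 1 + u by lra.
have uE : (1 + u)^-1 = 1 + - (u / (1 + u)) by field; lra.
have ln_ge : u / (1 + u) <= ln (1 + u).
  rewrite -lerN2 -lnV ?posrE // [in ln _]uE; apply: le_ln1Dx.
  by rewrite ltrN2 ltr_pdivrMr // mul1r ltrDr.
have pE : (1 + u) `^ (- b) = expR (- (b * ln (1 + u))).
  by rewrite /powR gt_eqF // mulNr.
have lo : 1 - b * u <= (1 + u) `^ (- b).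
  rewrite pE; apply: le_trans (expR_ge1Dx _); rewrite lerD2l lerN2.
  by rewrite ler_pM2l //; apply: le_ln1Dx; lra.
have w0 : 0 < 1 + (1 + b) * u by lra.
have hi : (1 + u) `^ (- b) <= (1 + u) / (1 + (1 + b) * u).
  rewrite pE expRN -[leRHS]invrK lef_pV2 ?posrE ?expR_gt0 ?invr_gt0 ?divr_gt0 //.
  rewrite invf_div; apply: le_trans (expR_ge1Dx _).
  have -> : (1 + (1 + b) * u) / (1 + u) = 1 + b * (u / (1 + u)) by field; lra.
  by rewrite lerD2l ler_pM2l.
have hi2 : (1 + u) / (1 + (1 + b) * u) <= 1 - b * u + 2 * b * (1 + b) * u ^+ 2.
  rewrite ler_pdivrMr //.
  (* This is the difference of the two sides; its last factor is nonnegative because [(1 + b) * u]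
     is at least - 1 / 2. *)
  have : 0 <= b * (1 + b) * u ^+ 2 * (1 + 2 * ((1 + b) * u)).
    by apply: mulr_ge0; [apply: mulr_ge0 (sqr_ge0 u); apply: mulr_ge0|]; lra.
  move=> h; rewrite -subr_ge0; apply: le_trans h _.
  by rewrite le_eqVlt; apply/orP; left; apply/eqP; ring.
by rewrite ler_norml; apply/andP; split; nra.
Qed.

Lemma powR_taylor_at b a u : 0 < b -> 0 < a -> 2 * (1 + b) * `|u| <= a ->
  `|(a + u) `^ (- b) - a `^ (- b) + b * a `^ (- b) * (u / a)| <=
  2 * b * (1 + b) * a `^ (- b) * (u / a) ^+ 2.
Proof.
move=> b0 a0 hu.
have /(@powR_taylor b (u / a) b0) : 2 * (1 + b) * `|u / a| <= 1.
  by rewrite normrM normfV (gtr0_norm a0) mulrA ler_pdivrMr // mul1r.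
have -> : a + u = a * (1 + u / a) by field; rewrite gt_eqF.
have h : 0 <= 1 + u / a.
  have : `|u| <= a by apply: le_trans hu; rewrite ler_peMl //; lra.
  rewrite ler_norml => /andP[h _].
  by rewrite -lerBlDl sub0r ler_pdivlMr // mulN1r.
move=> /(ler_wpM2l (powR_ge0 a (- b))) e; rewrite powRM ?(ltW a0) //.
rewrite -[X in X * `|_|](gtr0_norm (powR_gt0 (- b) a0)) -normrM in e.
by apply: etrans e; congr (`|_| <= _); ring.
Qed.

End taylor.

Section frechet.
Context {R : realType} {n : nat}.
Implicit Types (f : 'rV[R]_n -> R) (x y v g : 'rV[R]_n).

(** Stronger than Frechet differentiability: the remainder is quadratic. This is what the kernel
    estimates give, and it survives integration and composition with powers. *)
Definition frechet f x g := exists C eta, [/\ 0 <= C, 0 < eta &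
  forall h, enorm h < eta -> `|f (x + h) - f x - dot g h| <= C * enorm h ^+ 2].

Lemma frechet_dirder f x g v : frechet f x g -> dirder f x v (dot g v).
Proof.
move=> [C [eta [C0 eta0 h]]] e e0.
have k0 : 0 < 1 + enorm v by rewrite ltr_pwDl ?enorm_ge0.
have K0 : 0 < 1 + C * enorm v ^+ 2 by rewrite ltr_pwDl ?mulr_ge0 ?exprn_ge0 ?enorm_ge0.
exists (Num.min (eta / (1 + enorm v)) (e / (1 + C * enorm v ^+ 2))).
  by rewrite lt_min !divr_gt0.
move=> t; rewrite lt_min !ltr_pdivlMr // => /andP[t1 t2].
have /h : enorm (t *: v) < eta.
  by rewrite enormZ; apply: le_lt_trans t1; rewrite ler_wpM2l // lerDr.
rewrite dotZr (mulrC t) => /le_trans; apply; rewrite enormZ.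
have -> : C * (`|t| * enorm v) ^+ 2 = `|t| * (C * enorm v ^+ 2) * `|t| by ring.
by rewrite ler_wpM2r //; apply/ltW/(le_lt_trans _ t2); rewrite ler_wpM2l // lerDr.
Qed.

Lemma frechet_continuous f x g : frechet f x g -> {for x, continuous f}.
Proof.
move=> [C [eta [C0 eta0 h]]].
apply: (@enorm_continuous_at _ _ _ _ eta (enorm g + C * eta)) => // y xy.
have := h (y - x); rewrite addrCA subrr addr0 (enormBC y) => /(_ xy).
rewrite (distrC (f x)) => h1.
have -> : f y - f x = f y - f x - dot g (y - x) + dot g (y - x) by rewrite subrK.
apply: le_trans (ler_normD _ _) _; rewrite mulrDl addrC.
apply: lerD; first by rewrite (enormBC x) cauchy_schwarz.
apply: le_trans h1 _; rewrite -mulrA ler_wpM2l // expr2 ler_wpM2r ?enorm_ge0 //.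
exact: ltW.
Qed.

Lemma frechet_gradient f x g : frechet f x g -> gradient f x = g.
Proof.
move=> fg; apply/rowP => i; rewrite mxE.
have [_ ->] := dirder_is_derive (frechet_dirder (delta_mx 0 i) fg).
rewrite /dot (bigD1 i) //= mxE !eqxx mulr1 big1 ?addr0 // => j ji.
by rewrite mxE /= (negPf ji) mulr0.
Qed.

Lemma frechet_powR f x g b : 0 < b -> 0 < f x -> frechet f x g ->
  frechet (fun y => f y `^ (- b)) x (- (b * f x `^ (- b) / f x) *: g).
Proof.
move=> b0 fx0 [C [eta [C0 eta0 h]]].
(* [K] is a Lipschitz constant of [f] at [x], [A] the absolute value of the derivative of the power,
   [B] its second-order constant. *)
pose K := enorm g + C * eta.
have K0 : 0 <= K by rewrite addr_ge0 ?mulr_ge0 ?enorm_ge0 ?(ltW eta0).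
pose A := b * f x `^ (- b) / f x.
pose B := 2 * b * (1 + b) * f x `^ (- b) / f x ^+ 2.
have A0 : 0 <= A by rewrite !mulr_ge0 ?powR_ge0 ?invr_ge0 ?(ltW b0) ?(ltW fx0).
have B0 : 0 <= B.
  by rewrite !mulr_ge0 ?powR_ge0 ?invr_ge0 ?exprn_ge0 ?addr_ge0 ?(ltW b0) ?(ltW fx0).
(* The second bound on the radius makes 2 (1 + b) |f (x + v) - f x| at most [f x], as the expansion
   of the power requires. *)
exists (A * C + B * K ^+ 2), (Num.min eta (f x / (2 * (1 + b) * (K + 1)))).
have K1 : 0 < K + 1 by lra.
have KK : 0 < 2 * (1 + b) * (K + 1) by rewrite !mulr_gt0 // addr_gt0.
split; first by rewrite addr_ge0 // mulr_ge0 // exprn_ge0.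
  by rewrite lt_min eta0 divr_gt0.
move=> v; rewrite lt_min => /andP[v1 v2].
have hv := h v v1.
set u := f (x + v) - f x.
have uK : `|u| <= K * enorm v.
  rewrite -(subrK (dot g v) u); apply: le_trans (ler_normD _ _) _.
  rewrite mulrDl addrC; apply: lerD; first exact: cauchy_schwarz.
  apply: le_trans hv _; rewrite -mulrA ler_wpM2l // expr2 ler_wpM2r ?enorm_ge0 //.
  exact: ltW.
have := @powR_taylor_at _ b (f x) u b0 fx0.
rewrite {2}/u subrKC => /(_ _) ht.
have {ht} /ht ht : 2 * (1 + b) * `|u| <= f x.
  move: v2; rewrite ltr_pdivlMr // => /ltW; apply: le_trans.
  rewrite [leRHS]mulrC -[leRHS]mulrA ler_wpM2l //.
    by rewrite mulr_ge0 // addr_ge0 // ltW.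
  by apply: le_trans uK _; rewrite ler_wpM2r ?enorm_ge0 // lerDl.
rewrite dotZl.
have -> : f (x + v) `^ (- b) - f x `^ (- b) - - (b * f x `^ (- b) / f x) * dot g v
  = (f (x + v) `^ (- b) - f x `^ (- b) + b * f x `^ (- b) * (u / f x)) -
    A * (u - dot g v).
  by rewrite /A; field; rewrite gt_eqF.
apply: le_trans (ler_normB _ _) _; rewrite normrM (ger0_norm A0) [leRHS]mulrDl [leRHS]addrC.
apply: lerD; last by rewrite -mulrA ler_wpM2l.
apply: le_trans ht _.
have -> : 2 * b * (1 + b) * f x `^ (- b) * (u / f x) ^+ 2 = B * u ^+ 2.
  by rewrite /B; field; rewrite gt_eqF.
by rewrite -mulrA ler_wpM2l // -exprMn -(real_normK (num_real u)) ler_sqr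
  ?nnegrE ?mulr_ge0 ?enorm_ge0.
Qed.

End frechet.

(** * Kernel estimates away from the singularity *)

Section kernel_estimates.
Context {R : realType} {n : nat}.
Implicit Types (x y z h v : 'rV[R]_n) (p delta : R).

(** [enorm (z + h)] is at least half of [enorm z]. *)
Lemma kernel_comparable p z h : 0 <= p -> 0 < enorm z -> 2 * enorm h <= enorm z ->
  enorm (z + h) `^ (- p) <= 2 `^ p * enorm z `^ (- p).
Proof.
move=> p0 z0 hz.
have := enorm_sub z (- h); rewrite opprK enormN => h1.
rewrite -[2]invrK -powR_inv1 // -powRrM mulN1r -powRM ?invr_ge0 ?enorm_ge0 //.
have zh0 : 0 < enorm (z + h) by lra.
rewrite !powRN lef_pV2 ?posrE ?powR_gt0 ?mulr_gt0 ?invr_gt0 //.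
apply: ge0_ler_powR; rewrite ?nnegrE ?mulr_ge0 ?invr_ge0 ?enorm_ge0 //.
by lra.
Qed.

Lemma powR_sqr_half p z : enorm z `^ (- p) = (dot z z) `^ (- (p / 2)).
Proof.
by rewrite -enorm_sqr -powR_mulrn ?enorm_ge0 // -powRrM; congr (_ `^ _); field.
Qed.

(** With a = |z|^2 and u = 2 z.h + |h|^2, the kernel at [z + h] is (a + u)^(- p / 2), to which the
    scalar expansion applies. The remainder keeps the kernel as a factor, so it is integrable
    wherever the potential is finite. *)
Lemma kernel_taylor p delta z h : 0 < p -> 0 < delta -> delta <= enorm z ->
  6 * (1 + p) * enorm h <= delta ->
  `|enorm (z + h) `^ (- p) - enorm z `^ (- p)
     + p * (dot z h * enorm z `^ (- p - 2))|
  <= (18 * p * (1 + p) + p) / delta ^+ 2 * enorm h ^+ 2 * enorm z `^ (- p).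
Proof.
move=> p0 d0 dz hz.
have z0 : 0 < enorm z by lra.
have h0 := enorm_ge0 h.
have hd : enorm h <= delta.
  by apply: le_trans hz; rewrite -{1}[enorm h]mul1r ler_wpM2r //; lra.
set a := dot z z.
have aE : a = enorm z ^+ 2 by rewrite enorm_sqr.
have a0 : 0 < a by rewrite aE exprn_gt0.
have zp2 : enorm z `^ (- p - 2) = enorm z `^ (- p) / a.
  rewrite powRD; last by rewrite (gt_eqF z0) implybT.
  by congr (_ * _); rewrite powRN powR_mulrn ?enorm_ge0 // aE.
pose b := p / 2; have b0 : 0 < b by rewrite divr_gt0.
set P := enorm z `^ (- p).
have PE : P = a `^ (- b) by rewrite /P powR_sqr_half.
have P0 : 0 <= P by exact: powR_ge0.
pose u := 2 * dot z h + enorm h ^+ 2.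
have zhE : enorm (z + h) `^ (- p) = (a + u) `^ (- b).
  by rewrite powR_sqr_half -[dot (z + h) _]enorm_sqr enorm_sqrD /u addrA aE.
have zh := cauchy_schwarz z h.
have uz : `|u| <= 3 * (enorm z * enorm h).
  apply: le_trans (ler_normD _ _) _; rewrite normrM (gtr0_norm (x := 2)) //.
  rewrite [`|enorm h ^+ 2|]ger0_norm ?exprn_ge0 //.
  have : enorm h ^+ 2 <= enorm z * enorm h.
    by rewrite expr2 ler_wpM2r //; lra.
  lra.
have := @powR_taylor_at _ b a u b0 a0; rewrite -PE -zhE => ht.
have {ht} /ht ht : 2 * (1 + b) * `|u| <= a.
  apply: le_trans (_ : 2 * (1 + b) * (3 * (enorm z * enorm h)) <= _).
    by rewrite ler_wpM2l // mulr_ge0 // addr_ge0 // ltW.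
  rewrite aE expr2.
  have -> : 2 * (1 + b) * (3 * (enorm z * enorm h)) =
     enorm z * (6 * (1 + b) * enorm h) by ring.
  rewrite ler_wpM2l ?enorm_ge0 //; apply: le_trans dz; apply: le_trans hz.
  by rewrite ler_wpM2r // ler_wpM2l // lerD2l /b; lra.
rewrite zp2 -/P.
have -> : enorm (z + h) `^ (- p) - P + p * (dot z h * (P / a)) =
   (enorm (z + h) `^ (- p) - P + b * P * (u / a)) - b * P * (enorm h ^+ 2 / a).
  by rewrite /u /b; field; rewrite gt_eqF.
have ha0 : 0 <= enorm h ^+ 2 / a by rewrite divr_ge0 ?exprn_ge0 // ltW.
apply: le_trans (ler_normB _ _) _.
have -> : `|b * P * (enorm h ^+ 2 / a)| = b * P * (enorm h ^+ 2 / a).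
  by rewrite ger0_norm // mulr_ge0 // mulr_ge0 // ltW.
have hu : (u / a) ^+ 2 <= 9 * (enorm h ^+ 2 / a).
  have -> : 9 * (enorm h ^+ 2 / a) = (3 * (enorm z * enorm h)) ^+ 2 / a ^+ 2.
    by rewrite !exprMn -aE; field; rewrite gt_eqF.
  rewrite expr_div_n ler_wpM2r ?invr_ge0 ?exprn_ge0 ?(ltW a0) //.
  rewrite -(real_normK (num_real u)) ler_sqr ?nnegrE //.
  by rewrite !mulr_ge0 ?enorm_ge0.
have hd2 : enorm h ^+ 2 / a <= enorm h ^+ 2 / delta ^+ 2.
  rewrite ler_wpM2l ?exprn_ge0 // lef_pV2 ?posrE ?exprn_gt0 //.
  by rewrite aE ler_sqr ?nnegrE ?enorm_ge0 // ltW.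
(* 18 is 2 times 9, from |u| <= 3 |z| |h|; the extra [b] comes from the term |h|^2 of [u], moved to
   the remainder. *)
apply: le_trans (_ : (18 * b * (1 + b) + b) * P * (enorm h ^+ 2 / a) <= _).
  have h1 : 2 * b * (1 + b) * P * (u / a) ^+ 2 <=
         2 * b * (1 + b) * P * (9 * (enorm h ^+ 2 / a)).
    by rewrite ler_wpM2l // !mulr_ge0 // ?addr_ge0 // ltW.
  by move: (le_trans ht h1); lra.
apply: le_trans (_ : (18 * p * (1 + p) + p) * P * (enorm h ^+ 2 / a) <= _).
  rewrite ler_wpM2r // ler_wpM2r // /b; nra.
apply: le_trans (_ : (18 * p * (1 + p) + p) * P * (enorm h ^+ 2 / delta ^+ 2) <= _).
  by rewrite ler_wpM2l // mulr_ge0 // addr_ge0 ?mulr_ge0 ?addr_ge0 // ltW.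
by rewrite le_eqVlt; apply/orP; left; apply/eqP; ring.
Qed.

End kernel_estimates.

Section measurability.
Context {R : realType} {n : nat}.

Lemma continuous_borel_measurable (f : 'rV[R]_n -> R) :
  continuous f -> measurable_fun [set: borelRn R n] f.
Proof.
move=> /continuousP cf; apply: (measurability _ (RGenOpens.measurableE R)).
move=> _ [_ [a [b ->] <-]]; rewrite setTI; apply: sub_sigma_algebra.
exact/cf/interval_open.
Qed.

Lemma open_borel (U : set 'rV[R]_n) : open U -> measurable (U : set (borelRn R n)).
Proof. by move=> oU; exact: sub_sigma_algebra. Qed.

Lemma closed_borel (A : set 'rV[R]_n) :
  closed A -> measurable (A : set (borelRn R n)).
Proof.
move=> cA; rewrite -[A]setCK; apply: measurableC; apply: open_borel.
exact: closed_openC.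
Qed.

Lemma measurable_enorm_powR (x : 'rV[R]_n) q :
  measurable_fun [set: borelRn R n] (fun y : borelRn R n => enorm (x - (y : 'rV[R]_n)) `^ q).
Proof.
apply: (measurableT_comp (measurable_powR q)).
exact: (continuous_borel_measurable (@enorm_dist_continuous_l _ _ x)).
Qed.

Lemma measurable_dot (x v : 'rV[R]_n) :
  measurable_fun [set: borelRn R n] (fun y : borelRn R n => dot (x - (y : 'rV[R]_n)) v).
Proof.
apply: continuous_borel_measurable => y.
apply: (@enorm_continuous_at _ _ _ y 1 (enorm v)) => // z _.
rewrite -dotBl opprB addrC subrKA.
by apply: le_trans (cauchy_schwarz _ _) _; rewrite mulrC (enormBC z).
Qed.

End measurability.

(** * Riesz potentials and differentiation under the integral sign *)

Section riesz_potential.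
Context {R : realType} {n : nat}.
Variables (mu : {measure set borelRn R n -> \bar R}) (E : set 'rV[R]_n).
Variable p : R.
Hypothesis p0 : 0 < p.
Hypothesis mE : measurable (E : set (borelRn R n)).

Definition riesz (x : 'rV[R]_n) : \bar R :=
  (\int[mu]_(y in E) (enorm (x - (y : 'rV[R]_n)) `^ (- p))%:E)%E.

Definition riesz_grad (x : 'rV[R]_n) : 'rV[R]_n :=
  \row_i (- p * \int[mu]_(y in E)
    (dot (x - (y : 'rV[R]_n)) (delta_mx 0 i) * enorm (x - (y : 'rV[R]_n)) `^ (- p - 2)))%R.

Let mk x q : measurable_fun (E : set (borelRn R n))
  (fun y : borelRn R n => enorm (x - (y : 'rV[R]_n)) `^ q).
Proof. exact: (measurable_funTS (@measurable_enorm_powR R n x q)). Qed.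

Let mdk x v q : measurable_fun (E : set (borelRn R n))
  (fun y : borelRn R n => dot (x - (y : 'rV[R]_n)) v * enorm (x - (y : 'rV[R]_n)) `^ q).
Proof. by apply: measurable_funM => //; exact: (measurable_funTS (@measurable_dot R n x v)). Qed.

Lemma riesz_ge0 x : (0 <= riesz x)%E.
Proof. by apply: integral_ge0 => y _; rewrite lee_fin powR_ge0. Qed.

(** A Harnack inequality: it bounds the potential near [x] for the expansion, and used from [x + h]
    back to [x] it propagates infinite values. *)
Lemma riesz_comparable x h : 0 < dist_to E x -> 2 * enorm h <= dist_to E x ->
  (riesz (x + h) <= (2 `^ p)%:E * riesz x)%E.
Proof.
move=> d0 hd; rewrite /riesz -ge0_integralZl //.
- apply: ge0_le_integral => //.
  + by move=> y _; rewrite lee_fin powR_ge0.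
  + exact/measurable_EFinP.
  + by apply/measurable_EFinP; apply: measurable_funM.
  + move=> y Ey; rewrite -EFinM lee_fin addrAC.
    have dy := dist_to_le x Ey.
    apply: kernel_comparable; [exact: ltW | exact: lt_le_trans dy | exact: le_trans dy].
- exact/measurable_EFinP.
- by move=> y _; rewrite lee_fin powR_ge0.
Qed.

Section finite.
Variable x : 'rV[R]_n.
Hypothesis d0 : 0 < dist_to E x.
Hypothesis fx : (riesz x < +oo)%E.

Let k y := enorm (x - y) `^ (- p).

Let kpos (y : 'rV[R]_n) : E y -> 0 < enorm (x - y).
Proof. by move=> Ey; apply: lt_le_trans d0 _; exact: dist_to_le. Qed.

Lemma integrable_kernel : mu.-integrable E (EFin \o (k : borelRn R n -> R)).
Proof.
apply/integrableP; split; first by apply/measurable_EFinP; apply: mk.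
under eq_integral do rewrite /= ger0_norm ?powR_ge0 //.
exact: fx.
Qed.

Lemma integrable_kernel_dot v : mu.-integrable E (EFin \o
  (fun y : borelRn R n => dot (x - (y : 'rV[R]_n)) v * enorm (x - (y : 'rV[R]_n)) `^ (- p - 2))).
Proof.
have := integrableZl mE (enorm v / dist_to E x) integrable_kernel.
apply: le_integrable => //; first exact/measurable_EFinP.
move=> y Ey /=; have dy := dist_to_le x Ey; have ky := kpos Ey.
rewrite lee_fin [leRHS]ger0_norm ?mulr_ge0 ?invr_ge0 ?enorm_ge0 ?powR_ge0 ?(ltW d0) //.
rewrite normrM (ger0_norm (powR_ge0 _ _)) /k.
rewrite powRD; last by rewrite (gt_eqF ky) implybT.
rewrite (powRN _ 2) powR_mulrn ?enorm_ge0 //.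
(* Of the two extra powers of 1 / |x - y|, Cauchy-Schwarz cancels one and the distance to [E] bounds
   the other. *)
apply: le_trans (ler_wpM2r _ (cauchy_schwarz _ _)) _.
  by rewrite mulr_ge0 ?powR_ge0 ?invr_ge0 ?exprn_ge0 ?enorm_ge0.
have -> : enorm (x - y) * enorm v * (enorm (x - y) `^ (- p) * (enorm (x - y) ^+ 2)^-1)
  = enorm v / enorm (x - y) * enorm (x - y) `^ (- p).
  by field; rewrite gt_eqF.
rewrite ler_wpM2r ?powR_ge0 // ler_wpM2l ?enorm_ge0 //.
by rewrite lef_pV2 ?posrE.
Qed.

Lemma dot_riesz_grad v : dot (riesz_grad x) v =
  - p * \int[mu]_(y in E)
    (dot (x - (y : 'rV[R]_n)) v * enorm (x - (y : 'rV[R]_n)) `^ (- p - 2))%R.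
Proof.
rewrite {1}/dot.
have -> : \sum_(i < n) riesz_grad x 0 i * v 0 i =
   - p * \sum_(i < n) \int[mu]_(y in E)
      (v 0 i * (dot (x - (y : 'rV[R]_n)) (delta_mx 0 i) *
      enorm (x - (y : 'rV[R]_n)) `^ (- p - 2)))%R.
  rewrite mulr_sumr; apply: eq_bigr => i _.
  by rewrite mxE RintegralZl //; [ring | exact: integrable_kernel_dot].
congr (_ * _).
(* Integrability and additivity go together, since additivity asks for the integrability of the
   partial sums. *)
have sumI (s : seq 'I_n) :
  mu.-integrable E (EFin \o (fun y : borelRn R n => \sum_(i <- s)
     (v 0 i * (dot (x - (y : 'rV[R]_n)) (delta_mx 0 i) *
      enorm (x - (y : 'rV[R]_n)) `^ (- p - 2))))) /\
  \sum_(i <- s) \int[mu]_(y in E)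
      (v 0 i * (dot (x - (y : 'rV[R]_n)) (delta_mx 0 i) *
      enorm (x - (y : 'rV[R]_n)) `^ (- p - 2)))%R =
  \int[mu]_(y in E) (\sum_(i <- s)
     (v 0 i * (dot (x - (y : 'rV[R]_n)) (delta_mx 0 i) *
      enorm (x - (y : 'rV[R]_n)) `^ (- p - 2))))%R.
  elim: s => [|i s [IH1 IH2]].
    under [in X in X /\ _]eq_fun do rewrite big_nil.
    under [X in _ /\ _ = X]eq_Rintegral do rewrite big_nil.
    by rewrite big_nil /Rintegral integral0; split => //; exact: integrable0.
  have I1 : mu.-integrable E (EFin \o (fun y : borelRn R n =>
     (v 0 i * (dot (x - (y : 'rV[R]_n)) (delta_mx 0 i) *
      enorm (x - (y : 'rV[R]_n)) `^ (- p - 2))))).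
    exact: (integrableZl mE (v 0 i) (integrable_kernel_dot _)).
  under [in X in X /\ _]eq_fun do rewrite big_cons.
  under [X in _ /\ _ = X]eq_Rintegral do rewrite big_cons.
  rewrite big_cons IH2 RintegralD //; split => //.
  exact: (integrableD mE I1 IH1).
have [_ ->] := sumI (index_enum _).
apply: eq_Rintegral => y _; rewrite [X in _ = X * _]/dot mulr_suml; apply: eq_bigr => i _.
rewrite mulrA; congr (_ * _); rewrite mulrC; congr (_ * _).
rewrite /dot (bigD1 i) //= !mxE !eqxx mulr1 big1 ?addr0 // => j ji.
by rewrite [delta_mx _ _ _ _]mxE /= (negPf ji) mulr0.
Qed.

(** The expansion of the kernel, integrated over [E]: the quadratic remainder becomes a multiple of
    the potential at [x]. *)
Lemma riesz_frechet : frechet (fun z => fine (riesz z)) x (riesz_grad x).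
Proof.
pose M := (18 * p * (1 + p) + p) / dist_to E x ^+ 2.
have M0 : 0 <= M.
  by rewrite mulr_ge0 ?invr_ge0 ?exprn_ge0 ?addr_ge0 ?mulr_ge0 ?addr_ge0 // ltW.
exists (M * fine (riesz x)), (dist_to E x / (6 * (1 + p))).
split; first by rewrite mulr_ge0 // fine_ge0 // riesz_ge0.
  by rewrite divr_gt0 // mulr_gt0 // addr_gt0.
move=> h; rewrite ltr_pdivlMr; last by rewrite mulr_gt0 // addr_gt0.
rewrite mulrC => /ltW hd.
have h0 := enorm_ge0 h.
have h2 : 2 * enorm h <= dist_to E x.
  have h6 : 2 <= 6 * (1 + p) by have := p0; lra.
  by apply: le_trans hd; rewrite ler_wpM2r.
pose kh (y : borelRn R n) := enorm (x + h - (y : 'rV[R]_n)) `^ (- p).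
have Ikh : mu.-integrable E (EFin \o kh).
  apply/integrableP; split; first by apply/measurable_EFinP; apply: mk.
  under eq_integral do rewrite /= ger0_norm ?powR_ge0 //.
  apply: le_lt_trans (riesz_comparable d0 h2) _.
  by rewrite lte_mul_pinfty ?lee_fin ?powR_ge0.
pose w (y : borelRn R n) := dot (x - (y : 'rV[R]_n)) h * enorm (x - (y : 'rV[R]_n)) `^ (- p - 2).
have Iw : mu.-integrable E (EFin \o w) by exact: integrable_kernel_dot.
have Ik := integrable_kernel.
have Ikk : mu.-integrable E (EFin \o (fun y => kh y - k y)) by exact: (integrableB mE Ikh Ik).
have Ipw : mu.-integrable E (EFin \o (fun y => p * w y)) by exact: (integrableZl mE p Iw).
have -> : fine (riesz (x + h)) - fine (riesz x) - dot (riesz_grad x) h =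
   \int[mu]_(y in E) (kh y - k y + p * w y)%R.
  rewrite (RintegralD mE Ikk Ipw) (RintegralB mE Ikh Ik) (RintegralZl p mE Iw) dot_riesz_grad.
  by rewrite mulNr opprK.
apply: le_trans (le_normr_Rintegral _ _ ) _ => //.
  exact: (integrableD mE Ikk Ipw).
have -> : M * fine (riesz x) * enorm h ^+ 2 =
  \int[mu]_(y in E) (M * enorm h ^+ 2 * k y)%R.
  by rewrite RintegralZl // mulrAC.
apply: le_Rintegral => //.
- exact: (integrable_abse (integrableD mE Ikk Ipw)).
- exact: (integrableZl mE _ Ik).
- move=> y Ey; have := kernel_taylor p0 d0 (dist_to_le x Ey) hd.
  by rewrite (addrAC x).
Qed.

End finite.
End riesz_potential.

(** * Unbounded sets and supports *)

Section support.
Context {R : realType} {n : nat}.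
Variables (mu : {measure set borelRn R n -> \bar R}) (E : set 'rV[R]_n).

Lemma unbounded_nonempty : ~ bounded_set E -> E !=set0.
Proof.
move=> Eb; apply/set0P/negP => /eqP E0; apply: Eb; rewrite E0.
exists 0; split; first exact: num_real.
by move=> M _ x.
Qed.

(** Makes the Ahlfors bounds available at every radius. *)
Lemma unbounded_ediam : ~ bounded_set E -> ediam E = +oo%E.
Proof.
move=> Eb; have [a Ea] := unbounded_nonempty Eb.
apply/eqP; rewrite -leye_eq leNgt; apply/negP => Efin; apply: Eb.
have D0 : (0 <= ediam E)%E by apply: ereal_sup_ubound; left.
have Dfin : ediam E \is a fin_num by rewrite ge0_fin_numE.
exists (enorm a + fine (ediam E)); split; first exact: num_real.
move=> M aM x Ex /=; apply/ltW; apply: le_lt_trans aM.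
apply: (le_trans (norm_le_enorm _)).
have : enorm (a - x) <= fine (ediam E).
  rewrite -lee_fin fineK //; apply: ereal_sup_ubound; right.
  by exists a => //; exists x.
by have := enorm_sub x a; rewrite (enormBC x a); lra.
Qed.

(* The complement of the support is covered by countably many compact sets,
   hence by countably many null open sets. *)
Lemma measure_setC_support : closed E -> E !=set0 -> measure_support mu = E ->
  mu (~` E) = 0.
Proof.
move=> Ecl E0 supp.
(* A null open neighbourhood is chosen for each point off [E]; on [E] the value [set0] is a
   default. *)
have nbh x : {U : set 'rV[R]_n | ~ E x -> open_nbhs x U /\ mu U = 0}.
  apply: cid; have [Ex|nEx] := pselect (E x); first by exists set0.
  move: (nEx); rewrite -supp /measure_support /= => /existsNP[U /not_implyP[xU U0]].
  exists U => _; split => //; apply/eqP; rewrite -measure_le0 leNgt; exact/negP.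
pose K (k : nat) := [set x : 'rV[R]_n | enorm (0 - x) <= k%:R] `&`
   [set x | k.+1%:R^-1 <= dist_to E x].
have Kcl k : closed [set x | k.+1%:R^-1 <= dist_to E x].
  rewrite (_ : [set _ | _] = dist_to E @^-1` [set t | k.+1%:R^-1 <= t]) //.
  apply: (preimage_closed _ (@closed_ge R _)) => y _.
  exact: dist_to_continuous.
have KE k x : K k x -> ~ E x.
  move=> [_ /= kx] Ex; have := dist_to_le x Ex.
  rewrite subrr enorm0; apply/negP; rewrite -ltNge.
  by apply: lt_le_trans kx; rewrite invr_gt0.
have coverK : ~` E `<=` \bigcup_k K k.
  move=> x nEx; have d0 := dist_to_gt0 E0 Ecl nEx.
  have [k1 k1x] : exists k, enorm x < k%:R.
    by exists (Num.bound (enorm x)); apply: archi_boundP; exact: enorm_ge0.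
  have [k2 k2x] : exists k, (dist_to E x)^-1 < k%:R.
    by exists (Num.bound (dist_to E x)^-1); apply: archi_boundP; rewrite invr_ge0 ltW.
  exists (maxn k1 k2) => //; split => /=.
    by rewrite sub0r enormN; apply: le_trans (ltW k1x) _; rewrite ler_nat leq_maxl.
  rewrite invf_ple ?posrE //; apply: le_trans (ltW k2x) _.
  by rewrite ler_nat leqW // leq_maxr.
have Knull k : mu.-negligible (K k : set (borelRn R n)).
  have : compact (K k) by apply: compact_closedI => //; exact: eball_compact.
  rewrite compact_cover => /(_ 'rV[R]_n (~` E) (fun x => sval (nbh x))).
  move=> []; first by move=> x nEx; have [[]] := svalP (nbh x) nEx.
    move=> x Kx; exists x; first exact: KE Kx.
    by have [[]] := svalP (nbh x) (KE _ _ Kx).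
  move=> D DE KD; apply: (@negligibleS _ _ _ mu _ _ KD); rewrite /cover bigcup_fset big_seq.
  elim/big_ind: _ => [|A B|x xD]; first exact: negligible_set0.
    exact: negligibleU.
  have /set_mem nEx := DE _ xD; have [[oU _] U0] := svalP (nbh x) nEx.
  by apply/negligibleP => //; exact: open_borel.
apply/negligibleP; first by apply: measurableC; exact: closed_borel.
exact: (@negligibleS _ _ _ mu _ _ coverK (negligible_bigcup Knull)).
Qed.
End support.

(** * Potentials of Ahlfors regular measures *)

Section ahlfors_potential.
Context {R : realType} {n : nat}.
Variables (d alpha : R) (E : set 'rV[R]_n).
Variable mu : {measure set borelRn R n -> \bar R}.
Hypothesis d0 : 0 < d.
Hypothesis alpha0 : 0 < alpha.
Hypothesis Ecl : closed E.
Hypothesis E0 : E !=set0.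
Hypothesis muEC : mu (~` E) = 0.
Variable C : R.
Hypothesis C1 : 1 <= C.
Hypothesis muE : forall Q r, E Q -> 0 < r ->
  ((C^-1 * r `^ d)%:E <= mu (eball Q r) <= (C * r `^ d)%:E)%E.

Let p := d + alpha.
Let D := Dmu d alpha mu E.
Let Rz := riesz mu E p.

Let p0 : 0 < p. Proof. by rewrite addr_gt0. Qed.
Let mE : measurable (E : set (borelRn R n)). Proof. exact: closed_borel. Qed.
Let C0 : 0 < C. Proof. exact: lt_le_trans C1. Qed.

Lemma DmuE x : D x = fine (Rz x) `^ (- alpha^-1).
Proof. by rewrite /D /Dmu /Rmu -opprD. Qed.

Lemma measure_setIE (A : set (borelRn R n)) : measurable A -> mu (A `&` E) = mu A.
Proof.
move=> mA; have mAE : measurable (A `&` E : set (borelRn R n)) by exact: measurableI.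
have mEC : measurable (~` E : set (borelRn R n)) by exact: measurableC.
have mAEC : measurable (A `&` ~` E : set (borelRn R n)) by exact: measurableI.
apply/eqP; rewrite eq_le; apply/andP; split.
  by apply: le_measure; rewrite ?inE //; exact: subIsetl.
rewrite -[X in (mu X <= _)%E](setIT A) -(setUv E) setIUr.
apply: (le_trans (@measureU2 _ _ _ mu _ _ mAE mAEC)).
rewrite [X in (_ + X)%E](subset_measure0 _ _ _ muEC) ?adde0 //.
Qed.

(** Points of the ball of radius [t] about [Q] are within [2 * t] of [x], and this ball has mass at
    least t^d / C; the exponents add up to d - (d + alpha) = - alpha. *)
Lemma riesz_lower Q t x : E Q -> 0 < t -> enorm (x - Q) <= t -> ~ E x ->
  ((C^-1 * 2 `^ (- p) * t `^ (- alpha))%:E <= Rz x)%E.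
Proof.
move=> EQ t0 xQ nEx.
have mB : measurable (eball Q t : set (borelRn R n)) by apply: open_borel; exact: eball_open.
have mBE : measurable (eball Q t `&` E : set (borelRn R n)) by exact: measurableI.
have mk : measurable_fun (E : set (borelRn R n))
    (fun y : borelRn R n => (enorm (x - (y : 'rV[R]_n)) `^ (- p))%:E).
  by apply/measurable_EFinP; apply: measurable_funTS; exact: measurable_enorm_powR.
apply: (@le_trans _ _ (\int[mu]_(y in eball Q t `&` E) ((2 * t) `^ (- p))%:E)%E).
  rewrite integral_cst // measure_setIE //.
  have /andP[h _] := muE EQ t0.
  apply: le_trans (lee_wpmul2l _ h); last by rewrite lee_fin powR_ge0.
  rewrite -EFinM lee_fin powRM // ?(ltW t0) //.
  rewrite le_eqVlt; apply/orP; left; apply/eqP.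
  have -> : t `^ (- alpha) = t `^ (- p) * t `^ d.
    rewrite -powRD; last by rewrite (gt_eqF t0) implybT.
    by congr (_ `^ _); rewrite /p; ring.
  by ring.
apply: (@le_trans _ _ (\int[mu]_(y in eball Q t `&` E) (enorm (x - (y : 'rV[R]_n)) `^ (- p))%:E)%E).
  apply: ge0_le_integral => //.
  - by move=> y _; rewrite lee_fin powR_ge0.
  - exact: measurable_funS mk.
  - move=> y [/= Qy Ey]; rewrite lee_fin !powRN lef_pV2 ?posrE ?powR_gt0 ?mulr_gt0 //.
      apply: ge0_ler_powR; rewrite ?nnegrE ?enorm_ge0 ?(ltW p0) ?mulr_ge0 ?(ltW t0) //.
      by have := enorm_dist Q x y; move: Qy xQ; rewrite /eball /=; lra.
    rewrite enorm_gt0 subr_eq0; apply/eqP => xy; apply: nEx; rewrite xy; exact: Ey.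
apply: ge0_subset_integral => //.
by move=> y _; rewrite lee_fin powR_ge0.
Qed.

Hypothesis grad_gt0 : forall x, ~ E x -> 0 < enorm (gradient D x).

(* If the potential were infinite at [x], it would be infinite near [x], so that
   [D] would vanish there and so would its gradient. *)
Lemma riesz_fin x : ~ E x -> (Rz x < +oo)%E.
Proof.
move=> nEx; rewrite ltNge leye_eq; apply/negP => /eqP Rx.
have dx := dist_to_gt0 E0 Ecl nEx.
have := grad_gt0 nEx.
suff -> : gradient D x = 0 by rewrite enorm0 ltxx.
(* A third of the distance keeps [2 * enorm h] below the distance from [x + h] to [E], so that the
   comparison runs from [x + h] back to [x]. *)
have Dz h : enorm h < dist_to E x / 3 -> D (x + h) = 0.
  move=> hd; rewrite DmuE.
  suff -> : Rz (x + h) = +oo%E.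
    (* [fine] sends [+oo] to 0, and 0 to a nonzero power is 0. *)
    by rewrite /= powR0 // oppr_eq0 invr_eq0 gt_eqF.
  have hdx := dist_to_lip E0 x (x + h).
  rewrite opprD addNKr enormN in hdx.
  have hd0 : 0 < dist_to E (x + h) by lra.
  have hd2 : 2 * enorm (- h) <= dist_to E (x + h) by rewrite enormN; lra.
  have := riesz_comparable mu p0 mE hd0 hd2.
  rewrite addrK [riesz _ _ _ x]Rx leye_eq => /eqP RxE.
  apply/eqP; rewrite -leye_eq leNgt; apply/negP => Rfin.
  suff : ((2 `^ p)%:E * Rz (x + h) < +oo)%E by rewrite RxE.
  by rewrite lte_mul_pinfty ?lee_fin ?powR_ge0.
apply: frechet_gradient; exists 0, (dist_to E x / 3); split => //.
  by rewrite divr_gt0.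
move=> h hd; rewrite (Dz h hd).
have -> : D x = 0 by rewrite -[x]addr0 Dz // enorm0 divr_gt0.
by rewrite dot0l !subrr normr0 mul0r.
Qed.

(** All that matters of [k] is that it is nonzero: the gradients of [D] and of the potential are
    then orthogonal to the same vectors. *)
Lemma D_frechet_riesz x : ~ E x -> exists2 k, k != 0 &
  frechet D x (k *: riesz_grad mu E p x).
Proof.
move=> nEx; have dx := dist_to_gt0 E0 Ecl nEx.
have Rx := riesz_fin nEx.
have Rf : Rz x \is a fin_num by rewrite ge0_fin_numE // riesz_ge0.
have R0 : 0 < fine (Rz x).
  have [q Eq xq] := dist_to_attained E0 Ecl x.
  rewrite -lte_fin fineK //; apply: lt_le_trans (riesz_lower Eq dx _ nEx).
    by rewrite lte_fin !mulr_gt0 ?invr_gt0 ?powR_gt0.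
  by rewrite xq.
have a0 : 0 < alpha^-1 by rewrite invr_gt0.
have DE : D = (fun y => fine (Rz y) `^ (- alpha^-1)) by apply/funext => y; rewrite DmuE.
have := frechet_powR a0 R0 (riesz_frechet p0 mE dx Rx).
rewrite -/Rz -DE => h.
exists (- (alpha^-1 * fine (Rz x) `^ (- alpha^-1) / fine (Rz x))); last exact: h.
have P0 : 0 < fine (Rz x) `^ (- alpha^-1) := powR_gt0 _ R0.
have Q0 : 0 < alpha^-1 * fine (Rz x) `^ (- alpha^-1) := mulr_gt0 a0 P0.
by rewrite oppr_eq0 (gt_eqF (divr_gt0 Q0 R0)).
Qed.

Lemma D_frechet x : ~ E x -> frechet D x (gradient D x).
Proof.
by move=> /D_frechet_riesz[k _ h]; rewrite (frechet_gradient h).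
Qed.

(** The derivative along [e] is a multiple of the integral of a function of constant sign, which
    must then vanish almost everywhere. If it were positive at a point of [E], it would be positive
    at the points of [E] in a ball about that point, and such balls have positive mass. *)
Lemma gradient_orthogonal x e : ~ E x -> dot (gradient D x) e = 0 ->
  (forall y, E y -> 0 <= dot (x - y) e) -> forall y, E y -> dot (x - y) e = 0.
Proof.
move=> nEx; have [k k0 /frechet_gradient ->] := D_frechet_riesz nEx.
have dx := dist_to_gt0 E0 Ecl nEx; have Rx := riesz_fin nEx.
rewrite dotZl (dot_riesz_grad mE dx Rx) => /eqP.
rewrite !mulf_eq0 oppr_eq0 (negPf k0) (gt_eqF p0) /= => /eqP I0 xe y Ey.
pose w (y : borelRn R n) := dot (x - (y : 'rV[R]_n)) e * enorm (x - (y : 'rV[R]_n)) `^ (- p - 2).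
have Iw : mu.-integrable E (EFin \o w) by exact: integrable_kernel_dot.
have w0 z : E z -> 0 <= w z by move=> Ez; rewrite mulr_ge0 ?powR_ge0 ?xe.
have : (\int[mu]_(y in E) `|(EFin \o w) y| = 0)%E.
  rewrite -[RHS]/(0%:E) -I0 fineK; last exact: integrable_fin_num.
  by apply: eq_integral => z; rewrite inE => /w0 z0; rewrite /= ger0_norm.
move=> /(ae_eq_integral_abs mu mE (measurable_int _ Iw)) w_ae.
apply/eqP; rewrite eq_le xe // andbT leNgt; apply/negP => xy.
have e0 : 0 < enorm e + 1 by rewrite ltr_wpDl ?enorm_ge0.
(* On the ball of this radius Cauchy-Schwarz keeps [dot (x - z) e] positive; adding 1 avoids a
   division by zero. *)
pose r := dot (x - y) e / (enorm e + 1).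
have r0 : 0 < r by rewrite divr_gt0.
have mB : measurable (eball y r : set (borelRn R n)) by apply: open_borel; exact: eball_open.
have mBE : measurable (eball y r `&` E : set (borelRn R n)) by exact: measurableI.
suff : mu (eball y r `&` E) = 0.
  rewrite measure_setIE // => mu0; have /andP[h _] := muE Ey r0.
  by move: h; rewrite mu0 lee_fin leNgt mulr_gt0 ?invr_gt0 ?powR_gt0.
apply/(negligibleP _ mBE); apply: negligibleS w_ae.
move=> z [/= yz Ez] /(_ Ez) /= [] /eqP; apply/negP; rewrite gt_eqF // mulr_gt0 //.
  have := cauchy_schwarz (y - z) e.
  have -> : x - z = (x - y) + (y - z) by rewrite addrA subrK.
  rewrite (dotDl (x - y)) ler_norml => /andP[h _].
  rewrite -ltrBlDr sub0r; apply: (le_lt_trans (y := enorm (y - z) * enorm e)).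
    by rewrite lerNl.
  apply: (le_lt_trans (y := enorm (y - z) * (enorm e + 1))).
    by rewrite ler_wpM2l ?enorm_ge0 // lerDl.
  by rewrite -ltr_pdivlMr.
rewrite powR_gt0 // enorm_gt0 subr_eq0; apply/eqP => xz; apply: nEx.
by rewrite xz.
Qed.

(** The lower bound on the potential, raised to the power - 1 / alpha: [D] tends to 0 at [E], at
    most linearly. *)
Lemma D_near : exists2 K, 0 < K & forall Q t x, E Q -> 0 < t ->
  enorm (x - Q) <= t -> ~ E x -> D x <= K * t.
Proof.
pose c1 := C^-1 * 2 `^ (- p); have c10 : 0 < c1 by rewrite mulr_gt0 ?invr_gt0 ?powR_gt0.
exists (c1 `^ (- alpha^-1)); first exact: powR_gt0.
move=> Q t x EQ t0 xQ nEx.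
have h := riesz_lower EQ t0 xQ nEx.
have Rf : Rz x \is a fin_num by rewrite ge0_fin_numE ?riesz_ge0 ?riesz_fin.
have ct : 0 < c1 * t `^ (- alpha) by rewrite mulr_gt0 ?powR_gt0.
have {}h : c1 * t `^ (- alpha) <= fine (Rz x) by rewrite -lee_fin fineK.
have -> : c1 `^ (- alpha^-1) * t = (c1 * t `^ (- alpha)) `^ (- alpha^-1).
  rewrite [RHS]powRM ?powR_ge0 ?(ltW c10) // -powRrM mulrNN mulfV ?gt_eqF //.
  by rewrite powRr1 // ltW.
have R0 := lt_le_trans ct h.
rewrite DmuE (powRN (fine _)) (powRN (_ * _)) lef_pV2 ?posrE ?powR_gt0 //.
apply: ge0_ler_powR; rewrite ?nnegrE ?invr_ge0 ?(ltW alpha0) ?(ltW ct) //.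
by apply: le_trans h; exact: ltW.
Qed.

End ahlfors_potential.

(** * Half-spaces avoiding the set *)

(** A locally constant function has derivative 0 along every direction, so the mean value theorem
    applies on the segment. *)
Lemma locally_constant_segment {R : realType} {n : nat} (E : set 'rV[R]_n)
    (f : 'rV[R]_n -> R) (x y : 'rV[R]_n) :
  closed E -> locally_constant_on (~` E) f ->
  (forall t, 0 <= t <= 1 -> ~ E (x + t *: (y - x))) -> f y = f x.
Proof.
move=> Ecl fE xyE.
have fc z v : ~ E z -> dirder f z v 0.
  move=> nEz e e0; have /nbhs_eballP[r r0 hr] := fE z nEz.
  have Eo := open_nbhs_nbhs (conj (closed_openC Ecl) nEz).
  have /nbhs_eballP[r' r'0 hr'] := Eo.
  have k0 : 0 < enorm v + 1 by rewrite ltr_wpDl ?enorm_ge0.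
  exists (Num.min r r' / (enorm v + 1)); first by rewrite divr_gt0 // lt_min r0.
  move=> t; rewrite ltr_pdivlMr // => ht.
  have : enorm (z - (z + t *: v)) < Num.min r r'.
    rewrite opprD addNKr enormN enormZ; apply: le_lt_trans ht.
    by rewrite ler_wpM2l // lerDl.
  rewrite lt_min => /andP[/hr h1 /hr' h2].
  by rewrite (h1 h2) mul0r subr0 subrr normr0 mulr_ge0 // ltW.
have [t t01||t t01] := @MVT_segment R (fun t => f (x + t *: (y - x))) (fun=> 0) 0 1 ler01.
- apply: dirder_along; apply: fc; apply: xyE.
  by move: t01; rewrite in_itv /= => /andP[? ?]; rewrite !ltW.
- apply: continuous_in_subspaceT => t; rewrite inE /= in_itv /= => /xyE tE.
  apply: differentiable_continuous; apply/derivable1_diffP.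
  by have [] := dirder_along (fc _ (y - x) tE).
by rewrite scale1r scale0r addr0 subrKC mul0r => /eqP; rewrite subr_eq0 => /eqP.
Qed.

Section half_space.
Context {R : realType} {n : nat}.
Variables (E : set 'rV[R]_n) (D : 'rV[R]_n -> R) (G : 'rV[R]_n -> 'rV[R]_n) (K : R).
Hypothesis Ecl : closed E.
Hypothesis E0 : E !=set0.
Hypothesis D_ge0 : forall x, 0 <= D x.
Hypothesis D_frechet : forall x, ~ E x -> frechet D x (G x).
Hypothesis K0 : 0 < K.
Hypothesis D_near : forall q t x, E q -> 0 < t -> enorm (x - q) <= t -> ~ E x ->
  D x <= K * t.
Hypothesis G_gt0 : forall x, ~ E x -> 0 < enorm (G x).
Hypothesis G_const : locally_constant_on (~` E) (fun x => enorm (G x)).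

Lemma ball_outside x y : enorm (x - y) < dist_to E x -> ~ E y.
Proof. by move=> xy /(dist_to_le x); rewrite leNgt xy. Qed.

Lemma G_const_ball x y : enorm (x - y) < dist_to E x -> enorm (G y) = enorm (G x).
Proof.
move=> xy; apply: (locally_constant_segment Ecl G_const) => t /andP[t0 t1].
apply: (@ball_outside x); rewrite opprD addNKr enormN enormZ ger0_norm //.
by apply: le_lt_trans xy; rewrite (enormBC x) ler_piMl ?enorm_ge0.
Qed.

Section at_point.
Variable x : 'rV[R]_n.
Hypothesis nEx : ~ E x.

Let r := dist_to E x.

Let nD y := - D y.
Let nG y := - G y.

Let nDG y v : enorm (x - y) < r -> dirder nD y v (dot (nG y) v).
Proof.
by move=> /ball_outside/D_frechet/(frechet_dirder v) h; rewrite dotNl; exact: dirderN.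
Qed.

Let nDc y : enorm (x - y) < r -> {for y, continuous nD}.
Proof.
by move=> /ball_outside/D_frechet/frechet_continuous h; exact: continuousN.
Qed.

Let nGc y : enorm (x - y) < r -> enorm (nG y) = enorm (G x).
Proof. by move=> h; rewrite enormN -(G_const_ball h). Qed.

(* Ascent of [- D] reaches the slope [enorm (G x)] up to the boundary of the ball
   [eball x r], where [D] is still nonnegative. *)
Lemma D_dist : D x = enorm (G x) * r.
Proof.
have r0 : 0 < r := dist_to_gt0 E0 Ecl nEx.
have cx := G_gt0 nEx.
apply/eqP; rewrite eq_le; apply/andP; split.
  have [q Eq xq] := dist_to_attained E0 Ecl x.
  apply/ler_addgt0Pr => e e0.
  (* The point [z] below is on the segment from [q] to [x], close to [q], where [D] is at most K t
     r; this [t] makes it at most [e]. *)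
  pose t := Num.min (1/2) (e / (K * r)).
  have t0 : 0 < t by rewrite lt_min !divr_gt0 // mulr_gt0.
  have t1 : t < 1 by rewrite gt_min; apply/orP; left; lra.
  have te : K * r * t <= e.
    by rewrite mulrC -ler_pdivlMr ?mulr_gt0 // ge_min lexx orbT.
  pose z := q + t *: (x - q).
  have xz : enorm (x - z) = (1 - t) * r.
    have -> : x - z = (1 - t) *: (x - q).
      by rewrite /z scalerBl scale1r opprD addrA.
    by rewrite enormZ ger0_norm ?subr_ge0 ?(ltW t1) // xq.
  have xzr : enorm (x - z) < r by rewrite xz gtr_pMl // ltrBlDr ltrDl.
  have := eikonal_lip nDG nGc xzr; rewrite /nD xz opprK addrC => h.
  have := @D_near q (t * r) z Eq; rewrite mulr_gt0 // /z [_ - q]addrAC subrr add0r.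
  rewrite enormZ (gtr0_norm t0) xq lexx => /(_ isT isT (ball_outside xzr)) h2.
  have : enorm (G x) * ((1 - t) * r) <= enorm (G x) * r.
    by rewrite ler_wpM2l ?(ltW cx) // ler_piMl ?(ltW r0) // lerBlDr lerDl ltW.
  by lra.
apply/ler_addgt0Pr => e e0; rewrite -lerBlDr.
have [ec|ec] := leP (enorm (G x) * r) e.
  by apply: le_trans (D_ge0 _); rewrite subr_le0.
(* Ascent is available only at radii below [r], hence this small loss. *)
pose s := r - e / enorm (G x).
have s0 : 0 < s < r.
  by rewrite subr_gt0 ltr_pdivrMr // mulrC ec /= ltrBlDr ltrDl divr_gt0.
have [z xz hz] := eikonal_ascent cx nDc nDG nGc s0.
have Dz : 0 <= D z by exact: D_ge0.
have -> : enorm (G x) * r - e = enorm (G x) * s.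
  by rewrite /s mulrBr mulrC [enorm (G x) * (e / _)]mulrC divfK ?gt_eqF.
by move: hz; rewrite /nD; lra.
Qed.

End at_point.

(* The point of the sphere of radius [(t - 1) r] about [x] where [D] is largest is at
   distance [t r] from [E], so that the triangle inequality through [x] is an
   equality and this point is on the ray from [q] through [x]. *)
Lemma dist_to_ray2 x q t : ~ E x -> E q -> enorm (x - q) = dist_to E x ->
  1 <= t < 2 -> dist_to E (q + t *: (x - q)) = t * dist_to E x.
Proof.
move=> nEx Eq xq /andP[]; rewrite le_eqVlt => /orP[/eqP <- _|t1 t2].
  by rewrite scale1r mul1r subrKC.
set r := dist_to E x in xq *.
have r0 : 0 < r := dist_to_gt0 E0 Ecl nEx.
have cx := G_gt0 nEx.
have [||||z xz hz] := @eikonal_ascent R n D (G) x r (enorm (G x)) cx _ _ _ ((t - 1) * r).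
- by move=> y /ball_outside/D_frechet/frechet_continuous.
- by move=> y v /ball_outside/D_frechet/(frechet_dirder v).
- by move=> y /G_const_ball.
- by rewrite mulr_gt0 ?subr_gt0 //= gtr_pMl // ltrBlDr.
have xzr : enorm (x - z) < r by rewrite xz gtr_pMl // ltrBlDr.
have nEz := ball_outside xzr.
(* The slope at [z] is the slope at [x], so the lower bound on [D z] is a lower bound on its
   distance to [E]. *)
have dz : t * r <= dist_to E z.
  rewrite -(ler_pM2l cx) -{2}(G_const_ball xzr) -(D_dist nEz).
  by apply: le_trans hz; rewrite (D_dist nEx) -/r le_eqVlt; apply/orP; left; apply/eqP; ring.
have zq : enorm ((x - q) + (z - x)) = enorm (x - q) + enorm (z - x).
  apply/eqP; rewrite eq_le enormD /= xq (enormBC z) xz.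
  have := dist_to_le z Eq; rewrite (_ : x - q + (z - x) = z - q); last first.
    by rewrite addrC subrKA.
  by lra.
have := enorm_colinear zq; rewrite (enormBC z) xz xq => h.
have zE : z - x = (t - 1) *: (x - q).
  apply: (scalerI (a := r)); first by rewrite gt_eqF.
  by rewrite -h scalerA mulrC.
have zE2 : z = q + t *: (x - q).
  rewrite -(subrK x z) zE scalerBl scale1r.
  by rewrite -addrA opprB subrK addrC.
rewrite -zE2; apply/eqP; rewrite eq_le dz andbT.
apply: le_trans (dist_to_le z Eq) _.
by rewrite zE2 addrAC subrr add0r enormZ xq ger0_norm // ltW // (lt_trans _ t1).
Qed.

(** One step reaches only ratios below 2, since it stays in the ball of radius [dist_to E x]; the
    fixed ratio 3 / 2 is iterated to go arbitrarily far along the ray. *)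
Lemma dist_to_ray x q m : ~ E x -> E q -> enorm (x - q) = dist_to E x ->
  dist_to E (q + (3 / 2) ^+ m *: (x - q)) = (3 / 2) ^+ m * dist_to E x.
Proof.
move=> nEx Eq xq; elim: m => [|m IH].
  by rewrite !expr0 scale1r mul1r subrKC.
set y := q + _ in IH.
have r0 := dist_to_gt0 E0 Ecl nEx.
have nEy : ~ E y.
  apply: (@ball_outside y); rewrite subrr enorm0 IH mulr_gt0 // exprn_gt0 //; lra.
have yq : enorm (y - q) = dist_to E y.
  rewrite IH /y addrAC subrr add0r enormZ xq ger0_norm // exprn_ge0 //; lra.
have : 1 <= (3 / 2 : R) < 2 by apply/andP; split; lra.
move=> /(dist_to_ray2 nEy Eq yq); rewrite IH mulrA -exprS => <-.
by rewrite /y (addrAC q) subrr add0r scalerA -exprS.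
Qed.

(* The balls of radius [dist_to E y] about the points [y] of the ray from [q] through
   [x] miss [E] and exhaust an open half-space. *)
Lemma half_space x : ~ E x -> exists q, [/\ E q, enorm (x - q) = dist_to E x &
  forall y, E y -> dot (y - q) (x - q) <= 0].
Proof.
move=> nEx; have [q Eq xq] := dist_to_attained E0 Ecl x.
exists q; split => // y Ey; rewrite leNgt; apply/negP => yx.
(* With s = (3 / 2)^m, this inequality says that [y] is closer than s |x - q| to the point q + s (x
   - q) of the ray. *)
have [m hm] : exists m, dot (y - q) (y - q) < 2 * (3 / 2) ^+ m * dot (y - q) (x - q).
  have bern m : m%:R <= 2 * (3 / 2 : R) ^+ m.
    elim: m => [|m IH]; first by rewrite expr0 mulr1.
    have : 1 <= (3 / 2 : R) ^+ m by apply: exprn_ege1; lra.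
    have <- : m%:R + 1 = m.+1%:R :> R by exact: natr1.
    by rewrite exprS; lra.
  exists (Num.bound (dot (y - q) (y - q) / dot (y - q) (x - q))).
  rewrite -ltr_pdivrMr //; apply: lt_le_trans (bern _).
  by apply: archi_boundP; rewrite divr_ge0 ?dot_ge0 // ltW.
have := dist_to_le (q + (3 / 2) ^+ m *: (x - q)) Ey.
rewrite (dist_to_ray m nEx Eq xq) -xq; apply/negP; rewrite -ltNge.
have t0 : 0 < (3 / 2 : R) ^+ m by rewrite exprn_gt0 //; lra.
rewrite -ltr_sqr ?nnegrE ?mulr_ge0 ?enorm_ge0 ?(ltW t0) //.
have -> : q + (3 / 2) ^+ m *: (x - q) - y = (3 / 2) ^+ m *: (x - q) - (y - q).
  by rewrite opprB [RHS]addrCA addrA.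
rewrite enorm_sqrB enormZ (gtr0_norm t0) dotZl (dotC (x - q)).
by rewrite (enorm_sqr (y - q)); lra.
Qed.

End half_space.

(** * Dimension of the affine span *)

Section counting.
Context d (T : measurableType d) {R : realType} (mu : {measure set T -> \bar R}).
Context (I : eqType) (F : I -> set T).
Hypothesis mF : forall i, measurable (F i).

Lemma measure_disjoint_ge (s : seq I) (B : set T) (m : R) : uniq s -> measurable B ->
  (forall i, i \in s -> F i `<=` B) ->
  (forall i j x, F i x -> F j x -> i = j) ->
  (forall i, (m%:E <= mu (F i))%E) ->
  (((size s)%:R * m)%:E <= mu B)%E.
Proof.
move=> + + + tF Fm; elim: s B => [|i s IH] B /=.
  by rewrite mul0r => *; exact: measure_ge0.
move=> /andP[is_ us] mB sB.
have mBF : measurable (B `\` F i) by exact: measurableD.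
have -> : B = F i `|` (B `\` F i).
  by rewrite setDUK //; apply: sB; rewrite mem_head.
rewrite measureU //; last by rewrite setDIK.
rewrite -natr1 mulrDl mul1r addrC EFinD leeD ?Fm //.
apply: IH => // j js x Fx; split; first by apply: (sB j) => //; rewrite in_cons js orbT.
by move=> /(tF _ _ _ Fx) ji; move: is_; rewrite -ji js.
Qed.

Lemma measure_cover_le (s : seq I) (A : set T) (m : R) : measurable A ->
  (forall x, A x -> exists2 i, i \in s & F i x) ->
  (forall i, i \in s -> (mu (F i) <= m%:E)%E) ->
  (mu A <= ((size s)%:R * m)%:E)%E.
Proof.
elim: s A => [|i s IH] A mA /=.
  move=> h _; have -> : A = set0 by apply/seteqP; split => // x /h[].
  by rewrite measure0 mul0r.
move=> sA Fm.
have mAF : measurable (A `&` F i) by exact: measurableI.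
have mAD : measurable (A `\` F i) by exact: measurableD.
rewrite -(setUIDK A (F i)) measureU //; last first.
  by apply/seteqP; split => // x [[_ ?] []].
rewrite -natr1 mulrDl mul1r addrC EFinD leeD //; last first.
  by apply: (le_trans _ (Fm i (mem_head _ _))); apply: le_measure; rewrite ?inE //; exact: subIsetr.
apply: IH => // [x [/sA[j]]|j js]; last by apply: Fm; rewrite in_cons js orbT.
by rewrite in_cons => /orP[/eqP -> //|js Fx _]; exists j.
Qed.

End counting.

Section growth.
Context {R : realType}.

(** Turns counts of balls, valid at every scale 1 / N, into an inequality between dimensions. *)
Lemma le_of_powR_bound (a b B : R) :
  (forall N : nat, (0 < N)%N -> N%:R `^ a <= B * N%:R `^ b) -> a <= b.
Proof.
move=> h; rewrite leNgt; apply/negP => ba.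
have ab0 : 0 < a - b by rewrite subr_gt0.
pose N := (Num.bound (`|B| `^ (a - b)^-1)).+1.
have N0 : 0 < N%:R :> R by rewrite ltr0n.
have := h N isT; rewrite -ler_pdivrMr ?powR_gt0 // -powRN -powRD; last first.
  by rewrite (gt_eqF N0) implybT.
apply/negP; rewrite -ltNge; apply: le_lt_trans (ler_norm B) _.
have -> : `|B| = (`|B| `^ (a - b)^-1) `^ (a - b).
  by rewrite -powRrM mulVf ?gt_eqF // powRr1.
apply: gt0_ltr_powR; rewrite ?nnegrE ?powR_ge0 ?(ltW N0) //.
apply: lt_trans (_ : _ < (Num.bound (`|B| `^ (a - b)^-1))%:R) _.
  by apply: archi_boundP; exact: powR_ge0.
by rewrite ltr_nat.
Qed.

End growth.

Section coordinates.
Context {R : realType} {n k : nat}.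
Variable X : k.-tuple 'rV[R]_n.
Hypothesis freeX : free X.

(** Coordinates are Lipschitz: this separates the points of a grid and bounds the number of points
    that a cover needs. *)
Lemma coord_bounded : exists2 K, 1 <= K & forall i (w : 'rV[R]_n),
  `|coord X i w| <= K * enorm w.
Proof.
exists (1 + \sum_(i < k) \sum_(j < n) `|coord X i (delta_mx 0 j)|).
  by rewrite lerDl; apply: sumr_ge0 => i _; apply: sumr_ge0.
move=> i w; rewrite {1}[w]row_sum_delta linear_sum /=.
apply: le_trans (ler_norm_sum _ _ _) _.
apply: (@le_trans _ _ (\sum_(j < n) `|coord X i (delta_mx 0 j)| * enorm w)).
  apply: ler_sum => j _; rewrite linearZ /= normrM mulrC ler_wpM2l //.
  rewrite -ler_sqr ?nnegrE ?enorm_ge0 // real_normK ?num_real // enorm_sqr.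
  rewrite /dot (bigD1 j) //= -expr2 lerDl.
  by apply: sumr_ge0 => l _; rewrite -expr2 sqr_ge0.
rewrite -mulr_suml ler_wpM2r ?enorm_ge0 // (bigD1 i) //= addrCA lerDl.
by rewrite addr_ge0 //; apply: sumr_ge0 => j _; apply: sumr_ge0.
Qed.

Lemma enorm_comb_le (t : 'I_k -> R) b : (forall i, `|t i| <= b) ->
  enorm (\sum_(i < k) t i *: X`_i) <= b * \sum_(i < k) enorm X`_i.
Proof.
move=> tb; rewrite mulr_sumr.
elim/big_ind2: _ => [|x1 x2 y1 y2 h1 h2|i _]; first by rewrite enorm0.
  by apply: le_trans (enormD _ _) _; exact: lerD.
by rewrite enormZ ler_wpM2r ?enorm_ge0.
Qed.

End coordinates.

Lemma natr_dist_lt1 {R : realType} (i j : nat) : `|i%:R - j%:R : R| < 1 -> i = j.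
Proof.
have lt_dist (l m : nat) : (l < m)%N -> 1 <= m%:R - l%:R :> R.
  by move=> lm; rewrite lerBrDr addrC natr1 ler_nat.
rewrite ltr_norml => /andP[h1 h2]; have [/lt_dist|/lt_dist|//] := ltngtP i j.
  by rewrite -opprB lerNr leNgt h1.
by rewrite leNgt h2.
Qed.

Section dimension.
Context {R : realType} {n k : nat}.
Variables (d C : R) (E : set 'rV[R]_n) (mu : {measure set borelRn R n -> \bar R}).
Hypothesis C1 : 1 <= C.
Hypothesis mE : measurable (E : set (borelRn R n)).
Hypothesis muI : forall A : set (borelRn R n), measurable A -> mu (A `&` E) = mu A.
Hypothesis muE : forall Q r, E Q -> 0 < r ->
  ((C^-1 * r `^ d)%:E <= mu (eball Q r) <= (C * r `^ d)%:E)%E.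
Variables (X : k.-tuple 'rV[R]_n) (a : 'rV[R]_n).
Hypothesis freeX : free X.
Hypothesis Ea : E a.

Let comb (t : 'I_k -> R) : 'rV[R]_n := a + \sum_(i < k) t i *: X`_i.

Let W := \sum_(i < k) enorm X`_i.
Let W0 : 0 <= W. Proof. by apply: sumr_ge0 => i _; exact: enorm_ge0. Qed.

Let mball (Q : 'rV[R]_n) r : measurable (eball Q r : set (borelRn R n)).
Proof. by apply: open_borel; exact: eball_open. Qed.

(* Packing: the points of the grid of step [1 / (k N)] are centers of [N ^ k]
   disjoint balls of radius comparable to [1 / N]. *)
Lemma dim_le_of_box_subset : (forall t, (forall i, 0 <= t i <= k%:R^-1) -> E (comb t)) ->
  (0 < k)%N -> k%:R <= d.
Proof.
move=> boxE k0; have C0 : 0 < C := lt_le_trans ltr01 C1.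
have kR : 0 < k%:R :> R by rewrite ltr0n.
have [K K1 hK] := coord_bounded X.
have K0 : 0 < K := lt_le_trans ltr01 K1.
(* With this value [K * (2 * rho)] is the grid step 1 / (k N), so balls with a common point have the
   same indices. *)
pose q := 2 * K * k%:R.
have q0 : 0 < q by rewrite !mulr_gt0.
have q1 : 1 <= q.
  have : 1 <= k%:R :> R by rewrite ler1n.
  have := K1; rewrite /q; nra.
apply: (@le_of_powR_bound _ _ _ (C * C * (W + 2) `^ d * q `^ d)) => N N0.
have NR : 0 < N%:R :> R by rewrite ltr0n.
have N1 : 1 <= N%:R :> R by rewrite ler1n.
have Nk0 : 0 < k%:R * N%:R :> R by rewrite mulr_gt0.
pose t (g : {ffun 'I_k -> 'I_N}) i : R := (g i)%:R / (k%:R * N%:R).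
have t0 g i : 0 <= t g i by rewrite divr_ge0 // ltW.
have t1 g i : t g i <= k%:R^-1.
  rewrite ler_pdivrMr // mulrA mulVf ?gt_eqF // mul1r ler_nat ltnW //.
have tE g : E (comb (t g)) by apply: boxE => i; rewrite t0 t1.
pose rho := (q * N%:R)^-1.
have rho0 : 0 < rho by rewrite invr_gt0 mulr_gt0.
have rho1 : rho <= 1 by rewrite invf_le1 ?mulr_gt0 //; have := N1; have := q1; nra.
have W2 : 0 < W + 2 by rewrite ltr_wpDl.
have := @measure_disjoint_ge _ _ _ mu {ffun 'I_k -> 'I_N}
  (fun g => eball (comb (t g)) rho) (fun g => mball _ _) (enum {ffun 'I_k -> 'I_N})
  (eball a (W + 2)) (C^-1 * rho `^ d) (enum_uniq _) (mball _ _).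
move=> /(_ _ _ _)/le_trans.
have /andP[_ h2] := muE Ea W2.
move=> /(_ _ _ _ _ h2).
rewrite lee_fin -cardE card_ffun !card_ord.
move=> h.
have {h} /h h : forall g : {ffun 'I_k -> 'I_N}, g \in enum {ffun 'I_k -> 'I_N} ->
    eball (comb (t g)) rho `<=` eball a (W + 2).
  move=> g _ z; rewrite /eball /= => gz.
  have := enorm_dist (comb (t g)) a z.
  rewrite {1}/comb opprD addNKr enormN.
  have : enorm (\sum_(i < k) t g i *: X`_i) <= 1 * W.
    apply: enorm_comb_le => i; rewrite ger0_norm // (le_trans (t1 g i)) //.
    by rewrite invf_le1 // ler1n.
  by have := rho1; lra.
have {h} /h h : forall (g g' : {ffun 'I_k -> 'I_N}) z,
    eball (comb (t g)) rho z -> eball (comb (t g')) rho z -> g = g'.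
  move=> g g' z; rewrite /eball /= => gz gz'; apply/ffunP => i.
  have gg' : enorm (comb (t g) - comb (t g')) < 2 * rho.
    by have := enorm_dist z (comb (t g)) (comb (t g')); rewrite (enormBC z); lra.
  have : `|t g i - t g' i| < (k%:R * N%:R)^-1.
    have -> : (k%:R * N%:R)^-1 = K * (2 * rho).
      by rewrite /rho /q; field; rewrite !gt_eqF.
    apply: (@le_lt_trans _ _ (K * enorm (comb (t g) - comb (t g')))); last by rewrite ltr_pM2l.
    apply: le_trans (hK i _); rewrite /comb opprD addrACA subrr add0r.
    by rewrite linearB /= !coord_sum_free.
  rewrite /t -mulrBl normrM normfV [`|k%:R * _|]gtr0_norm // -[ltRHS]mul1r ltr_pM2r ?invr_gt0 //.
  by move=> /natr_dist_lt1 gi; exact: val_inj.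
have {h} /h h : forall g : {ffun 'I_k -> 'I_N},
    ((C^-1 * rho `^ d)%:E <= mu (eball (comb (t g)) rho))%E.
  by move=> g; have /andP[] := muE (tE g) rho0.
rewrite powR_mulrn ?(ltW NR) // -natrX.
have rhoE : rho `^ d = (q `^ d * N%:R `^ d)^-1.
  have qN := mulr_gt0 q0 NR.
  rewrite /rho -(powR_inv1 (ltW qN)) -powRrM mulN1r powRN powRM //; exact: ltW.
have qN0 : 0 < q `^ d * N%:R `^ d by rewrite mulr_gt0 ?powR_gt0.
move: h; rewrite rhoE -invfM ler_pdivrMr ?mulr_gt0 ?powR_gt0 //.
by move/le_trans; apply; rewrite le_eqVlt; apply/orP; left; apply/eqP; ring.
Qed.

Hypothesis combE : forall t, E (comb t).
Hypothesis Espan : forall x, E x -> x - a \in <<X>>%VS.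

(** Coordinates are rounded down to a grid of step 1 / N. No measure occurs, as the cover serves
    both the bound on [d] and the finiteness of the Hausdorff measure of a ball. *)
Lemma grid_cover : exists (L : nat) (w : R), [/\ 0 < L%:R :> R, 0 < w &
  forall N, (0 < N)%N -> exists s : seq 'rV[R]_n, [/\ size s = ((2 * L * N) ^ k)%N,
    forall P, P \in s -> E P &
    forall x, (eball a 1 `&` E) x -> exists2 P, P \in s & eball P (w / N%:R) x]].
Proof.
have [K K1 hK] := coord_bounded X.
have [L KL] : exists L : nat, K < L%:R.
  by exists (Num.bound K); apply: archi_boundP; apply: le_trans K1.
have L0 : 0 < L%:R :> R by apply: le_lt_trans KL; apply: le_trans K1.
have W1 : 0 < W + 1 by rewrite ltr_wpDl.
exists L, (W + 1); split => // N N0.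
have NR : 0 < N%:R :> R by rewrite ltr0n.
pose M := (2 * L * N)%N.
(* The shift by [L] lets the indices below [2 * L * N] describe the coordinates from - L to L. *)
pose t (g : {ffun 'I_k -> 'I_M}) i : R := (g i)%:R / N%:R - L%:R.
exists [seq comb (t g) | g <- enum {ffun 'I_k -> 'I_M}]; split.
- by rewrite size_map -cardE card_ffun !card_ord.
- by move=> P /mapP[g _ ->].
move=> x [/= ax Ex]; have wX := Espan Ex.
set w := x - a in wX; have wE := coord_span wX.
have cw i : `|coord X i w| < L%:R.
  apply: le_lt_trans KL; apply: le_trans (hK _ _) _.
  rewrite -[leRHS]mulr1 ler_wpM2l ?(le_trans _ K1) // /w enormBC ltW //.
pose s i := (coord X i w + L%:R) * N%:R.
have s0 i : 0 <= s i.
  rewrite mulr_ge0 // -lerBlDr sub0r.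
  by have := ltW (cw i); rewrite ler_norml => /andP[].
have sM i : (Num.trunc (s i) < M)%N.
  rewrite -(ltr_nat R); have /andP[sl _] := trunc_itv (s0 i).
  apply: le_lt_trans sl _; rewrite /M natrM ltr_pM2r // natrM.
  by have := cw i; rewrite ltr_norml => /andP[_]; lra.
exists (comb (t [ffun i => Ordinal (sM i)])).
  by apply: map_f; rewrite mem_enum.
rewrite /eball /= /comb.
have -> : a + \sum_(i < k) t [ffun i0 => Ordinal (sM i0)] i *: X`_i - x =
   \sum_(i < k) (t [ffun i0 => Ordinal (sM i0)] i - coord X i w) *: X`_i.
  under [RHS]eq_bigr do rewrite scalerBl.
  by rewrite sumrB -wE /w opprB addrCA addrA.
apply: (@le_lt_trans _ _ (N%:R^-1 * W)); last first.
  by rewrite mulrC ltr_pM2r ?invr_gt0 // ltrDl.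
apply: enorm_comb_le => i; rewrite /t ffunE /=.
have /andP[sl su] := trunc_itv (s0 i).
have -> : (Num.trunc (s i))%:R / N%:R - L%:R - coord X i w =
   - ((s i - (Num.trunc (s i))%:R) / N%:R).
  by rewrite /s; field; rewrite gt_eqF.
rewrite normrN normrM normfV [`|N%:R|]gtr0_norm // -[leRHS]mul1r.
rewrite ler_wpM2r ?invr_ge0 ?(ltW NR) // ger0_norm ?subr_ge0 //.
by rewrite lerBlDl natr1 ltW.
Qed.

(** The unit ball has mass at least 1 / C and is covered, up to a null set, by (2 L N)^k balls of
    mass at most C (w / N)^d; the growth in [N] is compared. *)
Lemma dim_ge_of_span : d <= k%:R.
Proof.
have C0 : 0 < C := lt_le_trans ltr01 C1.
have [L [w [L0 w0 grid]]] := grid_cover.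
apply: (@le_of_powR_bound _ _ _ (C * C * w `^ d * (2 * L%:R) ^+ k)) => N N0.
have NR : 0 < N%:R :> R by rewrite ltr0n.
have wN : 0 < w / N%:R by rewrite divr_gt0.
have [s [ss sE scov]] := grid N N0.
have mEb : measurable (eball a 1 `&` E : set (borelRn R n)) by exact: measurableI.
have h : (mu (eball a 1 `&` E) <= ((size s)%:R * (C * (w / N%:R) `^ d))%:E)%E.
  apply: (@measure_cover_le _ _ _ mu 'rV[R]_n (fun P => eball P (w / N%:R))
    (fun P => mball P _) s _ _ mEb scov).
  by move=> P /sE EP; have /andP[] := muE EP wN.
have /andP[h1 _] := muE Ea ltr01.
move: h1; rewrite powR1 mulr1 -muI // => /le_trans/(_ h).
rewrite lee_fin ss => {}h.
have NN0 : 0 < N%:R `^ d by rewrite powR_gt0.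
have wE : (w / N%:R) `^ d = w `^ d / N%:R `^ d.
  rewrite powRM ?(ltW w0) ?invr_ge0 ?(ltW NR) //; congr (_ * _).
  by rewrite -(powR_inv1 (ltW NR)) -powRrM mulN1r powRN.
rewrite powR_mulrn ?(ltW NR) //.
move: h; rewrite -(ler_pM2l (mulr_gt0 C0 NN0)) wE mulrAC mulfV ?gt_eqF // mul1r.
move/le_trans; apply; rewrite le_eqVlt; apply/orP; left; apply/eqP.
by rewrite natrX !natrM exprMn; field; rewrite gt_eqF.
Qed.

End dimension.

Section orthogonal.
Context {R : realType} {n k : nat}.

Lemma orthogonal_vector (X : k.-tuple 'rV[R]_n) : (k < n)%N ->
  exists2 f : 'rV[R]_n, f != 0 & forall w, w \in <<X>>%VS -> dot f w = 0.
Proof.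
move=> kn; pose A : 'M[R]_(k, n) := \matrix_(i < k) X`_i.
have : kermx A^T != 0.
  rewrite -mxrank_eq0 mxrank_ker subn_eq0 -ltnNge.
  by apply: leq_ltn_trans kn; exact: rank_leq_col.
move=> /rowV0Pn[f /sub_kermxP fA f0]; exists f => // w /coord_span ->.
rewrite dotC dot_suml big1 // => i _; rewrite dotZl dotC.
have := congr1 (fun B : 'rV[R]_k => B 0 i) fA; rewrite !mxE => fi.
rewrite /dot (eq_bigr (fun j => f 0 j * A^T j i)) ?fi ?mulr0 // => j _.
by rewrite !mxE.
Qed.

(** A longest free family of vectors from [a] to points of [E]. Then [a] plus its span is the affine
    span of [E], and the simplex built on it at [a] has its vertices in [E]. *)
Lemma maximal_free (E : set 'rV[R]_n) (a : 'rV[R]_n) :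
  exists m (X : m.-tuple 'rV[R]_n), [/\ free X, forall i : 'I_m, E (a + X`_i) &
    forall y, E y -> y - a \in <<X>>%VS].
Proof.
pose P m := `[< exists X : m.-tuple 'rV[R]_n, free X /\ forall i : 'I_m, E (a + X`_i) >].
have P0 : exists m, P m.
  exists 0%N; apply/asboolP; exists [tuple]; split; first exact: nil_free.
  by case.
have Pn m : P m -> (m <= n)%N.
  move=> /asboolP[X [fX _]]; move: fX; rewrite /free size_tuple => /eqP <-.
  by apply: leq_trans (dimvS (subvf _)) _; rewrite dimvf /dim /= mul1n.
have [m /asboolP[X [fX XE]] maxm] := ex_maxnP P0 Pn.
exists m, X; split => // y Ey; apply: contrapT => /negP yX.
suff /maxm : P m.+1 by rewrite ltnn.
apply/asboolP; exists (cons_tuple (y - a) X); split; first by rewrite free_cons yX.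
move=> i; case: (unliftP ord0 i) => [j|] ->; first by rewrite lift0 /=; exact: XE.
by rewrite /= subrKC.
Qed.

End orthogonal.

(** * Convexity, and equality with the affine span *)

Section plane.
Context {R : realType} {n : nat}.
Variables (E : set 'rV[R]_n) (D : 'rV[R]_n -> R) (G : 'rV[R]_n -> 'rV[R]_n).
Hypothesis Ecl : closed E.
Hypothesis E0 : E !=set0.
Hypothesis half : forall x, ~ E x -> exists q, [/\ E q, enorm (x - q) = dist_to E x &
  forall y, E y -> dot (y - q) (x - q) <= 0].

(** Otherwise, with [q] the nearest point, |x - q|^2 is a combination with nonnegative weights of
    the products (y - q).(x - q) at the vertices [y], which are nonpositive. *)
Lemma convex_comb k (X : k.-tuple 'rV[R]_n) (a : 'rV[R]_n) (t : 'I_k -> R) :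
  E a -> (forall i : 'I_k, E (a + X`_i)) -> (forall i, 0 <= t i) ->
  \sum_(i < k) t i <= 1 -> E (a + \sum_(i < k) t i *: X`_i).
Proof.
move=> Ea EX t0 t1; set x := a + _; apply: contrapT => /[dup] nEx /half[q [Eq _ hq]].
have : dot (x - q) (x - q) <= 0.
  have {1}-> : x - q = (1 - \sum_(i < k) t i) *: (a - q)
      + \sum_(i < k) t i *: (a + X`_i - q).
    rewrite [X in _ = _ + X](eq_bigr (fun i => t i *: (a - q) + t i *: X`_i)); last first.
      by move=> i _; rewrite addrAC scalerDr.
    rewrite big_split /= -scaler_suml scalerBl scale1r addrA subrK.
    by rewrite /x addrAC.
  rewrite dotDl dotZl dot_suml -[leRHS]addr0; apply: lerD.
    by rewrite mulr_ge0_le0 ?subr_ge0 ?hq.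
  by apply: sumr_le0 => i _; rewrite dotZl mulr_ge0_le0 ?hq.
move=> xq; have : dot (x - q) (x - q) == 0 by rewrite eq_le xq dot_ge0.
by rewrite dot_eq0 subr_eq0 => /eqP xE; apply: nEx; rewrite xE.
Qed.

Hypothesis D_frechet : forall x, ~ E x -> frechet D x (G x).
Hypothesis G_const : locally_constant_on (~` E) (fun x => enorm (G x)).
Hypothesis D_dist : forall x, ~ E x -> D x = enorm (G x) * dist_to E x.
Hypothesis G_orth : forall x e, ~ E x -> dot (G x) e = 0 ->
  (forall y, E y -> 0 <= dot (x - y) e) -> forall y, E y -> dot (x - y) e = 0.

Lemma dist_to_orthogonal q f : E q -> (forall y, E y -> dot f (y - q) = 0) ->
  dist_to E (q + f) = enorm f.
Proof.
move=> Eq fE; apply/eqP; rewrite eq_le; apply/andP; split.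
  by apply: le_trans (dist_to_le _ Eq) _; rewrite addrAC subrr add0r.
apply: dist_to_ge => // y Ey; rewrite -ler_sqr ?nnegrE ?enorm_ge0 //.
have -> : q + f - y = f - (y - q) by rewrite opprB addrCA addrA.
by rewrite enorm_sqrB fE // mulr0 subr0 lerDl exprn_ge0 ?enorm_ge0.
Qed.

Lemma outside_orthogonal q f : f != 0 -> (forall y, E y -> dot f (y - q) = 0) ->
  ~ E (q + f).
Proof.
move=> f0 fE /fE; rewrite addrAC subrr add0r => /eqP; rewrite dot_eq0.
exact/negP.
Qed.

(* The point of [E] nearest to [q + f] is [q], and [D (q + f + s e)] is at most
   [c |f + s e|], which is [c |f| + O(s ^ 2)]. *)
Let gradient_tangent q f e : E q -> f != 0 -> (forall y, E y -> dot f (y - q) = 0) ->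
  dot f e = 0 -> dot (G (q + f)) e <= 0.
Proof.
move=> Eq f0 fE fe; set x := q + f.
have nEx : ~ E x by exact: outside_orthogonal.
have dx : dist_to E x = enorm f by exact: dist_to_orthogonal.
have f1 : 0 < enorm f by rewrite enorm_gt0.
set c := enorm (G x).
have c0 : 0 <= c by exact: enorm_ge0.
have K0 : 0 <= c * (enorm e ^+ 2 / enorm f).
  by rewrite mulr_ge0 // divr_ge0 ?exprn_ge0 ?enorm_ge0.
apply/ler_addgt0Pr => b b0; rewrite add0r.
have /nbhs_eballP[r r0 hr] := G_const nEx.
have h1 : 0 < enorm e + 1 by rewrite ltr_wpDl ?enorm_ge0.
have K1 : 0 < c * (enorm e ^+ 2 / enorm f) + 1 by rewrite ltr_wpDl.
(* In order: stay where the slope is [c], stay off [E], keep the quadratic term below [b * t]. *)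
apply: (dirder_le (eta := Num.min (Num.min r (enorm f) / (enorm e + 1))
    (b / (c * (enorm e ^+ 2 / enorm f) + 1))) _ (frechet_dirder e (D_frechet nEx))).
  by rewrite lt_min !divr_gt0 // lt_min r0.
move=> t /andP[t0]; rewrite lt_min !ltr_pdivlMr // => /andP[t1 t2].
have : enorm (x - (x + t *: e)) < Num.min r (enorm f).
  rewrite opprD addNKr enormN enormZ gtr0_norm //; apply: le_lt_trans t1.
  by rewrite ler_wpM2l ?(ltW t0) // lerDl.
rewrite lt_min => /andP[xr xf].
have nEz : ~ E (x + t *: e).
  by move=> /(dist_to_le x); rewrite dx leNgt xf.
have cz : enorm (G (x + t *: e)) = c := hr _ xr nEz.
rewrite (D_dist nEz) (D_dist nEx) cz dx -mulrBr.
have dz : dist_to E (x + t *: e) <= enorm (f + t *: e).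
  by apply: le_trans (dist_to_le _ Eq) _; rewrite /x -(addrA q) addrAC subrr add0r.
have fz : enorm (f + t *: e) <= enorm f + t ^+ 2 * (enorm e ^+ 2 / enorm f).
  have h2 : 0 <= t ^+ 2 * (enorm e ^+ 2 / enorm f).
    by rewrite mulr_ge0 ?exprn_ge0 ?divr_ge0 ?exprn_ge0 ?enorm_ge0 ?(ltW t0).
  rewrite -ler_sqr ?nnegrE ?addr_ge0 ?enorm_ge0 //.
  rewrite enorm_sqrD dotZr fe !mulr0 addr0 enormZ exprMn (gtr0_norm t0) sqrrD.
  have -> : enorm f * (t ^+ 2 * (enorm e ^+ 2 / enorm f)) = t ^+ 2 * enorm e ^+ 2.
    by field; rewrite gt_eqF.
  have : 0 <= t ^+ 2 * enorm e ^+ 2 by rewrite mulr_ge0 ?exprn_ge0 ?enorm_ge0 ?(ltW t0).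
  have := sqr_ge0 (t ^+ 2 * (enorm e ^+ 2 / enorm f)); lra.
apply: (@le_trans _ _ (c * (t ^+ 2 * (enorm e ^+ 2 / enorm f)))).
  by rewrite ler_wpM2l //; lra.
have -> : c * (t ^+ 2 * (enorm e ^+ 2 / enorm f)) = t * (c * (enorm e ^+ 2 / enorm f)) * t by ring.
rewrite ler_wpM2r ?(ltW t0) //; apply: le_trans (ltW t2).
by rewrite ler_wpM2l ?(ltW t0) // lerDl.
Qed.

(** The tangential estimate for [e] and [- e] makes the derivative at [q + f] vanish. As [f] is
    orthogonal to [e], the sign condition at [q + f] is the one at [q]. *)
Lemma tangent_orthogonal q f e : E q -> f != 0 ->
  (forall y, E y -> dot f (y - q) = 0) -> dot f e = 0 ->
  (forall y, E y -> dot (y - q) e <= 0) -> forall y, E y -> dot (y - q) e = 0.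
Proof.
move=> Eq f0 fE fe qe y Ey.
have Ge : dot (G (q + f)) e = 0.
  apply/eqP; rewrite eq_le gradient_tangent //=.
  have := @gradient_tangent q f (- e) Eq f0 fE.
  by rewrite !dotNr fe oppr0 oppr_le0; apply.
have xE z : dot (q + f - z) e = - dot (z - q) e.
  by rewrite -dotNl opprB addrAC dotDl fe addr0.
have := G_orth (outside_orthogonal f0 fE) Ge _ Ey.
rewrite xE => h; apply/eqP; rewrite -oppr_eq0; apply/eqP; apply: h.
by move=> z Ez; rewrite xE oppr_ge0 qe.
Qed.

Lemma affine_of_lowdim k (X : k.-tuple 'rV[R]_n) (a : 'rV[R]_n) :
  (k < n)%N -> E a -> (forall i : 'I_k, E (a + X`_i)) ->
  (forall y, E y -> y - a \in <<X>>%VS) ->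
  forall x, x - a \in <<X>>%VS -> E x.
Proof.
move=> kn Ea EX XE x xX; apply: contrapT => /[dup] nEx /half[q [Eq _ hq]].
have [f f0 fX] := orthogonal_vector X kn.
have subX y z : y - a \in <<X>>%VS -> z - a \in <<X>>%VS -> y - z \in <<X>>%VS.
  by move=> yX zX; have := rpredB yX zX; rewrite opprB addrA subrK.
have eX : x - q \in <<X>>%VS by apply: subX => //; exact: XE.
have orth := @tangent_orthogonal q f (x - q) Eq f0 _ (fX _ eX) hq.
have {orth} orth y : E y -> dot (y - q) (x - q) = 0.
  by apply: orth => z Ez; apply: fX; apply: subX; exact: XE.
(* Each vector of [X] is a difference of two points of [E], so [x - q], itself in the span, is
   orthogonal to itself. *)
have aX w : w \in <<X>>%VS -> dot w (x - q) = 0.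
  move=> /coord_span ->; rewrite dot_suml big1 // => i _.
  rewrite dotZl (_ : X`_i = (a + X`_i - q) - (a - q)); last first.
    by rewrite opprB addrA subrK addrAC subrr add0r.
  by rewrite dotBl !orth // subrr mulr0.
have /eqP := aX _ eX; rewrite dot_eq0 subr_eq0 => /eqP xq.
by apply: nEx; rewrite xq.
Qed.

End plane.

(** * A single slope around the plane *)

Section proportional.
Context {R : realType} {n k : nat}.
Variables (E : set 'rV[R]_n) (D : 'rV[R]_n -> R) (G : 'rV[R]_n -> 'rV[R]_n).
Variables (X : k.-tuple 'rV[R]_n) (a : 'rV[R]_n).
Hypothesis kn : (k < n)%N.
Hypothesis EX : forall x, E x <-> x - a \in <<X>>%VS.
Hypothesis Ecl : closed E.
Hypothesis G_gt0 : forall x, ~ E x -> 0 < enorm (G x).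
Hypothesis G_const : locally_constant_on (~` E) (fun x => enorm (G x)).
Hypothesis D_dist : forall x, ~ E x -> D x = enorm (G x) * dist_to E x.
Hypothesis D_radial : forall q f g, E q -> (forall y, E y -> dot f (y - q) = 0) ->
  (forall y, E y -> dot g (y - q) = 0) -> enorm f = enorm g -> D (q + f) = D (q + g).

Let Ea : E a. Proof. by apply/EX; rewrite subrr mem0v. Qed.

Let E0 : E !=set0. Proof. by exists a. Qed.

Lemma plane_sub y z : E y -> E z -> y - z \in <<X>>%VS.
Proof. by move=> /EX yX /EX zX; have := rpredB yX zX; rewrite opprB addrA subrK. Qed.

Lemma plane_shift y w : E y -> w \in <<X>>%VS -> E (y + w).
Proof. by move=> /EX yX wX; apply/EX; rewrite addrAC rpredD. Qed.

(** First variation: moving [q] inside the plane by a small multiple of [w] cannot bring it closer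
    to [x]. *)
Lemma nearest_orthogonal x q : E q -> enorm (x - q) = dist_to E x ->
  forall y, E y -> dot (x - q) (y - q) = 0.
Proof.
move=> Eq xq.
have le0 w : w \in <<X>>%VS -> dot (x - q) w <= 0.
  move=> wX; apply/ler_addgt0Pr => e e0; rewrite add0r.
  have W0 : 0 < dot w w + 1 by rewrite ltr_wpDl ?dot_ge0.
  pose s := e / (dot w w + 1); have s0 : 0 < s by rewrite divr_gt0.
  have := dist_to_le x (plane_shift Eq (rpredZ s wX)).
  rewrite -xq opprD addrA -ler_sqr ?nnegrE ?enorm_ge0 // (enorm_sqrB (x - q)).
  rewrite enormZ exprMn (gtr0_norm s0) dotZr (enorm_sqr w) => h.
  have ww := dot_ge0 w; have s2 : 0 <= s ^+ 2 * dot w w by rewrite mulr_ge0 ?sqr_ge0.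
  have : s * dot (x - q) w <= s * (s * dot w w) by rewrite mulrA -expr2; lra.
  rewrite ler_pM2l // => /le_trans; apply; rewrite /s -mulrA ger_pMr //.
  by rewrite mulrC ler_pdivrMr // mul1r lerDl.
move=> y Ey; have yX := plane_sub Ey Eq.
apply/eqP; rewrite eq_le le0 //=.
by have := le0 _ (rpredNr yX); rewrite dotNr oppr_le0.
Qed.

(** A hyperplane has two sides, so local constancy alone does not give one slope. Radial symmetry
    moves every point to the side of [u], where the segment to the reference point [a + 1 *: u]
    avoids [E]. *)
Lemma dist_proportional : exists2 c, 0 < c & forall x, ~ E x -> D x = c * dist_to E x.
Proof.
have [u0 u00 uX] := orthogonal_vector X kn.
pose u := (enorm u0)^-1 *: u0.
have nu0 : 0 < enorm u0 by rewrite enorm_gt0.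
have u1 : enorm u = 1 by rewrite enormZ gtr0_norm ?invr_gt0 // mulVf // gt_eqF.
have uE q y : E q -> E y -> dot u (y - q) = 0.
  by move=> Eq Ey; rewrite dotZl uX ?mulr0 //; exact: plane_sub.
have ruE r q y : E q -> E y -> dot (r *: u) (y - q) = 0.
  by move=> Eq Ey; rewrite dotZl uE ?mulr0.
have nE r q : E q -> 0 < r -> ~ E (q + r *: u).
  move=> Eq r0; apply: outside_orthogonal; last by move=> y; exact: ruE.
  by rewrite scaler_eq0 gt_eqF //= -enorm_eq0 u1 oner_eq0.
exists (enorm (G (a + 1 *: u))); first by apply: G_gt0; apply: nE.
move=> x nEx; have [q Eq xq] := dist_to_attained E0 Ecl x.
have r0 := dist_to_gt0 E0 Ecl nEx; set r := dist_to E x in xq r0 *.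
have -> : D x = D (q + r *: u).
  rewrite -{1}(subrKC q x); apply: D_radial => //.
  - exact: nearest_orthogonal.
  - by move=> y; exact: ruE.
  - by rewrite enormZ u1 mulr1 gtr0_norm.
have ru : enorm (r *: u) = r by rewrite enormZ u1 mulr1 gtr0_norm.
rewrite (D_dist (nE _ _ Eq r0)) (dist_to_orthogonal E0 Eq); last by move=> y; exact: ruE.
rewrite ru; congr (_ * _).
apply: (locally_constant_segment Ecl G_const) => t /andP[t0 t1].
have -> : a + 1 *: u + t *: (q + r *: u - (a + 1 *: u)) =
    (a + t *: (q - a)) + (1 + t * (r - 1)) *: u.
  by rewrite opprD addrACA -scalerBl scalerDr (scalerA t (r - 1) u) addrACA -scalerDl.
apply: nE; first by apply: plane_shift => //; rewrite rpredZ // plane_sub.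
by nra.
Qed.

End proportional.

(** * Hausdorff measure *)

(** The form [2 * j + 0] makes both sums instances of one bound with a parity parameter. *)
Lemma sum_even_odd (R : realType) (g : nat -> \bar R) m :
  (\sum_(0 <= i < 2 * m) g i = \sum_(j < m) g (2 * j + 0)%N + \sum_(j < m) g (2 * j + 1)%N)%E.
Proof.
elim: m => [|m IH]; first by rewrite big_geq // !big_ord0 adde0.
rewrite !big_ord_recr /= mulnS !addSn add0n !big_nat_recr //= IH addn0 addn1.
by rewrite -addeA addeACA.
Qed.

Section hausdorff_outer_measure.
Context {R : realType} {n : nat}.
Variable d : R.
Hypothesis d0 : 0 < d.
Implicit Types (A B U : set 'rV[R]_n) (x y : 'rV[R]_n) (delta : R).
Local Open Scope ereal_scope.

Lemma ediam_ge0 A : 0 <= ediam A.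
Proof. by apply: ereal_sup_ubound; left. Qed.

Lemma ediam_le A (r : \bar R) : 0 <= r ->
  (forall x y, A x -> A y -> (enorm (x - y))%:E <= r) -> ediam A <= r.
Proof. by move=> r0 Ar; apply: ge_ereal_sup => _ [->//|[x Ax [y Ay <-]]]; exact: Ar. Qed.

Lemma enorm_le_ediam A x y : A x -> A y -> (enorm (x - y))%:E <= ediam A.
Proof. by move=> Ax Ay; apply: ereal_sup_ubound; right; exists x => //; exists y. Qed.

Lemma ediam0 : ediam (set0 : set 'rV[R]_n) = 0.
Proof. by apply/eqP; rewrite eq_le ediam_ge0 andbT; exact: ediam_le. Qed.

Lemma le_ediam A B : A `<=` B -> ediam A <= ediam B.
Proof.
move=> AB; apply: ediam_le; first exact: ediam_ge0.
by move=> x y Ax Ay; apply: enorm_le_ediam; exact: AB.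
Qed.

Lemma ediam_powR_le A B : A `<=` B -> ediam A `^ d <= ediam B `^ d.
Proof.
move=> AB; apply: gt0_ler_poweR; rewrite ?in_itv /= ?ediam_ge0 ?leey ?(ltW d0) //.
exact: le_ediam.
Qed.

Lemma ediam0_powR : ediam (set0 : set 'rV[R]_n) `^ d = 0.
Proof. by rewrite ediam0 poweR0r // gt_eqF. Qed.

Local Notation content := (@hausdorff_content R n d).
Local Notation H := (@hausdorff R n d).

Lemma content_ge0 delta A : 0 <= content delta A.
Proof.
by apply: le_ereal_inf_tmp => _ [U _ <-]; apply: nneseries_ge0 => i _ _; exact: poweR_ge0.
Qed.

Lemma content_le delta A (U : nat -> set 'rV[R]_n) : A `<=` \bigcup_i U i ->
  (forall i, ediam (U i) <= delta%:E) -> content delta A <= \sum_(0 <= i <oo) ediam (U i) `^ d.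
Proof. by move=> AU Ud; apply: ereal_inf_lbound; exists U. Qed.

Lemma content_anti delta delta' A : (delta <= delta')%R ->
  content delta' A <= content delta A.
Proof.
move=> dd; apply: le_ereal_inf_tmp => _ [U [AU Ud] <-].
by apply: content_le => // i; apply: le_trans (Ud i) _; rewrite lee_fin.
Qed.

Lemma hausdorff_ge delta A : (0 < delta)%R -> content delta A <= H A.
Proof. by move=> delta0; apply: ereal_sup_ubound; exists delta. Qed.

Lemma hausdorff_le A (b : \bar R) :
  (forall delta, (0 < delta)%R -> content delta A <= b) -> H A <= b.
Proof. by move=> h; apply: ge_ereal_sup => _ [delta /= delta0 <-]; exact: h. Qed.

Lemma hausdorff_ge0 A : 0 <= H A.
Proof. exact: le_trans (content_ge0 1 A) (hausdorff_ge A ltr01). Qed.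

Lemma hausdorff0 : H set0 = 0.
Proof.
apply/eqP; rewrite eq_le hausdorff_ge0 andbT; apply: hausdorff_le => delta delta0.
apply: le_trans (content_le (U := fun=> set0) _ _) _ => //.
  by move=> i; rewrite ediam0 lee_fin ltW.
by rewrite eseries0 // => i _ _; exact: ediam0_powR.
Qed.

Lemma le_hausdorff A B : A `<=` B -> H A <= H B.
Proof.
move=> AB; apply: hausdorff_le => delta delta0.
apply: le_trans (hausdorff_ge B delta0); apply: le_ereal_inf_tmp => _ [U [BU Ud] <-].
by apply: content_le => //; exact: subset_trans BU.
Qed.

(** Near-optimal covers with errors e / 2^(i + 1) are merged into one sequence by a bijection
    between pairs and natural numbers. An infinite content is set apart, because such covers need a
    finite infimum. *)
Lemma content_sigma_subadditive delta (A : nat -> set 'rV[R]_n) :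
  content delta (\bigcup_i A i) <= \sum_(0 <= i <oo) content delta (A i).
Proof.
have [[i ioo]|] := pselect (exists i, content delta (A i) = +oo).
  rewrite (eseries_pinfty _ _ ioo) ?leey// => k _.
  by rewrite -ltNye (lt_le_trans _ (content_ge0 _ _)).
rewrite -forallNE => Aoo.
apply/lee_addgt0Pr => e e0.
apply: le_trans (epsilon_trick xpredT (fun i => content_ge0 delta (A i)) (ltW e0)).
pose P i (U : nat -> set 'rV[R]_n) :=
  (A i `<=` \bigcup_j U j /\ forall j, ediam (U j) <= delta%:E) /\
  \sum_(0 <= j <oo) ediam (U j) `^ d <= content delta (A i) + (e / (2 ^ i.+1)%:R)%:E.
have [G PG] : {G : nat -> nat -> set 'rV[R]_n & forall i, P i (G i)}.
  apply: (@choice _ _ P) => i.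
  have cfin : content delta (A i) \is a fin_num.
    by rewrite ge0_fin_numE ?content_ge0 // ltey; apply/eqP/Aoo.
  have ei : (0 < e / (2 ^ i.+1)%:R)%R by rewrite divr_gt0 // ltr0n expn_gt0.
  have [_ [U [AU Ud] <-] Ue] := lb_ereal_inf_adherent ei cfin.
  by exists U; split => //; exact: ltW.
have /card_esym/ppcard_eqP[f] := card_nat2.
have AG : \bigcup_i A i `<=` \bigcup_i (uncurry G \o f) i.
  move=> t [i _ At]; have [j _ Gt] := (PG i).1.1 _ At.
  by exists (f^-1%FUN (i, j)) => //=; rewrite invK ?inE.
apply: le_trans (content_le AG _) _.
  by move=> i /=; rewrite /uncurry; case: (f i) => a b; exact: (PG a).1.2.
have G0 i j : 0 <= ediam (G i j) `^ d by exact: poweR_ge0.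
rewrite [leLHS]nneseries_esumT; last by move=> i; exact: poweR_ge0.
pose a (ij : nat * nat) := ediam (G ij.1 ij.2) `^ d.
have -> : \esum_(i in [set: nat]) ediam ((uncurry G \o f) i) `^ d =
    \esum_(i in [set: nat]) a (f i).
  by apply: eq_esum => i _; rewrite /a /= /uncurry; case: (f i).
rewrite -(reindex_esum [set: nat] [set: nat * nat] f) //.
have -> : [set: nat * nat] = [set: nat] `*`` (fun=> [set: nat]).
  by apply/seteqP; split.
rewrite -(esum_esum (a := fun i j => ediam (G i j) `^ d)) // -nneseries_esumT;
  last by move=> i; exact: esum_ge0.
apply: lee_nneseries => [i _ _|i _]; first exact: esum_ge0.
by rewrite -nneseries_esumT //; exact: (PG i).2.
Qed.

Lemma hausdorff_sigma_subadditive : sigma_subadditive H.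
Proof.
move=> A; apply: hausdorff_le => delta delta0.
apply: le_trans (content_sigma_subadditive _ _) _.
apply: lee_nneseries => [i _ _|i _]; first exact: content_ge0.
exact: hausdorff_ge.
Qed.

Definition hausdorff_outer : {outer_measure set 'rV[R]_n -> \bar R} :=
  HB.pack H (isOuterMeasure.Build R _ H hausdorff0 hausdorff_ge0 le_hausdorff
    hausdorff_sigma_subadditive).

(** A set of diameter below [eta] cannot meet both [A] and [B], so every fine cover splits in
    two. *)
Lemma hausdorff_separated A B eta : (0 < eta)%R ->
  (forall x y, A x -> B y -> (eta <= enorm (x - y))%R) ->
  H A + H B <= H (A `|` B).
Proof.
move=> eta0 AB.
have cAB delta : (0 < delta < eta)%R ->
    content delta A + content delta B <= content delta (A `|` B).
  move=> /andP[delta0 de]; apply: le_ereal_inf_tmp => _ [U [ABU Ud] <-].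
  have UAB i : ediam (U i `&` A) `^ d + ediam (U i `&` B) `^ d <= ediam (U i) `^ d.
    have [[x [Ux Ax]]|nA] := pselect (U i `&` A !=set0).
      have -> : U i `&` B = set0.
        apply/seteqP; split=> // y [Uy By].
        have := le_trans (enorm_le_ediam Ux Uy) (Ud i).
        by rewrite lee_fin leNgt (lt_le_trans de) // AB.
      by rewrite ediam0_powR adde0; apply: ediam_powR_le; exact: subIsetl.
    have -> : U i `&` A = set0 by apply/seteqP; split=> // y Uy; apply: nA; exists y.
    by rewrite ediam0_powR add0e; apply: ediam_powR_le; exact: subIsetl.
  apply: (@le_trans _ _ (\sum_(0 <= i <oo) (ediam (U i `&` A) `^ d + ediam (U i `&` B) `^ d))).
    rewrite nneseriesD; [|by move=> *; exact: poweR_ge0|by move=> *; exact: poweR_ge0].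
    apply: leeD; apply: content_le.
    - move=> x Ax; have [|i _ Ui] := ABU x; first by left.
      by exists i.
    - by move=> i; apply: le_trans (Ud i); apply: le_ediam; exact: subIsetl.
    - move=> x Bx; have [|i _ Ui] := ABU x; first by right.
      by exists i.
    - by move=> i; apply: le_trans (Ud i); apply: le_ediam; exact: subIsetl.
  by apply: lee_nneseries => [i _ _|i _]; [rewrite adde_ge0 ?poweR_ge0 | exact: UAB].
have [Hoo|Hfin] := eqVneq (H (A `|` B)) +oo; first by rewrite Hoo leey.
have HABfin : H (A `|` B) \is a fin_num by rewrite ge0_fin_numE ?hausdorff_ge0 // ltey.
(* Independent scales, so that the suprema defining [H A] and [H B] can be taken one after the
   other. *)
have key delta1 delta2 : (0 < delta1)%R -> (0 < delta2)%R ->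
    content delta1 A + content delta2 B <= H (A `|` B).
  move=> d1 d2; pose delta := Num.min (Num.min delta1 delta2) (eta / 2)%R.
  have delta0 : (0 < delta)%R by rewrite !lt_min d1 d2 divr_gt0.
  apply: le_trans (hausdorff_ge _ delta0).
  apply: le_trans (cAB delta _); last first.
    by rewrite delta0 /= gt_min; apply/orP; right; rewrite ltr_pdivrMr // ltr_pMr ?ltr1n.
  by apply: leeD; apply: content_anti; rewrite !ge_min lexx ?orbT.
have HBfin : H B \is a fin_num.
  rewrite ge0_fin_numE ?hausdorff_ge0 //; apply: le_lt_trans (_ : H (A `|` B) < +oo).
    by apply: le_hausdorff; exact: subsetUr.
  by rewrite ltey.
rewrite -leeBrDr //; apply: hausdorff_le => delta1 d1.
rewrite leeBrDr // addeC.
have cfin : content delta1 A \is a fin_num.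
  rewrite ge0_fin_numE ?content_ge0 //; apply: le_lt_trans (_ : H (A `|` B) < +oo).
    by apply: le_trans (hausdorff_ge A d1) _; apply: le_hausdorff; exact: subsetUl.
  by rewrite ltey.
rewrite -leeBrDr //; apply: hausdorff_le => delta2 d2.
by rewrite leeBrDr // addeC; exact: key.
Qed.

End hausdorff_outer_measure.

Section hausdorff_caratheodory.
Context {R : realType} {n : nat}.
Variable d : R.
Hypothesis d0 : 0 < d.
Local Open Scope ereal_scope.
Local Notation H := (@hausdorff_outer R n d d0).

Section annuli.
Variables (F X : set 'rV[R]_n).
Hypothesis F0 : F !=set0.
Hypothesis Fcl : closed F.

Let S i := X `&` [set x | (i.+1%:R^-1 <= dist_to F x)%R].
Let A i := X `&` [set x | (i.+2%:R^-1 <= dist_to F x < i.+1%:R^-1)%R].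

Let inv_lt (i j : nat) : (i < j)%N -> (j.+1%:R^-1 < i.+1%:R^-1 :> R)%R.
Proof. by move=> ij; rewrite ltf_pV2 ?posrE // ltr_nat. Qed.

(* Caratheodory's criterion: every second annulus is at positive distance from
   the previous ones, so the series of the measures of the annuli converges. *)
Let annulus_step i : H (S i) + H (A i.+1) <= H (S i.+2).
Proof.
have e0 : (0 < i.+1%:R^-1 - i.+2%:R^-1 :> R)%R by rewrite subr_gt0 inv_lt.
apply: le_trans (hausdorff_separated d0 e0 _) _.
  move=> x y [_ /= Sx] [_ /= /andP[_ Ay]].
  rewrite lerBlDr addrC; apply: le_trans Sx _; apply: le_trans (dist_to_lip F0 x y) _.
  by rewrite lerD2r ltW.
apply: le_hausdorff => x [[Xx /= Sx]|[Xx /= /andP[Ax _]]]; split => //=.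
by apply: le_trans Sx; apply/ltW/inv_lt.
Qed.

(** [s] stands for a parity: it is used with 0 and 1. *)
Let annuli_sum s m : \sum_(j < m.+1) H (A (2 * j + s)%N) <= H (S (2 * m + s).+1).
Proof.
elim: m => [|m IH].
  rewrite big_ord_recl big_ord0 adde0 /=; apply: le_hausdorff => x [Xx /= /andP[Ax _]].
  by split.
rewrite big_ord_recr /=; apply: le_trans (leeD IH (lexx _)) _.
have -> : (2 * m.+1 + s)%N = (2 * m + s).+2 by rewrite mulnS.
exact: annulus_step.
Qed.

Let annuli_series : \sum_(0 <= i <oo) H (A i) <= H X + H X.
Proof.
apply: lime_le; first by apply: is_cvg_nneseries => i _ _; exact: outer_measure_ge0.
apply: nearW => N.
have SX i : H (S i) <= H X by apply: le_hausdorff; exact: subIsetl.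
apply: (@le_trans _ _ (\sum_(0 <= i < 2 * N.+1) H (A i))).
  by apply: lee_sum_nneg_natr; [move=> i _ _; exact: outer_measure_ge0 | lia].
by rewrite sum_even_odd; apply: leeD; apply: le_trans (SX _); exact: annuli_sum.
Qed.

(** The part of [X] at distance at least 1 / (N + 1) from [F] is separated from [F]; the rest of [X]
    off [F] lies in the annuli of index at least [N], whose total measure tends to 0. *)
Lemma hausdorff_closed_cut : H (X `&` F) + H (X `&` ~` F) <= H X.
Proof.
have [HX|HX] := eqVneq (H X) +oo; first by rewrite HX leey.
have tail : \sum_(N <= i <oo) H (A i) @[N --> \oo] --> 0.
  apply: nneseries_tail_cvg => [|i _]; last exact: outer_measure_ge0.
  by apply: le_lt_trans annuli_series _; rewrite lte_add_pinfty // ltey.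
apply/lee_addgt0Pr => e e0.
have [N _ /(_ N (leqnn N)) /= hN] : \forall N \near \oo, \sum_(N <= i <oo) H (A i) < e%:E.
  by apply: (tail [set x | x < e%:E]); apply: open_ereal_lt'; rewrite lte_fin.
have XF : H (X `&` ~` F) <= H (S N) + \sum_(N <= i <oo) H (A i).
  apply: le_trans (leeD (lexx _) (outer_measure_sigma_subadditive_tail H N A)).
  apply: le_trans (outer_measureU2 _ _ _); apply: le_hausdorff => x [Xx nFx].
  have dx := dist_to_gt0 F0 Fcl nFx.
  have [Sx|Sx] := leP (N.+1%:R^-1)%R (dist_to F x); [by left; split | right].
  pose P k := (k.+2%:R^-1 <= dist_to F x)%R.
  have exP : exists k, P k.
    exists (Num.bound (dist_to F x)^-1); rewrite /P invf_ple ?posrE //.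
    have : ((dist_to F x)^-1 < (Num.bound (dist_to F x)^-1)%:R)%R.
      by apply: archi_boundP; rewrite invr_ge0 ltW.
    by move=> /ltW /le_trans; apply; rewrite ler_nat; lia.
  have [k Pk kmin] := ex_minnP exP.
  have Ak : (dist_to F x < k.+1%:R^-1)%R.
    (* Minimality gives the upper bound except at [k = 0], where the bound is 1 and follows from the
       distance being below 1 / (N + 1). *)
    rewrite ltNge; apply/negP => kx; case: k Pk kmin kx => [|k] Pk kmin kx.
      have : (1 < N.+1%:R^-1 :> R)%R by apply: le_lt_trans Sx; rewrite invr1 in kx.
      by rewrite ltNge invf_le1 // ler1n.
    by have := kmin k kx; rewrite ltnn.
  exists k => /=; last by split => //=; rewrite Ak andbT.
  apply/negP; rewrite -leqNgt leqNgt; apply/negP => kN.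
  have : (k.+2%:R^-1 < N.+1%:R^-1 :> R)%R by exact: le_lt_trans Pk Sx.
  by rewrite ltf_pV2 ?posrE // ltr_nat ltnNge ltnS kN.
apply: le_trans (leeD (lexx _) XF) _; rewrite addeA.
apply: leeD; last exact: ltW.
have eN : (0 < N.+1%:R^-1 :> R)%R by rewrite invr_gt0.
apply: le_trans (hausdorff_separated d0 eN _) _.
  move=> x y [_ Fx] [_ /= Sy]; apply: le_trans Sy _; rewrite enormBC.
  exact: dist_to_le.
by apply: le_hausdorff => x [[Xx _]|[Xx _]].
Qed.

End annuli.

Lemma closed_caratheodory (F : set 'rV[R]_n) : closed F -> H.-caratheodory F.
Proof.
move=> Fcl; apply: le_caratheodory_measurable => X.
have [->|/set0P F0] := eqVneq F set0.
  by rewrite setI0 setC0 setIT outer_measure0 add0e.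
exact: hausdorff_closed_cut.
Qed.

Lemma borel_caratheodory (A : set (borelRn R n)) : measurable A -> H.-caratheodory A.
Proof.
apply: smallest_sub; last first.
  move=> U oU; rewrite -[U]setCK; apply: caratheodory_measurable_setC.
  by apply: closed_caratheodory; exact: open_closedC.
split.
- exact: caratheodory_measurable_set0.
- by move=> B mB; rewrite setTD; exact: caratheodory_measurable_setC.
- exact: caratheodory_measurable_bigcup.
Qed.

Section restriction.
Variable E : set 'rV[R]_n.
Hypothesis mE : measurable (E : set (borelRn R n)).

Let nu (A : set (borelRn R n)) : \bar R := H (A `&` E).

Let nu0 : nu set0 = 0. Proof. by rewrite /nu set0I outer_measure0. Qed.

Let nu_ge0 A : 0 <= nu A. Proof. exact: outer_measure_ge0. Qed.

Let nu_sigma : semi_sigma_additive nu.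
Proof.
move=> A mA tA mUA.
have := @caratheodory_measure_sigma_additive R _ H (fun i => A i `&` E).
rewrite -setI_bigcupl; apply.
- by move=> i; apply: borel_caratheodory; exact: measurableI.
- exact: trivIset_setIr.
- by apply: borel_caratheodory; exact: measurableI.
Qed.

Definition hausdorff_on : {measure set (borelRn R n) -> \bar R} :=
  HB.pack nu (isMeasure.Build _ _ _ nu nu0 nu_ge0 nu_sigma).

Lemma hausdorff_onE (A : set (borelRn R n)) : hausdorff_on A = hausdorff d (A `&` E).
Proof. by []. Qed.

End restriction.
End hausdorff_caratheodory.

Section hausdorff_scaling.
Context {R : realType} {n : nat}.
Variable d : R.
Hypothesis d0 : 0 < d.
Local Open Scope ereal_scope.
Local Notation H := (@hausdorff R n d).
Implicit Types (A : set 'rV[R]_n) (b x y : 'rV[R]_n) (t : R).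

Let hausdorff_image_le t b A : (0 < t)%R ->
  H ((fun x => b + t *: x)%R @` A) <= (t `^ d)%:E * H A.
Proof.
move=> t0; have td0 : (0 < t `^ d)%R by exact: powR_gt0.
apply: hausdorff_le => delta delta0.
have dt0 : (0 < delta / t)%R by rewrite divr_gt0.
apply: (@le_trans _ _ ((t `^ d)%:E * hausdorff_content d (delta / t) A)); last first.
  by rewrite lee_pmul2l //; exact: hausdorff_ge.
rewrite -lee_pdivrMl //; apply: le_ereal_inf_tmp => _ [U [AU Ud] <-].
rewrite lee_pdivrMl // -nneseriesZl; last by move=> i _; exact: poweR_ge0.
pose V i := (fun x => b + t *: x)%R @` U i.
have dV i : ediam (V i) <= t%:E * ediam (U i).
  apply: ediam_le; first by rewrite mule_ge0 ?ediam_ge0 // lee_fin ltW.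
  move=> _ _ [x Ux <-] [y Uy <-].
  rewrite opprD addrACA subrr add0r -scalerBr enormZ gtr0_norm // EFinM.
  by rewrite lee_pmul2l //; exact: enorm_le_ediam.
apply: (@le_trans _ _ (\sum_(0 <= i <oo) ediam (V i) `^ d)).
  apply: content_le => [_ [x Ax <-]|i].
    by have [i _ Ui] := AU x Ax; exists i => //; exists x.
  apply: le_trans (dV i) _; rewrite -lee_pdivlMl // -EFinM mulrC; exact: Ud.
apply: lee_nneseries => [i _ _|i _]; first exact: poweR_ge0.
rewrite -poweR_EFin -poweRM ?ediam_ge0 ?lee_fin ?(ltW t0) //.
apply: gt0_ler_poweR (dV i); rewrite ?(ltW d0) // in_itv /= ?ediam_ge0 ?leey //.
by rewrite mule_ge0 ?ediam_ge0 // lee_fin ltW.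
Qed.

(** Dilating covers gives one inequality; the other is the same one for the inverse dilation. *)
Lemma hausdorff_image t b A : (0 < t)%R ->
  H ((fun x => b + t *: x)%R @` A) = (t `^ d)%:E * H A.
Proof.
move=> t0; apply/eqP; rewrite eq_le hausdorff_image_le //=.
have ti0 : (0 < t^-1)%R by rewrite invr_gt0.
rewrite -lee_pdivlMl ?powR_gt0 //.
have -> : ((t `^ d)^-1)%R = (t^-1 `^ d)%R.
  by rewrite -(powR_inv1 (ltW t0)) -powRrM mulN1r powRN.
have sub : A `<=` (fun y => - (t^-1 *: b) + t^-1 *: y)%R @` ((fun x => b + t *: x)%R @` A).
  move=> x Ax; exists (b + t *: x)%R; first by exists x.
  by rewrite scalerDr scalerA mulVf ?gt_eqF // scale1r addKr.
by apply: (le_trans (le_hausdorff _ sub)); exact: hausdorff_image_le.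
Qed.

End hausdorff_scaling.

(** * Hausdorff measure on a plane *)

Section plane_hausdorff.
Context {R : realType} {n k : nat}.
Variables (d : R) (E : set 'rV[R]_n) (X : k.-tuple 'rV[R]_n) (a : 'rV[R]_n).
Hypothesis d0 : 0 < d.
Hypothesis dk : d = k%:R.
Hypothesis mE : measurable (E : set (borelRn R n)).
Hypothesis EX : forall x, E x <-> x - a \in <<X>>%VS.

Local Notation nu := (@hausdorff_on R n d d0 E mE).

Lemma plane_dilation y t x : E y -> 0 < t -> E (a + t^-1 *: (x - y)) <-> E x.
Proof.
move=> /EX yX t0; rewrite !EX (addrC a) addrK; split=> [h|xX].
  have := rpredZ t h; rewrite scalerA mulfV ?gt_eqF // scale1r => {}h.
  by have := rpredD h yX; rewrite addrA subrK.
by apply: rpredZ; have := rpredB xX yX; rewrite opprB addrA subrK.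
Qed.

(** The preimage is the image of [A] under z -> (y - t a) + t z, and the plane is preserved because
    [y] lies in it. *)
Lemma hausdorff_on_dilation y t (A : set (borelRn R n)) : E y -> 0 < t ->
  nu ((fun x : 'rV[R]_n => a + t^-1 *: (x - y)) @^-1` A) = ((t `^ d)%:E * nu A)%E.
Proof.
move=> Ey t0; rewrite !hausdorff_onE -(hausdorff_image d0 (y - t *: a) _ t0).
congr hausdorff; apply/seteqP; split=> [x [/= Ax Ex]|_ [z [Az Ez] <-]].
  exists (a + t^-1 *: (x - y)); first by split => //; apply/plane_dilation.
  by rewrite scalerDr scalerA mulfV ?gt_eqF // scale1r addrA subrK subrKC.
have zE : a + t^-1 *: (y - t *: a + t *: z - y) = z.
  rewrite addrAC (addrAC y) subrr add0r addrC scalerDr scalerN !scalerA.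
  by rewrite mulVf ?gt_eqF // !scale1r subrKC.
by split => /=; [rewrite zE | apply/(plane_dilation _ Ey t0); rewrite zE].
Qed.

Lemma ediam_eball (Q : 'rV[R]_n) r : 0 <= r -> (ediam (eball Q r) <= (2 * r)%:E)%E.
Proof.
move=> r0; apply: ediam_le; first by rewrite lee_fin mulr_ge0.
move=> x y; rewrite /eball /= lee_fin => Qx Qy.
by have := enorm_dist Q x y; rewrite (enormBC x Q); lra.
Qed.

(** The grid gives (2 L N)^k balls of diameter at most 2 w / N; as d = k, the powers of [N]
    cancel. *)
Lemma hausdorff_on_ball1 : (nu (eball a 1) < +oo)%E.
Proof.
have Ea : E a by apply/EX; rewrite subrr mem0v.
have combE t : E (a + \sum_(i < k) t i *: X`_i).
  apply/EX; rewrite addrAC subrr add0r; apply: rpred_sum => i _.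
  by apply/rpredZ/memv_span/mem_nth; rewrite size_tuple.
have [L [w [L0 w0 grid]]] := grid_cover combE (fun x => (EX x).1).
pose B := (2 * L%:R) ^+ k * (2 * w) `^ d.
apply: (@le_lt_trans _ _ B%:E); last exact: ltry.
rewrite hausdorff_onE; apply: hausdorff_le => delta delta0.
have [N N0 wN] : exists2 N : nat, (0 < N)%N & 2 * w / delta < N%:R.
  exists (Num.bound (2 * w / delta)).+1 => //.
  apply: lt_trans (_ : _ < (Num.bound (2 * w / delta))%:R) _; last by rewrite ltr_nat.
  by apply: archi_boundP; rewrite divr_ge0 ?mulr_ge0 ?(ltW w0) ?(ltW delta0).
have NR : 0 < N%:R :> R by rewrite ltr0n.
have wN0 : 0 < w / N%:R by rewrite divr_gt0.
have wd : 2 * (w / N%:R) <= delta.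
  by rewrite mulrA ler_pdivrMr // [leRHS]mulrC -ler_pdivrMr // ltW.
have [s [ss _ scov]] := grid N N0.
pose U i := if (i < size s)%N then eball (nth 0 s i) (w / N%:R) else set0.
have Ud i : (ediam (U i) <= (2 * (w / N%:R))%:E)%E.
  rewrite /U; case: ifP => _; first by apply: ediam_eball; exact: ltW.
  by rewrite ediam0 lee_fin mulr_ge0 // ltW.
apply: (le_trans (@content_le R n d delta (eball a 1 `&` E) U _ _)).
- move=> x /scov[P Ps Px]; exists (index P s) => //.
  by rewrite /U index_mem Ps nth_index.
- by move=> i; apply: le_trans (Ud i) _; rewrite lee_fin.
rewrite (nneseries_split _ (size s)); last by move=> i _; exact: poweR_ge0.
rewrite add0n eseries0 ?adde0; last first.
  by move=> i si _; rewrite /U ltnNge si /= ediam0_powR.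
apply: (@le_trans _ _ (\sum_(0 <= i < size s) ((2 * (w / N%:R)) `^ d)%:E)%E).
  apply: lee_sum => i _; rewrite -poweR_EFin; apply: gt0_ler_poweR (Ud i).
  - exact: ltW.
  - by rewrite in_itv /= ediam_ge0 leey.
  - by rewrite in_itv /= leey lee_fin mulr_ge0 // ltW.
rewrite sumEFin lee_fin big_const_nat iter_addr_0 subn0 -[leLHS]mulr_natl ss.
rewrite (mulrA 2 w) powRM ?mulr_ge0 ?invr_ge0 ?(ltW w0) ?(ltW NR) //.
have -> : N%:R^-1 `^ d = (N%:R ^+ k)^-1.
  by rewrite -(powR_inv1 (ltW NR)) -powRrM mulN1r powRN dk powR_mulrn ?(ltW NR).
rewrite natrX !natrM exprMn /B le_eqVlt; apply/orP; left; apply/eqP.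
by field; rewrite expf_neq0 // gt_eqF.
Qed.

Lemma hausdorff_on_ball r : 0 < r -> (nu (eball a r) < +oo)%E.
Proof.
move=> r0; have Ea : E a by apply/EX; rewrite subrr mem0v.
have := hausdorff_on_dilation (eball a 1) Ea r0.
have -> : (fun x : 'rV[R]_n => a + r^-1 *: (x - a)) @^-1` eball a 1 = eball a r.
  apply/seteqP; split=> x; rewrite /eball /= opprD addNKr enormN enormZ gtr0_norm ?invr_gt0 //;
  by rewrite mulrC ltr_pdivrMr // mul1r (enormBC x).
move=> ->; rewrite lte_mul_pinfty ?lee_fin ?powR_ge0 //; exact: hausdorff_on_ball1.
Qed.

End plane_hausdorff.

Section ahlfors_hausdorff.
Context {R : realType} {n : nat}.
Variables (d C : R) (E : set 'rV[R]_n) (mu : {measure set borelRn R n -> \bar R}).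
Hypothesis d0 : 0 < d.
Hypothesis C1 : 1 <= C.
Hypothesis muI : forall A : set (borelRn R n), measurable A -> mu (A `&` E) = mu A.
Hypothesis mE : measurable (E : set (borelRn R n)).
Hypothesis muE : forall Q r, E Q -> 0 < r ->
  ((C^-1 * r `^ d)%:E <= mu (eball Q r) <= (C * r `^ d)%:E)%E.

(** A set of a cover that meets [E] lies in a ball centred on [E] of radius twice its diameter. The
    bound serves to show that balls of the plane have positive Hausdorff measure. *)
Lemma measure_le_hausdorff (A : set (borelRn R n)) : measurable A ->
  (mu A <= (C * 2 `^ d)%:E * hausdorff d (A `&` E))%E.
Proof.
move=> mA; have C0 : 0 < C := lt_le_trans ltr01 C1.
have K0 : 0 < C * 2 `^ d by rewrite mulr_gt0 ?powR_gt0.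
have mball (Q : 'rV[R]_n) r : measurable (eball Q r : set (borelRn R n)).
  by apply: open_borel; exact: eball_open.
rewrite -lee_pdivrMl //; apply: le_trans (hausdorff_ge _ (A `&` E) ltr01).
apply: le_ereal_inf_tmp => _ [U [AU Ud] <-].
rewrite lee_pdivrMl // -nneseriesZl; last by move=> i _; exact: poweR_ge0.
have Vx i : {V : set (borelRn R n) | [/\ measurable V, U i `&` E `<=` V &
    (mu V <= (C * 2 `^ d)%:E * ediam (U i) `^ d)%E]}.
  apply: cid; have [[x [Ux Ex]]|UE] := pselect (U i `&` E !=set0); last first.
    exists set0; split=> // [y Uy|]; first by apply: UE; exists y.
    by rewrite measure0 mule_ge0 ?poweR_ge0 // lee_fin ltW.
  have dfin : ediam (U i) \is a fin_num.
    by rewrite ge0_fin_numE ?ediam_ge0 //; apply: le_lt_trans (Ud i) (ltry _).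
  set D := fine (ediam (U i)); have DE : ediam (U i) = D%:E by rewrite /D fineK.
  have D0 : 0 <= D by rewrite fine_ge0 // ediam_ge0.
  have UD y : U i y -> enorm (x - y) <= D.
    by move=> Uy; rewrite -lee_fin -DE; exact: enorm_le_ediam.
  have ballle r : 0 < r -> (mu (eball x r) <= (C * r `^ d)%:E)%E.
    by move=> r0; have /andP[] := muE Ex r0.
  have [D1|D1] := ltP 0 D.
    exists (eball x (2 * D)); split => //.
      by move=> y [/UD Uy _]; rewrite /eball /=; lra.
    rewrite DE poweR_EFin -EFinM -mulrA -powRM //; apply: ballle.
    by rewrite mulr_gt0.
  have DE0 : D = 0 by apply/eqP; rewrite eq_le D1 D0.
  (* In diameter 0 the ball of radius [2 * D] would be empty; the singleton replaces it, and it is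
     null because it lies in arbitrarily small balls. *)
  pose V := (fun y => enorm (x - y)) @^-1` [set (0 : R)].
  have mV : measurable (V : set (borelRn R n)).
    apply: closed_borel; apply: (preimage_closed _ (@closed_eq R 0)) => y _.
    exact: enorm_dist_continuous_l.
  exists V; split => //.
    by move=> y [/UD Uy _]; apply/eqP; rewrite eq_le enorm_ge0 andbT -DE0.
  apply: le_trans (_ : mu V <= 0)%E _; last by rewrite mule_ge0 ?poweR_ge0 // lee_fin ltW.
  apply/lee_addgt0Pr => e e0; rewrite add0e.
  pose r := (e / C) `^ d^-1; have r0 : 0 < r by rewrite powR_gt0 // divr_gt0.
  have -> : e = C * r `^ d.
    have eC0 : 0 <= e / C by rewrite divr_ge0 // ltW.
    by rewrite /r -powRrM mulVf ?(gt_eqF d0) // powRr1 // mulrC divfK ?(gt_eqF C0).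
  apply: le_trans (ballle r r0); apply: le_measure; rewrite ?inE //.
  by move=> y; rewrite /V /eball /= => ->.
pose V i := sval (Vx i).
have [mV UV muV] : [/\ forall i, measurable (V i), forall i, U i `&` E `<=` V i &
    forall i, (mu (V i) <= (C * 2 `^ d)%:E * ediam (U i) `^ d)%E].
  by split => i; have [] := svalP (Vx i).
apply: (@le_trans _ _ (\sum_(0 <= i <oo) mu (V i))%E); last first.
  by apply: lee_nneseries => [i _ _|i _]; [exact: measure_ge0 | exact: muV].
rewrite -(muI mA); apply: measure_sigma_subadditive => //; first exact: measurableI.
move=> x [Ax Ex]; have [i _ Ui] := AU x (conj Ax Ex).
by exists i => //; apply: UV.
Qed.

End ahlfors_hausdorff.

(** * Density of the measure *)

Section limn_einf_bounds.
Context {R : realType}.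
Local Open Scope ereal_scope.
Implicit Types (u : nat -> \bar R) (b : \bar R).

Lemma limn_einf_sup_einfs u : limn_einf u = ereal_sup (range (einfs u)).
Proof. by rewrite limn_einf_lim; apply/cvg_lim => //; exact: cvg_einfs_sup. Qed.

Lemma limn_einf_le u b : (forall n, u n <= b) -> limn_einf u <= b.
Proof.
move=> ub; rewrite limn_einf_sup_einfs; apply: ge_ereal_sup => _ [n _ <-].
by apply: le_trans (ub n); apply: ereal_inf_lbound; exists n => /=.
Qed.

Lemma le_limn_einf u b N : (forall n, (N <= n)%N -> b <= u n) -> b <= limn_einf u.
Proof.
move=> bu; rewrite limn_einf_sup_einfs; apply: (@le_trans _ _ (einfs u N)).
  by apply: le_ereal_inf_tmp => _ [n /= Nn <-]; exact: bu.
by apply: ereal_sup_ubound; exists N.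
Qed.

End limn_einf_bounds.

Definition sigma_finite_of d (T : measurableType d) {R : realType}
    (m : {measure set T -> \bar R}) (sf : sigma_finite setT m) :
    {sigma_finite_measure set T -> \bar R} :=
  HB.pack_for {sigma_finite_measure set T -> \bar R} (Measure.sort m)
    (isSFinite.Build _ _ _ _ (sfinite_measure_sigma_finite sf))
    (isSigmaFinite.Build _ _ _ _ sf).

Section fatou_tonelli.
Context d (T : measurableType d) {R : realType}.
Variables (m1 m2 : {sigma_finite_measure set T -> \bar R}).
Variables (K : nat -> T * T -> \bar R) (V : set T) (kappa c : \bar R).
Local Open Scope ereal_scope.
Hypothesis mV : measurable V.
Hypothesis mK : forall n, measurable_fun setT (K n).
Hypothesis K0 : forall n z, 0 <= K n z.

(** Fatou's lemma bounds the left side by the lower limit of the double integrals, which Tonelli's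
    theorem rewrites with the bounded inner integral. It is applied twice, with the measures
    exchanged. *)
Lemma fatou_tonelli : 0 <= kappa -> 0 <= c ->
  (forall y, V y -> kappa <= limn_einf (fun n => \int[m2]_(x in V) K n (y, x))) ->
  (forall n x, V x -> \int[m1]_(y in V) K n (y, x) <= c) ->
  kappa * m1 V <= c * m2 V.
Proof.
move=> kappa0 c0 lo hi.
(* The cut-off to V x V lets Tonelli's theorem be used on the whole space. *)
pose k n := (K n) \_ (V `*` V).
have mVV : measurable (V `*` V) by exact: measurableX.
have mk n : measurable_fun setT (k n).
  by apply/(measurable_restrictT _ mVV); exact: measurable_funTS.
have k0 n z : 0 <= k n z by rewrite /k patchE; case: ifP.
have kF n y : fubini_F m2 (k n) y = ((fun y => \int[m2]_(x in V) K n (y, x)) \_ V) y.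
  rewrite /fubini_F patchE; case: ifPn => yV.
    rewrite [RHS]integral_mkcond; apply: eq_integral => x _.
    by rewrite /k !patchE in_setX /= yV.
  by rewrite integral0_eq // => x _; rewrite /k patchE in_setX /= (negPf yV).
have kG n x : fubini_G m1 (k n) x = ((fun x => \int[m1]_(y in V) K n (y, x)) \_ V) x.
  rewrite /fubini_G patchE; case: ifPn => xV.
    rewrite [RHS]integral_mkcond; apply: eq_integral => y _.
    by rewrite /k !patchE in_setX /= xV andbT.
  by rewrite integral0_eq // => y _; rewrite /k patchE in_setX /= (negPf xV) andbF.
have mF n : measurable_fun V (fun y => \int[m2]_(x in V) K n (y, x)).
  apply/(measurable_restrictT _ mV).
  apply: eq_measurable_fun (measurable_fun_fubini_tonelli_F (k n) (mk n) (k0 n)).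
  by move=> y _; exact: kF.
have mG n : measurable_fun V (fun x => \int[m1]_(y in V) K n (y, x)).
  apply/(measurable_restrictT _ mV).
  apply: eq_measurable_fun (measurable_fun_fubini_tonelli_G (k n) (mk n) (k0 n)).
  by move=> y _; exact: kG.
have F0 n y : V y -> 0 <= \int[m2]_(x in V) K n (y, x) by move=> _; exact: integral_ge0.
have swap n : \int[m1]_(y in V) \int[m2]_(x in V) K n (y, x) =
    \int[m2]_(x in V) \int[m1]_(y in V) K n (y, x).
  rewrite [LHS]integral_mkcond [RHS]integral_mkcond.
  under eq_integral do rewrite -kF.
  under [RHS]eq_integral do rewrite -kG.
  exact: fubini_tonelli.
rewrite -(integral_cst _ mV) -(integral_cst _ mV).
apply: (@le_trans _ _ (\int[m1]_(y in V) limn_einf (fun n => \int[m2]_(x in V) K n (y, x)))).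
  apply: ge0_le_integral => //.
  apply: measurableT_comp => //.
  apply: (measurable_fun_limn_esup (f := fun n y => - \int[m2]_(x in V) K n (y, x))) => n.
  exact: measurableT_comp.
apply: le_trans (fatou _ _ _ _) _ => //.
apply: limn_einf_le => n; rewrite swap.
apply: ge0_le_integral => // [x _|x Vx]; [exact: integral_ge0 | exact: hi].
Qed.

End fatou_tonelli.

(** * The kernel as an approximate identity *)

Section extension_kernel.
Context {R : realType} {n : nat}.
Variables (d alpha : R).
Hypothesis d0 : 0 < d.
Hypothesis alpha0 : 0 < alpha.
Implicit Types (t : R) (x y : 'rV[R]_n).

Let q := (d + alpha) / 2.

Let q0 : 0 < q. Proof. by rewrite divr_gt0 // addr_gt0. Qed.

(* For [x], [y] in a hyperplane and [u] a unit normal vector, this is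
   [t `^ alpha * enorm (x + t *: u - y) `^ (- d - alpha)]. *)
Definition ext_kernel t x y : R :=
  t `^ alpha * (enorm (x - y) ^+ 2 + t ^+ 2) `^ (- ((d + alpha) / 2)).

Lemma ext_kernel_ge0 t x y : 0 <= ext_kernel t x y.
Proof. by rewrite mulr_ge0 ?powR_ge0. Qed.

Lemma ext_kernelC t x y : ext_kernel t x y = ext_kernel t y x.
Proof. by rewrite /ext_kernel enormBC. Qed.

(** The scaling of an approximate identity in dimension [d]; every kernel is brought back to
    parameter 1 and pole [a]. *)
Lemma ext_kernel_dilation t x y a : 0 < t ->
  t `^ d * ext_kernel t x y = ext_kernel 1 (a + t^-1 *: (x - y)) a.
Proof.
move=> t0; have t20 : 0 < t ^+ 2 by rewrite exprn_gt0.
rewrite /ext_kernel (addrC a) addrK enormZ gtr0_norm ?invr_gt0 // powR1 mul1r expr1n.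
have -> : (t^-1 * enorm (x - y)) ^+ 2 + 1 = (enorm (x - y) ^+ 2 + t ^+ 2) * (t ^+ 2)^-1.
  by field; rewrite gt_eqF.
rewrite [RHS]powRM ?invr_ge0 ?addr_ge0 ?exprn_ge0 ?enorm_ge0 ?(ltW t0) //.
rewrite mulrA mulrC; congr (_ * _).
rewrite -powRD; last by rewrite (gt_eqF t0) implybT.
rewrite -(powR_inv1 (ltW t20)) -powRrM mulN1r opprK -powR_mulrn ?(ltW t0) // -powRrM.
by congr (_ `^ _); field.
Qed.

(** At distance at least [eps], |x - y|^2 + eps^2 is at most twice |x - y|^2 + t^2; the rest is the
    ratio of t^alpha to eps^alpha. *)
Lemma ext_kernel_tail eps t x y : 0 < eps -> 0 < t -> eps <= enorm (x - y) ->
  ext_kernel t x y <= 2 `^ q * (t / eps) `^ alpha * ext_kernel eps x y.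
Proof.
move=> e0 t0 exy; rewrite /ext_kernel -/q.
have s0 : 0 < enorm (x - y) by apply: lt_le_trans exy.
set s := enorm (x - y) in exy s0 *.
have te : t `^ alpha = (t / eps) `^ alpha * eps `^ alpha.
  by rewrite -powRM ?divr_ge0 ?(ltW t0) ?(ltW e0) // divfK // gt_eqF.
have e2 : eps ^+ 2 <= s ^+ 2 by rewrite ler_sqr ?nnegrE ?(ltW e0) ?(ltW s0).
have e20 : 0 < eps ^+ 2 by rewrite exprn_gt0.
have t20 : 0 < t ^+ 2 by rewrite exprn_gt0.
have s20 : 0 < s ^+ 2 by rewrite exprn_gt0.
have h : (s ^+ 2 + t ^+ 2) `^ (- q) <= 2 `^ q * (s ^+ 2 + eps ^+ 2) `^ (- q).
  rewrite -[2]invrK -powR_inv1 // -powRrM mulN1r -powRM ?invr_ge0 //; last by lra.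
  rewrite !powRN lef_pV2 ?posrE ?powR_gt0 //; [|lra|lra].
  apply: ge0_ler_powR; rewrite ?nnegrE ?(ltW q0) //; lra.
rewrite te -mulrA; apply: (@le_trans _ _ ((t / eps) `^ alpha * (eps `^ alpha *
    (2 `^ q * (s ^+ 2 + eps ^+ 2) `^ (- q))))).
  by rewrite ler_wpM2l ?powR_ge0 // ler_wpM2l ?powR_ge0.
by rewrite le_eqVlt; apply/orP; left; apply/eqP; ring.
Qed.

Lemma measurable_coordinate (i : 'I_n) :
  measurable_fun [set: borelRn R n] (fun x : borelRn R n => (x : 'rV[R]_n) 0 i).
Proof.
apply: continuous_borel_measurable => x.
apply: (@enorm_continuous_at _ _ _ x 1 1) => // z _; rewrite mul1r.
have -> : x 0 i - z 0 i = (x - z) 0 i by rewrite !mxE.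
apply: le_trans (norm_le_enorm _).
rewrite [leRHS]/Num.norm /= mx_normrE.
by apply/bigmax_geP; right => /=; exists (0, i).
Qed.

Lemma measurable_ext_kernel t : measurable_fun [set: borelRn R n * borelRn R n]
  (fun z : borelRn R n * borelRn R n => ext_kernel t (z.1 : 'rV[R]_n) (z.2 : 'rV[R]_n)).
Proof.
apply: measurable_funM => //; apply: (measurableT_comp (measurable_powR _)).
apply: measurable_funD => //.
have -> : (fun z : borelRn R n * borelRn R n => enorm ((z.1 : 'rV[R]_n) - (z.2 : 'rV[R]_n)) ^+ 2) =
   (fun z : borelRn R n * borelRn R n => \sum_(i < n)
     ((z.1 : 'rV[R]_n) 0 i - (z.2 : 'rV[R]_n) 0 i) ^+ 2).
  by apply/funext => z; rewrite enorm_sqr; apply: eq_bigr => i _; rewrite !mxE expr2.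
apply: measurable_sum => i; apply: measurable_funX; apply: measurable_funB.
  exact: (measurableT_comp (measurable_coordinate i) measurable_fst).
exact: (measurableT_comp (measurable_coordinate i) measurable_snd).
Qed.

Lemma measurable_ext_kernel_r t x :
  measurable_fun [set: borelRn R n] (fun y : borelRn R n => ext_kernel t x (y : 'rV[R]_n)).
Proof.
apply: measurable_funM => //; apply: (measurableT_comp (measurable_powR _)).
apply: measurable_funD => //; apply: measurable_funX.
exact: (continuous_borel_measurable (@enorm_dist_continuous_l _ _ x)).
Qed.

Section concentration.
Variables (m : {measure set borelRn R n -> \bar R}) (E : set 'rV[R]_n) (x : 'rV[R]_n) (c : R).
Hypothesis mE : measurable (E : set (borelRn R n)).
Hypothesis mc : forall t, 0 < t ->
  (\int[m]_(y in E) (ext_kernel t x (y : 'rV[R]_n))%:E = c%:E)%E.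

(* Outside [eball x eps] the kernel of parameter [t] is dominated by a small multiple
   of the kernel of parameter [eps], whose integral is also [c]. *)
Lemma ext_kernel_concentration eps t : 0 < eps -> 0 < t ->
  ((c - 2 `^ q * (t / eps) `^ alpha * c)%:E <=
   \int[m]_(y in E `&` eball x eps) (ext_kernel t x (y : 'rV[R]_n))%:E)%E.
Proof.
move=> e0 t0; set B := eball x eps; set k := 2 `^ q * (t / eps) `^ alpha.
have k0 : 0 <= k by rewrite mulr_ge0 ?powR_ge0.
have mB : measurable (B : set (borelRn R n)) by apply: open_borel; exact: eball_open.
have mEB : measurable (E `&` B : set (borelRn R n)) by exact: measurableI.
have mED : measurable (E `\` B : set (borelRn R n)) by exact: measurableD.
have mker t' (A : set (borelRn R n)) :
    measurable_fun A (fun y : borelRn R n => (ext_kernel t' x (y : 'rV[R]_n))%:E).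
  by apply/measurable_EFinP; apply: measurable_funTS; exact: measurable_ext_kernel_r.
have ker0 t' (y : 'rV[R]_n) : (0 <= (ext_kernel t' x y)%:E)%E by rewrite lee_fin ext_kernel_ge0.
have split : (\int[m]_(y in E) (ext_kernel t x (y : 'rV[R]_n))%:E =
    \int[m]_(y in E `&` B) (ext_kernel t x (y : 'rV[R]_n))%:E +
    \int[m]_(y in E `\` B) (ext_kernel t x (y : 'rV[R]_n))%:E)%E.
  rewrite -ge0_integral_setU ?setUIDK //.
  by rewrite disj_set2E setDE setIACA setICr setI0.
have tail : (\int[m]_(y in E `\` B) (ext_kernel t x (y : 'rV[R]_n))%:E <= (k * c)%:E)%E.
  rewrite EFinM -(mc e0) -ge0_integralZl //.
  apply: le_trans (_ : \int[m]_(y in E `\` B) (k%:E * (ext_kernel eps x (y : 'rV[R]_n))%:E) <= _)%E.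
    apply: ge0_le_integral => //; first exact: measurable_funeM.
    move=> y [_ /= By]; rewrite -EFinM lee_fin; apply: ext_kernel_tail => //.
    by rewrite leNgt; apply/negP.
  apply: ge0_subset_integral => //; first exact: measurable_funeM.
  by move=> y _; rewrite mule_ge0 // lee_fin.
have := mc t0; rewrite split => hc.
rewrite EFinB leeBlDr // -hc; apply: leeD => //.
Qed.

End concentration.
End extension_kernel.

Lemma mule_fin_inj (R : realType) (r : R) : r != 0 ->
  injective (fun x : \bar R => r%:E * x)%E.
Proof.
by move=> r0 x y /eqP; rewrite -eqe_pdivrMl // muleA -EFinM mulVf // mul1e => /eqP.
Qed.

Section uniqueness.
Context {R : realType} {n k : nat}.
Variables (d alpha C c : R) (E : set 'rV[R]_n) (X : k.-tuple 'rV[R]_n) (a : 'rV[R]_n).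
Variable mu : {measure set borelRn R n -> \bar R}.
Hypothesis d0 : 0 < d.
Hypothesis alpha0 : 0 < alpha.
Hypothesis c0 : 0 < c.
Hypothesis C1 : 1 <= C.
Hypothesis dk : d = k%:R.
Hypothesis mE : measurable (E : set (borelRn R n)).
Hypothesis EX : forall x, E x <-> x - a \in <<X>>%VS.
Hypothesis muI : forall A : set (borelRn R n), measurable A -> mu (A `&` E) = mu A.
Hypothesis muE : forall Q r, E Q -> 0 < r ->
  ((C^-1 * r `^ d)%:E <= mu (eball Q r) <= (C * r `^ d)%:E)%E.
Hypothesis mu_pot : forall x t, E x -> 0 < t ->
  (\int[mu]_(y in E) (ext_kernel d alpha t x (y : 'rV[R]_n))%:E = c%:E)%E.

Local Notation K := (ext_kernel d alpha).
Local Notation nu := (@hausdorff_on R n d d0 E mE).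

Let Ea : E a. Proof. by apply/EX; rewrite subrr mem0v. Qed.

Let mball (Q : 'rV[R]_n) r : measurable (eball Q r : set (borelRn R n)).
Proof. by apply: open_borel; exact: eball_open. Qed.

Let mK t x (A : set (borelRn R n)) :
  measurable_fun A (fun y : borelRn R n => (K t x (y : 'rV[R]_n))%:E).
Proof. by apply/measurable_EFinP; apply: measurable_funTS; exact: measurable_ext_kernel_r. Qed.

Let K0 t (x y : 'rV[R]_n) : (0 <= (K t x y)%:E)%E.
Proof. by rewrite lee_fin ext_kernel_ge0. Qed.

Let balls_cover : \bigcup_i eball a i.+1%:R = [set: 'rV[R]_n].
Proof.
apply/seteqP; split => // x _; exists (Num.bound (enorm (a - x))) => //.
rewrite /eball /=; apply: lt_trans (_ : _ < (Num.bound (enorm (a - x)))%:R) _.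
  by apply: archi_boundP; exact: enorm_ge0.
by rewrite ltr_nat.
Qed.

Let mu_fin r : 0 < r -> (mu (eball a r) < +oo)%E.
Proof. by move=> r0; have /andP[_ h] := muE Ea r0; exact: le_lt_trans h (ltry _). Qed.

Let nu_fin r : 0 < r -> (nu (eball a r) < +oo)%E.
Proof. exact: (hausdorff_on_ball d0 dk mE EX). Qed.

Let mu_sf : sigma_finite setT mu.
Proof.
exists (fun i => eball a i.+1%:R); first exact: esym balls_cover.
by move=> i; split; [exact: mball | exact: mu_fin].
Qed.

Let nu_sf : sigma_finite setT nu.
Proof.
exists (fun i => eball a i.+1%:R); first exact: esym balls_cover.
by move=> i; split; [exact: mball | exact: nu_fin].
Qed.

Let m1 := sigma_finite_of mu_sf.
Let m2 := sigma_finite_of nu_sf.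

(** Kept in [\bar R], since its finiteness is obtained only at the end. *)
Let kappa := (\int[nu]_(z in E) (K 1 a (z : 'rV[R]_n))%:E)%E.

Let dilation y t (x : borelRn R n) : borelRn R n := a + t^-1 *: ((x : 'rV[R]_n) - y).

Let mdilation y t : 0 < t -> measurable_fun [set: borelRn R n] (dilation y t).
Proof.
move=> t0; refine (@measurability _ _ (borelRn R n) (borelRn R n) setT (dilation y t)
  (@open 'rV[R]_n) _ _) => // _ [U oU <-].
rewrite setTI; apply: open_borel.
rewrite openE => x Ux; have /nbhs_eballP[r r0 hr] := open_nbhs_nbhs (conj oU Ux).
apply/nbhs_eballP; exists (t * r); first by rewrite mulr_gt0.
move=> z; rewrite /eball /= => xz; apply: hr; rewrite /eball /dilation /=.
rewrite opprD addrACA subrr add0r -scalerBr opprB addrA subrK enormZ.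
by rewrite gtr0_norm ?invr_gt0 // mulrC ltr_pdivrMr // mulrC.
Qed.

(** Change of variables: the dilation sends [nu] to t^d [nu] and the kernel scales by the same
    factor, which cancels. A small ball about [y] thus becomes a large ball about [a]. *)
Let nu_dilation y t (D : set (borelRn R n)) : E y -> 0 < t -> measurable D ->
  (\int[nu]_(x in dilation y t @^-1` D) (K t y (x : 'rV[R]_n))%:E =
   \int[nu]_(z in D) (K 1 a (z : 'rV[R]_n))%:E)%E.
Proof.
move=> Ey t0 mD; have td0 : 0 < t `^ d by exact: powR_gt0.
have mphiD : measurable (dilation y t @^-1` D).
  by rewrite -[_ @^-1` _]setTI; exact: mdilation.
have td0' : 0 <= t `^ d by exact: ltW.
have h : (\int[pushforward nu (dilation y t)]_(z in D) (K 1 a (z : 'rV[R]_n))%:E =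
    (t `^ d)%:E * \int[nu]_(z in D) (K 1 a (z : 'rV[R]_n))%:E)%E.
  rewrite (eq_measure_integral (mscale (NngNum td0') nu)).
    by rewrite ge0_integral_mscale.
    exact: mdilation.
  by move=> mphi A mA _; exact: (hausdorff_on_dilation d0 mE EX A Ey t0).
move: h; rewrite (ge0_integral_pushforward (mdilation y t0) nu mD (@mK 1 a D)); last first.
  by move=> z _; exact: K0.
have -> : (\int[nu]_(x in dilation y t @^-1` D)
      ((fun z : borelRn R n => (K 1 a (z : 'rV[R]_n))%:E) \o dilation y t) x =
    (t `^ d)%:E * \int[nu]_(x in dilation y t @^-1` D) (K t y (x : 'rV[R]_n))%:E)%E.
  rewrite -ge0_integralZl //; apply: eq_integral => x _ /=.
  by rewrite ext_kernelC -(ext_kernel_dilation _ _ _ _ _ t0) (ext_kernelC _ _ _ y) EFinM.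
exact: (mule_fin_inj (lt0r_neq0 td0)).
Qed.

Let kappa_lim : (\int[nu]_(z in E `&` eball a M.+1%:R) (K 1 a (z : 'rV[R]_n))%:E
  @[M --> \oo] --> kappa)%E.
Proof.
rewrite /kappa -[X in (\int[nu]_(z in X) _)%E](setIT E) -balls_cover setI_bigcupr.
apply: ge0_nondecreasing_set_cvg_integral => // [i j ij|i].
  apply/subsetPset; apply: setIS => x; rewrite /eball /= => /lt_le_trans; apply.
  by rewrite ler_nat.
exact: measurableI.
Qed.

Let step t := t.+1%:R^-1 : R.

Let step_gt0 i : 0 < step i. Proof. by rewrite invr_gt0. Qed.

Let step_lt r : 0 < r -> exists N, forall i, (N <= i)%N -> step i < r.
Proof.
move=> r0; exists (Num.bound r^-1) => i Ni.
rewrite invf_plt ?posrE //; apply: lt_le_trans (_ : (Num.bound r^-1)%:R <= _).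
  by apply: archi_boundP; rewrite invr_ge0 ltW.
by rewrite ler_nat leqW.
Qed.

Let open_ball U y : open U -> (U `&` E) y -> exists2 r, 0 < r & E `&` eball y r `<=` U `&` E.
Proof.
move=> oU [Uy _]; have /nbhs_eballP[r r0 hr] := open_nbhs_nbhs (conj oU Uy).
by exists r => // x [Ex /hr].
Qed.

Let KN i (z : borelRn R n * borelRn R n) : \bar R :=
  (K (step i) (z.1 : 'rV[R]_n) (z.2 : 'rV[R]_n))%:E.

Let mKN i : measurable_fun setT (KN i).
Proof. by apply/measurable_EFinP; exact: measurable_ext_kernel. Qed.

Let KN0 i z : (0 <= KN i z)%E. Proof. exact: K0. Qed.

Let kappa0 : (0 <= kappa)%E. Proof. by apply: integral_ge0 => z _; exact: K0. Qed.

Let sub_int (m : {measure set borelRn R n -> \bar R}) (A B : set (borelRn R n)) t x :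
  measurable A -> measurable B -> A `<=` B ->
  (\int[m]_(y in A) (K t x (y : 'rV[R]_n))%:E <= \int[m]_(y in B) (K t x (y : 'rV[R]_n))%:E)%E.
Proof. by move=> mA mB AB; apply: ge0_subset_integral => // y _; exact: K0. Qed.

Let KNC (m : {measure set borelRn R n -> \bar R}) (A : set (borelRn R n)) i x :
  (\int[m]_(y in A) KN i (y, x) = \int[m]_(y in A) (K (step i) (x : 'rV[R]_n) (y : 'rV[R]_n))%:E)%E.
Proof. by apply: eq_integral => y _; rewrite /KN /= ext_kernelC. Qed.

Let mUE U : open U -> measurable (U `&` E : set (borelRn R n)).
Proof. by move=> oU; apply: measurableI => //; exact: open_borel. Qed.

Let mpre y t (D : set (borelRn R n)) : 0 < t -> measurable D ->
  measurable (dilation y t @^-1` D).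
Proof. by move=> t0 mD; rewrite -[_ @^-1` _]setTI; exact: mdilation. Qed.

(** The lower limit for [nu] comes from dilation: a fixed ball about [a] pulls back inside [U] once
    the step is small. *)
Let mu_le_nu U : open U -> (kappa * mu (U `&` E) <= c%:E * nu (U `&` E))%E.
Proof.
move=> oU; have mV := mUE oU.
apply: (@fatou_tonelli _ _ _ m1 m2 KN _ _ _ mV mKN KN0 kappa0).
- by rewrite lee_fin ltW.
- move=> y Uy; have Ey : E y by case: Uy.
  have [r r0 hr] := open_ball oU Uy.
  (* [kappa] is a limit of integrals over balls of radius [M.+1], each of which is bounded
     separately. *)
  rewrite -(cvg_lim _ kappa_lim) //; apply: lime_le; first by apply/cvg_ex; exists kappa.
  apply: nearW => M; have M0 : 0 < M.+1%:R :> R by [].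
  have [N hN] := step_lt (divr_gt0 r0 M0).
  have stepM i : (N <= i)%N -> step i * M.+1%:R < r by move=> /hN; rewrite ltr_pdivlMr.
  apply: (@le_limn_einf _ _ _ N) => i /stepM iM.
  have mD : measurable (E `&` eball a M.+1%:R : set (borelRn R n)) by exact: measurableI.
  rewrite -(nu_dilation Ey (step_gt0 i) mD); apply: sub_int => //.
    exact: mpre (step_gt0 i) mD.
  move=> x [/(plane_dilation EX _ Ey (step_gt0 i)) Ex xM]; apply: hr; split => //.
  move: xM; rewrite /eball /= /dilation opprD addrA subrr add0r -scalerN opprB enormZ.
  rewrite gtr0_norm ?invr_gt0 // ?step_gt0 // => xM; apply: lt_trans iM.
  by rewrite -ltr_pdivrMl ?step_gt0.
- move=> i x Ux; have Ex : E x by case: Ux.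
  by rewrite KNC -(mu_pot Ex (step_gt0 i)); apply: sub_int => // y [].
Qed.

(** No dilation is available for [mu]; its lower limit comes from the concentration estimate, up to
    an error [e]. *)
Let nu_le_mu U : open U -> (c%:E * nu (U `&` E) <= kappa * mu (U `&` E))%E.
Proof.
move=> oU; have mV := mUE oU.
have c0' : (0 <= c%:E)%E by rewrite lee_fin ltW.
apply: (@fatou_tonelli _ _ _ m2 m1 KN _ _ _ mV mKN KN0 c0' kappa0).
- move=> y Uy; have Ey : E y by case: Uy.
  have [r r0 hr] := open_ball oU Uy.
  apply/lee_subgt0Pr => e e0.
  set A := 2 `^ ((d + alpha) / 2) : R.
  have A0 : 0 < A by exact: powR_gt0.
  (* For steps below [rho * r] the mass lost outside the ball, A (step / r)^alpha c, is at most
     [e]. *)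
  pose rho := (e / (A * c)) `^ alpha^-1.
  have eAc : 0 < e / (A * c) by rewrite divr_gt0 ?mulr_gt0.
  have rho0 : 0 < rho by exact: powR_gt0.
  have [N hN] := step_lt (mulr_gt0 rho0 r0).
  have stepr i : (N <= i)%N -> step i / r < rho by move=> /hN; rewrite ltr_pdivrMr.
  apply: (@le_limn_einf _ _ _ N) => i /stepr ir.
  have mD : measurable (E `&` eball y r : set (borelRn R n)) by exact: measurableI.
  apply: (@le_trans _ _ (\int[mu]_(z in E `&` eball y r) (K (step i) y (z : 'rV[R]_n))%:E)%E);
    last exact: sub_int.
  apply: le_trans (ext_kernel_concentration d0 alpha0 mE (fun t => @mu_pot y t Ey) r0 (step_gt0 i)).
  rewrite -EFinB lee_fin lerD2l lerN2 -/A.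
  have : (step i / r) `^ alpha <= e / (A * c).
    have -> : e / (A * c) = rho `^ alpha.
      by rewrite /rho -powRrM mulVf ?gt_eqF // powRr1 // ltW.
    by apply: ge0_ler_powR; rewrite ?nnegrE ?ltW // ?divr_gt0 ?step_gt0.
  rewrite ler_pdivlMr ?mulr_gt0 // => h.
  by rewrite mulrAC mulrC.
- move=> i x Ux; have Ex : E x by case: Ux.
  rewrite KNC /kappa -(nu_dilation Ex (step_gt0 i) mE).
  apply: sub_int => //; first exact: mpre.
  by move=> y [_ Ey]; apply/(plane_dilation EX _ Ex (step_gt0 i)).
Qed.

Let nu_ball_gt0 : (0 < nu (eball a 1))%E.
Proof.
have C0 : 0 < C := lt_le_trans ltr01 C1.
have := measure_le_hausdorff d0 C1 muI mE muE (mball a 1).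
have /andP[lo _] := muE Ea ltr01; rewrite powR1 mulr1 in lo.
have {}lo : (0 < mu (eball a 1))%E by apply: lt_le_trans lo; rewrite lte_fin invr_gt0.
move=> /(lt_le_trans lo); rewrite hausdorff_onE pmule_rgt0 //.
by rewrite lte_fin mulr_gt0 ?powR_gt0.
Qed.

Lemma measure_eq_hausdorff :
  exists2 c' : R, 0 < c' & forall A : set (borelRn R n), measurable A ->
    mu A = (c'%:E * hausdorff d (A `&` E))%E.
Proof.
have nuI (A : set (borelRn R n)) : nu (A `&` E) = nu A.
  by rewrite !hausdorff_onE -setIA setIid.
have eqU U : open U -> (kappa * mu U = c%:E * nu U)%E.
  move=> oU; rewrite -(muI (open_borel oU)) -nuI; apply/eqP; rewrite eq_le.
  by rewrite mu_le_nu // nu_le_mu.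
have ob : (kappa * mu (eball a 1) = c%:E * nu (eball a 1))%E by apply: eqU; exact: eball_open.
have /andP[lo _] := muE Ea ltr01; rewrite powR1 mulr1 in lo.
have C0 : 0 < C := lt_le_trans ltr01 C1.
have {}lo : (0 < mu (eball a 1))%E by apply: lt_le_trans lo; rewrite lte_fin invr_gt0.
(* On one ball [mu] is positive and [nu] finite, which excludes an infinite [kappa]; positivity of
   [nu] there then excludes 0. *)
have kfin : kappa \is a fin_num.
  rewrite ge0_fin_numE // ltNge leye_eq; apply/negP => /eqP koo.
  have : (c%:E * nu (eball a 1) < +oo)%E by rewrite lte_mul_pinfty ?lee_fin ?ltW ?nu_fin.
  by rewrite -ob koo gt0_mulye.
have k0 : 0 < fine kappa.
  rewrite -lte_fin fineK // lt_def kappa0 andbT; apply/eqP => k0.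
  have : (0 < c%:E * nu (eball a 1))%E by rewrite mule_gt0.
  by rewrite -ob k0 mul0e ltxx.
exists (c / fine kappa); first by rewrite divr_gt0.
have q0 : 0 <= c / fine kappa by rewrite divr_ge0 // ltW.
move=> A mA; rewrite -hausdorff_onE.
rewrite (_ : (_ * _)%E = mscale (NngNum q0) nu A) //.
(* Open sets are stable under intersection and generate the Borel sets, and balls of finite measure
   exhaust the space. *)
refine (@measure_unique _ R (borelRn R n) (@open 'rV[R]_n) (fun i => eball a i.+1%:R)
  _ _ _ _ mu (mscale (NngNum q0) nu) _ _ A mA) => //.
- by move=> ? ?; exact: openI.
- by move=> i; exact: eball_open.
- move=> U oU; change (mu U = (c / fine kappa)%:E * nu U)%E.
  rewrite [in RHS]mulrC EFinM -muleA -eqU // muleA.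
  by rewrite -{2}(fineK kfin) -EFinM mulVf ?gt_eqF // mul1e.
- by move=> i; exact: mu_fin.
Qed.

End uniqueness.

(** By Pythagoras; the potential at [q + f] depends on [f] only through its norm. *)
Lemma riesz_orthogonal (R : realType) n (mu : {measure set borelRn R n -> \bar R})
    (E : set 'rV[R]_n) p (q f : 'rV[R]_n) : (forall y, E y -> dot f (y - q) = 0) ->
  (riesz mu E p (q + f) =
   \int[mu]_(y in E) ((enorm (q - (y : 'rV[R]_n)) ^+ 2 + enorm f ^+ 2) `^ (- (p / 2)))%:E)%E.
Proof.
move=> fE; apply: eq_integral => y; rewrite inE => Ey; congr (_%:E).
have -> : enorm (q - y) ^+ 2 + enorm f ^+ 2 = enorm (q + f - y) ^+ 2.
  have : dot (q - y) f = 0 by rewrite dotC -(opprB y q) dotNr fE // oppr0.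
  by rewrite addrAC (enorm_sqrD (q - y)) => ->; rewrite mulr0 addr0.
rewrite -powR_mulrn ?enorm_ge0 // -powRrM; congr (_ `^ _).
by field.
Qed.

Section constant_slope.
Context {R : realType} {n : nat}.
Variables (d alpha c : R) (E : set 'rV[R]_n).
Variable mu : {measure set borelRn R n -> \bar R}.
Hypothesis alpha0 : 0 < alpha.
Hypothesis c0 : 0 < c.
Hypothesis mE : measurable (E : set (borelRn R n)).
Hypothesis E0 : E !=set0.
Hypothesis riesz_lty : forall x, ~ E x -> (riesz mu E (d + alpha) x < +oo)%E.
Hypothesis D_eq : forall x, ~ E x -> Dmu d alpha mu E x = c * dist_to E x.

(** D = c t at distance [t] means that the potential there is (c t)^(- alpha); the factor t^alpha of
    the kernel removes [t]. *)
Lemma ext_kernel_integral (u q : 'rV[R]_n) t : enorm u = 1 -> E q -> 0 < t ->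
  (forall y, E y -> dot u (y - q) = 0) ->
  (\int[mu]_(y in E) (ext_kernel d alpha t q (y : 'rV[R]_n))%:E = (c `^ (- alpha))%:E)%E.
Proof.
move=> u1 Eq t0 uE.
have tuE y : E y -> dot (t *: u) (y - q) = 0 by move=> Ey; rewrite dotZl uE ?mulr0.
have ntu : enorm (t *: u) = t by rewrite enormZ u1 mulr1 gtr0_norm.
have nE : ~ E (q + t *: u).
  by apply: outside_orthogonal tuE; rewrite -enorm_eq0 ntu gt_eqF.
have := D_eq nE; rewrite (dist_to_orthogonal E0 Eq tuE) ntu DmuE.
set r := riesz _ _ _ _ => Dr.
have r0 : (0 <= r)%E by exact: riesz_ge0.
have rfin : r \is a fin_num by rewrite ge0_fin_numE //; exact: riesz_lty.
have er : fine r = (c * t) `^ (- alpha).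
  rewrite -Dr -powRrM mulrNN mulVf ?gt_eqF // powRr1 //; exact: fine_ge0.
transitivity ((t `^ alpha)%:E * r)%E.
  rewrite /r (riesz_orthogonal _ _ tuE) ntu -ge0_integralZl //.
- apply/measurable_EFinP; apply: (measurableT_comp (measurable_powR _)).
  apply: measurable_funD => //; apply: measurable_funX; apply: measurable_funTS.
  exact: (continuous_borel_measurable (@enorm_dist_continuous_l _ _ q)).
- by move=> y _; rewrite lee_fin powR_ge0.
- by rewrite lee_fin powR_ge0.
rewrite -(fineK rfin) er -EFinM; congr (_%:E).
rewrite powRM ?ltW // mulrCA -powRD ?subrr ?powRr0 ?mulr1 //.
by rewrite (gt_eqF t0) implybT.
Qed.

End constant_slope.

Theorem corollary3p2 (R : realType) (n : nat) (d : R)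
    (d_gt0 : 0 < d) (d_ltn : d < n%:R)
    (E : set 'rV[R]_n) (E_unbounded : ~ bounded_set E)
    (mu : {measure set (borelRn R n) -> \bar R})
    (mu_regular : ahlfors_regular d mu E)
    (alpha : R) (alpha_gt0 : 0 < alpha)
    (grad_const : locally_constant_on (~` E)
       (fun x => enorm (gradient (Dmu d alpha mu E) x)))
    (grad_gt0 : forall x, (~` E) x ->
       0 < enorm (gradient (Dmu d alpha mu E) x)) :
  (exists k : nat, d = k%:R /\ affine_plane k E) /\
  (exists2 c : R, 0 < c &
     forall A : set (borelRn R n), measurable A ->
       mu A = (c%:E * hausdorff d (A `&` E))%E) /\
  (d < n%:R - 1 ->
     exists2 c : R, 0 < c &
       forall x, (~` E) x -> Dmu d alpha mu E x = c * dist_to E x).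
Proof.
case: mu_regular => Ecl supp [C C1 muE'].
have E0 := unbounded_nonempty E_unbounded.
have muE Q r : E Q -> 0 < r ->
    ((C^-1 * r `^ d)%:E <= mu (eball Q r) <= (C * r `^ d)%:E)%E.
  by move=> EQ r0; apply: muE' => //; rewrite unbounded_ediam // ltry.
have mE : measurable (E : set (borelRn R n)) by exact: closed_borel.
have muEC : mu (~` E) = 0 by exact: measure_setC_support.
have muI (A : set (borelRn R n)) : measurable A -> mu (A `&` E) = mu A.
  exact: measure_setIE.
pose D := Dmu d alpha mu E; pose G := gradient D.
have DG x : ~ E x -> frechet D x (G x).
  exact: (D_frechet d_gt0 alpha_gt0 Ecl E0 muEC C1 muE grad_gt0).
have D0 x : 0 <= D x by exact: powR_ge0.
have [K K0 D_le] := D_near d_gt0 alpha_gt0 Ecl E0 muEC C1 muE grad_gt0.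
have half := half_space Ecl E0 D0 DG K0 D_le grad_gt0 grad_const.
have Ddist := D_dist Ecl E0 D0 DG K0 D_le grad_gt0 grad_const.
have [a Ea] := E0; have [m [X [freeX EX XE]]] := maximal_free E a.
have md : m%:R <= d.
  case: (posnP m) => [->|m0]; first exact: ltW.
  apply: (@dim_le_of_box_subset _ _ _ _ _ _ mu C1 muE X a) => // t tm.
  (* Coordinates between 0 and 1 / m have sum at most 1, so the box lies in the simplex. *)
  apply: convex_comb => // [i|]; first by case/andP: (tm i).
  apply: (@le_trans _ _ (\sum_(i < m) m%:R^-1)).
    by apply: ler_sum => i _; case/andP: (tm i).
  by rewrite sumr_const card_ord -[_ *+ m]mulr_natr mulVf // pnatr_eq0 -lt0n.
have mn : (m < n)%N by rewrite -(ltr_nat R); exact: le_lt_trans d_ltn.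
have Xspan x : x - a \in <<X>>%VS -> E x.
  apply: (affine_of_lowdim E0 half DG grad_const Ddist) => //.
  exact: (gradient_orthogonal d_gt0 alpha_gt0 Ecl E0 muEC C1 muE grad_gt0).
have EiffX x : E x <-> x - a \in <<X>>%VS by split; [exact: XE | exact: Xspan].
have dm : d = m%:R.
  apply/eqP; rewrite eq_le md andbT.
  apply: (@dim_ge_of_span _ _ _ _ _ _ mu C1 mE muI muE X a) => // t.
  apply: Xspan; rewrite addrAC subrr add0r; apply: rpred_sum => i _.
  by apply/rpredZ/memv_span/mem_nth; rewrite size_tuple.
have radial q f g : E q -> (forall y, E y -> dot f (y - q) = 0) ->
    (forall y, E y -> dot g (y - q) = 0) -> enorm f = enorm g -> D (q + f) = D (q + g).
  by move=> _ fE gE fg; rewrite /D !DmuE (riesz_orthogonal _ _ fE) (riesz_orthogonal _ _ gE) fg.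
have [c c0 Dc] := dist_proportional mn EiffX Ecl grad_gt0 grad_const Ddist radial.
have [u0 u00 uX] := orthogonal_vector X mn.
have nu0 : 0 < enorm u0 by rewrite enorm_gt0.
have u1 : enorm ((enorm u0)^-1 *: u0) = 1.
  by rewrite enormZ gtr0_norm ?invr_gt0 // mulVf // gt_eqF.
have rfin := riesz_fin d_gt0 alpha_gt0 Ecl E0 grad_gt0.
split; [|split; last by exists c].
  exists m; split=> //; exists a, <<X>>%VS; split.
    by move/eqP: freeX => ->; rewrite size_tuple.
  by apply/seteqP; split => x /EiffX.
apply: (@measure_eq_hausdorff _ _ _ d alpha C (c `^ (- alpha)) E X a mu) => //.
  exact: powR_gt0.
move=> q t Eq t0; apply: (ext_kernel_integral alpha_gt0 c0 mE E0 rfin Dc u1 Eq t0).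
by move=> y Ey; rewrite dotZl uX ?mulr0 //; exact: (plane_sub EiffX).
Qed.
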